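(* Let $X=(X_t)_{t\ge0}$ be a real-valued Markov chain, $f_0:\mathbb{R}\to\mathbb{R}$ and $x_0\in\mathbb{R}$. Assume: (1) $X$ is a Harris recurrent, aperiodic, irreducible Markov chain which is either positive recurrent or $\beta$-null recurrent ($\beta\in(0,1)$), and whose kernel satisfies $P(x,A)\ge s(x)\nu(A)$ for all $x\in E$, $A\in\mathcal{E}$, where $s$ is measurable with $0\le s\le1$, $\nu$ is a probability measure and $\int_E s\,d\nu>0$. (2) There is $\delta>0$ such that $C=[x_0-\delta,x_0+\delta]$ is a small set. (3) $x_0$ belongs to the interior of the support of the chain (the support of $\pi$). (4) $f_0$ is non-increasing, and $f_0$ and $F(y)=\pi(C\cap(-\infty,y])/\pi(C)$ are differentiable on $C$, with derivatives $f_0'$ and $F'$ bounded, in absolute value, above and away from zero on $C$. (5) $\ell_C(\mathcal{B}_1)=\sum_{t\in\mathcal{B}_1}\mathbb{I}\{X_t\in C\}$, the number of visits to $C$ during one regeneration block, has a finite second moment. Let $T_n(C)=\sum_{t=0}^n\mathbb{I}\{X_t\in C\}$ and $F_n(y)=\frac1{T_n(C)}\sum_{t=0}^n\mathbb{I}\{X_t\in C,X_t\le y\}$. Then, for all sufficiently small $\epsilon>0$, as $n\to\infty$, $$T_n(C)\sup_{|y-x_0|\le\epsilon}|F_n(y)-F(y)|^2=O_P(1)$$ and $$T_n(C)\sup_{|p-F(x_0)|\le\epsilon}|F_n^{-1}(p)-F^{-1}(p)|^2=O_P(1).$$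
   Context: Chain. $E\subseteq\mathbb{R}$ is the state space with countably generated $\sigma$-algebra $\mathcal{E}$ (Borel sets), $P(x,A)$ the transition kernel, $\psi$ the maximal irreducibility measure. Harris recurrent: for all $x\in E$ and $A\in\mathcal{E}$ with $\psi(A)>0$, $\mathbb{P}(X_n\in A\text{ infinitely often}\mid X_0=x)=1$. Such a chain has a $\sigma$-finite invariant measure $\pi$, unique up to a multiplicative constant; it is positive recurrent if $\pi(E)<\infty$ and null recurrent otherwise. A function $h\ge0$ with $\psi(\{h>0\})>0$ is small if there are an integer $m_0\ge1$ and a nonzero positive measure $\nu'$ with $P^{m_0}(x,B)\ge h(x)\nu'(B)$ for all $x,B$; a set is small if its indicator is a small function; a small set $A$ satisfies $0<\pi(A)<\infty$. A null recurrent chain is $\beta$-null recurrent if there are a small nonnegative function $h$, a probability measure $\mu$, $\beta\in(0,1)$ and a slowly varying function $L_h$ such that $\mathbb{E}_\mu(\sum_{t=0}^n h(X_t))\sim\frac{1}{\Gamma(1+\beta)}n^\beta L_h(n)$ as $n\to\infty$. Split chain. The split chain $(X_n,\xi_n)_{n\ge0}$ on $E\times\{0,1\}$ is defined by: given the past and $X_n=x$, $\xi_n$ is Bernoulli with parameter $s(x)$; given $X_n=x,\xi_n=1$, $X_{n+1}\sim\nu$; given $X_n=x,\xi_n=0$, $X_{n+1}\sim(P(x,\cdot)-s(x)\nu)/(1-s(x))$. $\check\alpha=E\times\{1\}$ is an atom, $\tau_{\check\alpha}(k)$ is the $k$-th time $n\ge1$ with $\xi_n=1$, and the regeneration blocks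 are $\mathcal{B}_j=(X_{\tau_{\check\alpha}(j)+1},\dots,X_{\tau_{\check\alpha}(j+1)})$, $j\ge1$; they are i.i.d. Inverses. $F^{-1}$ is the inverse of $F$ on $C$. Let $Y_1<\dots<Y_m$ be the ordered distinct values among the $X_t$, $0\le t\le n$, lying in $C$ (there are such values for all large $n$ a.s.), and $Y_0<Y_1$ an arbitrary random variable. $F_n^{-1}(a)$, for $a\le F_n(Y_m)=1$, is the smallest $y\in[Y_0,Y_m]$ with $F_n(y)\ge a$. *)

(* Defs.v *)
From mathcomp Require Import all_boot all_order all_algebra.
From mathcomp Require Import all_classical all_reals all_analysis.

Set Implicit Arguments.
Unset Strict Implicit.
Unset Printing Implicit Defensive.
Import Order.TTheory GRing.Theory Num.Theory.
Import numFieldNormedType.Exports.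

Local Open Scope classical_set_scope.
Local Open Scope ring_scope.

(* A state space E included in R, with the trace of the Borel sigma-algebra, is
   given by a measurable space S and an injection val : S -> R whose range is E
   and for which the measurable sets of S are the preimages of Borel sets. *)
Definition borel_embedding (R : realType) (d : measure_display)
    (S : measurableType d) (val : S -> R) : Prop :=
  injective val /\
  (@measurable d S) = preimage_set_system setT val (@measurable _ R).

Fixpoint kiter (R : realType) (d : measure_display) (S : measurableType d)
    (P : R.-pker S ~> S) (n : nat) (x : S) (A : set S) : \bar R :=
  if n is m.+1 then (\int[P x]_y kiter P m y A)%E else \d_x A.

(* sigma(Y_0, ..., Y_(n-1)) *)
Definition history (d d' : measure_display) (Omega : measurableType d)
    (T : measurableType d') (Y : nat -> Omega -> T) (n : nat) :
    set (set Omega) :=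
  <<s \bigcup_(k in `I_n) preimage_set_system setT (Y k) measurable >>.

Definition markov_chain (R : realType) (d d' : measure_display)
    (S : measurableType d) (Omega : measurableType d') (P : R.-pker S ~> S)
    (Pr : probability Omega R) (X : nat -> {mfun Omega >-> S}) : Prop :=
  forall (n : nat) (H : set Omega) (B : set S),
    history X n.+1 H -> measurable B ->
    Pr (H `&` X n.+1 @^-1` B) = (\int[Pr]_(w in H) P (X n w) B)%E.

Definition initial_law (R : realType) (d d' : measure_display)
    (S : measurableType d) (Omega : measurableType d')
    (Pr : probability Omega R) (X : nat -> {mfun Omega >-> S})
    (mu : set S -> \bar R) : Prop :=
  forall A : set S, measurable A -> Pr (X 0%N @^-1` A) = mu A.

Section kernel_notions.
Context (R : realType) (d : measure_display) (S : measurableType d).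
Variable P : R.-pker S ~> S.

Definition irreducibility_measure (phi : {measure set S -> \bar R}) : Prop :=
  (0 < phi setT)%E /\
  forall A : set S, measurable A -> (0 < phi A)%E ->
    forall x : S, exists2 n : nat, (0 < n)%N & (0 < kiter P n x A)%E.

Definition maximal_irreducibility_measure
    (psi : {sigma_finite_measure set S -> \bar R}) : Prop :=
  irreducibility_measure psi /\
  forall phi : {sigma_finite_measure set S -> \bar R},
    irreducibility_measure phi -> phi `<< psi.

Definition d_cycle (psi : {measure set S -> \bar R}) (k : nat)
    (D : nat -> set S) : Prop :=
  [/\ forall i, (i < k)%N -> measurable (D i),
      trivIset `I_k D,
      forall i x, (i < k)%N -> D i x -> P x (D (i.+1 %% k)%N) = 1%E
    & psi (~` \bigcup_(i in `I_k) D i) = 0%E].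

(* The period is the largest length of a cycle; there is always one of length 1. *)
Definition aperiodic (psi : {measure set S -> \bar R}) : Prop :=
  forall (k : nat) (D : nat -> set S), (0 < k)%N -> d_cycle psi k D -> k = 1%N.

(* The law of a chain with a given kernel and initial law is unique, so any
   realization (Omega, Pr, X) of the chain started at x computes
   Pr (X_n \in A infinitely often | X_0 = x). *)
Definition harris_recurrent (psi : {measure set S -> \bar R}) : Prop :=
  forall (x : S) (A : set S), measurable A -> (0 < psi A)%E ->
    exists (d' : measure_display) (Omega : measurableType d')
      (Pr : probability Omega R) (X : nat -> {mfun Omega >-> S}),
      [/\ markov_chain P Pr X, initial_law Pr X \d_x
        & Pr (lim_sup_set (fun n => X n @^-1` A)) = 1%E].

Definition invariant_measure (pi : {measure set S -> \bar R}) : Prop :=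
  (0 < pi setT)%E /\
  forall A : set S, measurable A -> (\int[pi]_x P x A)%E = pi A.

Definition small_function (psi : {measure set S -> \bar R}) (h : S -> R) :
    Prop :=
  [/\ measurable_fun setT h, forall x, 0 <= h x, (0 < psi [set x | (0 < h x)%R])%E
    & exists (m0 : nat) (nu' : {measure set S -> \bar R}),
        [/\ (0 < m0)%N, (0 < nu' setT)%E
          & forall x B, measurable B ->
              ((h x)%:E * nu' B <= kiter P m0 x B)%E]].

Definition small_set (psi : {measure set S -> \bar R}) (A : set S) : Prop :=
  measurable A /\ small_function psi \1_A.

Definition positive_recurrent (pi : {measure set S -> \bar R}) : Prop :=
  (pi setT < +oo)%E.

Definition null_recurrent (pi : {measure set S -> \bar R}) : Prop :=
  pi setT = +oo%E.

Definition slowly_varying (L : R -> R) : Prop :=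
  (\forall x \near +oo, 0 < L x) /\
  forall k : R, 0 < k -> (L (k * x) / L x) @[x --> +oo] --> (1 : R).

Definition euler_gamma (a : R) : R :=
  \int[lebesgue_measure]_(t in `]0, +oo[) (t `^ (a - 1) * expR (- t)).

(* E_mu is computed on any realization of the chain with initial law mu. *)
Definition beta_null_recurrent (psi pi : {measure set S -> \bar R}) (beta : R) :
    Prop :=
  null_recurrent pi /\
  exists (h : S -> R) (mu : probability S R) (L : R -> R),
    [/\ small_function psi h, slowly_varying L
      & exists (d' : measure_display) (Omega : measurableType d')
          (Pr : probability Omega R) (X : nat -> {mfun Omega >-> S}),
          [/\ markov_chain P Pr X, initial_law Pr X mu
            & (fun n : nat => fine 'E_Pr[fun w => \sum_(t < n.+1) h (X t w)])
                ~_\oo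
              (fun n : nat =>
                 (euler_gamma (1 + beta))^-1 * n%:R `^ beta * L n%:R)]].

Definition minorized (s : S -> R) (nu : probability S R) : Prop :=
  [/\ measurable_fun setT s, forall x, 0 <= s x <= 1,
      forall x A, measurable A -> ((s x)%:E * nu A <= P x A)%E
    & (0 < \int[nu]_x (s x)%:E)%E].

Definition residual_kernel (s : S -> R) (nu : probability S R) (x : S)
    (B : set S) : \bar R :=
  ((P x B - (s x)%:E * nu B) * ((1 - s x)^-1)%:E)%E.

End kernel_notions.

Section split_chain.
Context (R : realType) (d d' : measure_display) (S : measurableType d).
Context (Omega : measurableType d').
Variables (X : nat -> {mfun Omega >-> S}) (xi : nat -> {mfun Omega >-> bool}).

(* sigma(X_0, ..., X_(n-1), xi_0, ..., xi_(m-1)) *)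
Definition split_history (n m : nat) : set (set Omega) :=
  <<s history X n `|` history xi m >>.

Definition split_chain (P : R.-pker S ~> S) (s : S -> R) (nu : probability S R)
    (Pr : probability Omega R) : Prop :=
  [/\ forall n H, split_history n.+1 n H ->
        Pr (H `&` [set w | xi n w]) = (\int[Pr]_(w in H) (s (X n w))%:E)%E,
      forall n H B, split_history n.+1 n.+1 H -> measurable B ->
        Pr (H `&` [set w | xi n w] `&` X n.+1 @^-1` B) =
        (Pr (H `&` [set w | xi n w]) * nu B)%E
    & forall n H B, split_history n.+1 n.+1 H -> measurable B ->
        Pr (H `&` [set w | ~~ xi n w] `&` X n.+1 @^-1` B) =
        (\int[Pr]_(w in H `&` [set w | ~~ xi n w])
           residual_kernel P s nu (X n w) B)%E].

(* n is the k-th time n >= 1 at which xi_n = 1 *)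
Definition regeneration_time (w : Omega) (k n : nat) : Prop :=
  [/\ (0 < n)%N, xi n w & (\sum_(1 <= i < n.+1) xi i w)%N = k].

Definition block (w : Omega) (j : nat) : set nat :=
  [set t | exists a b, [/\ regeneration_time w j a,
                           regeneration_time w j.+1 b & (a < t <= b)%N]].

(* Number of visits to A during the j-th block, j >= 1. It is set to +oo where
   fewer than j.+1 regenerations occur: a moment of it is finite only if the
   block exists almost surely. *)
Definition block_visits (A : set S) (j : nat) (w : Omega) : \bar R :=
  if `[< exists b, regeneration_time w j.+1 b >] then
    (\esum_(t in block w j) (\1_A (X t w))%:E)%E
  else +oo%E.

End split_chain.
Arguments block_visits {R d d' S Omega} X xi A j w.

Definition measure_support (R : realType) (d : measure_display)
    (S : measurableType d) (val : S -> R) (pi : {measure set S -> \bar R}) :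
    set R :=
  [set x | forall e : R, 0 < e -> (0 < pi (val @^-1` ball x e))%E].

Definition local_cdf (R : realType) (d : measure_display)
    (S : measurableType d) (val : S -> R) (pi : {measure set S -> \bar R})
    (C : set R) (y : R) : R :=
  fine (pi (val @^-1` (C `&` `]-oo, y]))) / fine (pi (val @^-1` C)).

(* Derivatives on a closed interval are one-sided at its end points. *)
Definition derivative_within (R : realType) (C : set R) (f : R -> R)
    (y l : R) : Prop :=
  ((f z - f y) / (z - y)) @[z --> within C y^'] --> l.

Definition bounded_derivative_on (R : realType) (C : set R) (f : R -> R) :
    Prop :=
  exists (f' : R -> R) (m M : R), 0 < m /\
    forall y, C y -> derivative_within C f y (f' y) /\ m <= `|f' y| <= M.

(* Empirical quantities of a real sequence x = (x_t)_t localized on C. *)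
Section localized_empirical.
Context (R : realType).
Variables (C : set R) (x : nat -> R) (n : nat).

Definition nvisits : nat := \sum_(t < n.+1) (x t \in C).

Definition emp_cdf (y : R) : R :=
  (\sum_(t < n.+1) ((x t \in C) && (x t <= y)%R))%N%:R / nvisits%:R.

(* Y_1 < ... < Y_m *)
Definition visited : seq R :=
  sort <=%R (undup [seq z <- [seq x t | t <- iota 0 n.+1] | z \in C]).

Definition smallest (A : set R) (y : R) : Prop := A y /\ lbound A y.

Definition emp_inv (y0 : R) (a : R) : R :=
  xget y0 (smallest
    [set y | y0 <= y <= last y0 visited /\ a <= emp_cdf y]).

End localized_empirical.

Definition bounded_in_probability (R : realType) (d : measure_display)
    (Omega : measurableType d) (Pr : probability Omega R)
    (Z : nat -> Omega -> \bar R) : Prop :=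
  forall eta : R, 0 < eta -> exists K : R,
    \forall n \near \oo, (Pr [set w | (K%:E < `|Z n w|)%E] <= eta%:E)%E.

(* Main.v *)
From HB Require Import structures.
Require Import Defs.
From mathcomp Require Import all_boot all_order all_algebra.
From mathcomp Require Import all_classical all_reals all_analysis.
From mathcomp Require Import measurable_realfun.
From mathcomp Require Import ring lra zify.

Set Implicit Arguments.
Unset Strict Implicit.
Unset Printing Implicit Defensive.
Import Order.TTheory GRing.Theory Num.Theory.
Import numFieldNormedType.Exports.

Local Open Scope classical_set_scope.
Local Open Scope ring_scope.


(** Cut the trajectory at its regeneration times.  The pieces that follow the
    first regeneration are independent with a common law [Q], the law of an
    excursion, and the whole proof takes place on the space of paths under [Q].

    Centering.  A step of the kernel [P] either regenerates (with weight
    [s x], from [nu]) or follows the excess [P x - s x * nu]; hence an invariant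
    measure is a multiple of the measure which gives to [A] the mean number of
    visits to [A] in one excursion ([invariant_measure_occupation],
    [integral_excursion_visits]).  For [A] inside [C] the number of visits to
    [A] minus [pi A / pi C] times the number of visits to [C] therefore has mean
    zero over an excursion ([excursion_mean_zero]), so that
    [T_n (F_n y - F y)], read at the regeneration times, is a random walk of
    mean zero for every [y].

    Uniformity in [y].  Within an excursion the number of visits to
    [C] below [y] is monotone in [y] and is at most the number of visits to [C],
    which is square integrable.  Symmetrization replaces the walk by a
    Rademacher sum with the excursions held fixed ([symmetrization]).  The
    increments of that sum have fourth moments at most
    [3 (h j - h i)^2] for a monotone function [h], and bisecting at the median
    of [h] bounds the fourth moment of the supremum by the same expression up to
    a factor, with no loss in the number of points ([chaining]).  So the
    supremum over a grid has second moment at most a constant times the number of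
    excursions times the second moment of the visits
    ([centered_sum_second_moment]), and a maximal inequality makes this uniform
    in the number of excursions ([walk_maximal_inequality]).

    Random number of excursions.  Truncate the durations at [n] and let [md] be
    the mean of the truncated duration.  A truncated duration has second moment
    at most [n * md], so by the inequalities of Markov and Chebyshev the number
    of excursions completed before time [n] lies between two constant
    multiples of [n / md] with probability close to one ([late_renewal],
    [early_renewal]); this holds for finite and for infinite mean durations.  The
    upper multiple bounds the squared deviations, the lower one bounds the
    number of visits [T_n] from below ([few_visits]), and their ratio is bounded
    ([good_excursions], [empirical_deviation]).

    Conclusion.  The function [F] is increasing with slopes between two positive
    constants ([bounded_slope]).  A fine grid then controls all [y]
    ([grid_deviation]), and a uniform bound [D] on [F_n - F] gives the bound
    [D / l] on the difference of the inverses, where [l] is the least slope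
    ([quantile_deviation]).  The probabilities in the statement are those of
    measurable events because a supremum that exceeds a level does so at a
    rational witness ([deviation_rational], [quantile_rational]). *)


(** * Rademacher averages and chaining *)

Section rademacher.
Context (R : realType) (T : Type).
Variable f : T -> nat -> R.

(** The mean of [phi (a + sum of +- f u)] over independent fair signs, as a
    recursion on the list [us], which avoids a probability space of signs. *)
Fixpoint rademacher (us : seq T) (phi : (nat -> R) -> R) (a : nat -> R) : R :=
  if us is u :: us' then
    (rademacher us' phi (fun i => a i + f u i) +
     rademacher us' phi (fun i => a i - f u i)) / 2
  else phi a.

Lemma rademacher_le us phi psi a : (forall v, phi v <= psi v) ->
  rademacher us phi a <= rademacher us psi a.
Proof.
move=> le; elim: us a => [|u us IH] a //=.
by rewrite ler_wpM2r ?invr_ge0 ?lerD.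
Qed.

Lemma rademacher_le0 us phi psi a : (forall u, f u 0%N = 0) ->
  (forall v, v 0%N = 0 -> phi v <= psi v) -> a 0%N = 0 ->
  rademacher us phi a <= rademacher us psi a.
Proof.
move=> f0 le; elim: us a => [|u us IH] a a0 /=; first exact: le.
by rewrite ler_wpM2r ?invr_ge0// lerD ?IH// f0 a0 ?addr0 ?subr0.
Qed.

Lemma rademacherD us phi psi a :
  rademacher us (fun v => phi v + psi v) a =
  rademacher us phi a + rademacher us psi a.
Proof. by elim: us a => [|u us IH] a //=; rewrite !IH; lra. Qed.

Lemma rademacherZ us c phi a :
  rademacher us (fun v => c * phi v) a = c * rademacher us phi a.
Proof. by elim: us a => [|u us IH] a //=; rewrite !IH; lra. Qed.

Lemma rademacher_cst us c a : rademacher us (fun=> c) a = c.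
Proof. by elim: us a => [|u us IH] a //=; rewrite !IH; lra. Qed.

(** Independent signs kill the odd powers, which leaves Khintchine's fourth
    moment inequality started from the increment of [a]. *)
Lemma rademacher_pow4 us i j a :
  rademacher us (fun v => (v j - v i) ^+ 4) a <=
    let x := a j - a i in let q := \sum_(u <- us) (f u j - f u i) ^+ 2 in
    x ^+ 4 + 6 * x ^+ 2 * q + 3 * q ^+ 2.
Proof.
elim: us a => [|u us IH] a /=; first by rewrite big_nil; lra.
rewrite big_cons ler_pdivrMr//.
apply: le_trans (lerD (IH _) (IH _)) _ => /=.
set q := \sum_(_ <- _) _.
have q0 : 0 <= q by apply: sumr_ge0 => ? _; exact: sqr_ge0.
set x := a j - a i; set z := f u j - f u i.
rewrite (_ : a j + f u j - (a i + f u i) = x + z); last by rewrite /x /z; lra.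
rewrite (_ : a j - f u j - (a i - f u i) = x - z); last by rewrite /x /z; lra.
have := sqr_ge0 (z ^+ 2); nra.
Qed.

End rademacher.

Section chaining.
Context (R : realType).

Definition supnorm (m : nat) (v : nat -> R) : R :=
  \big[Num.max/0]_(i < m.+1) `|v i|.

Lemma supnorm_ge0 m v : 0 <= supnorm m v.
Proof. exact: bigmax_ge_id. Qed.

Lemma le_supnorm m v i : (i <= m)%N -> `|v i| <= supnorm m v.
Proof. by move=> im; apply: (le_bigmax _ _ (Ordinal (im : (i < m.+1)%N))). Qed.

Lemma supnorm_le m v x : 0 <= x -> (forall i, (i <= m)%N -> `|v i| <= x) ->
  supnorm m v <= x.
Proof. by move=> x0 vx; apply: bigmax_le => // i _; apply: vx; rewrite -ltnS. Qed.

Definition oscillation (i j : nat) (v : nat -> R) : R :=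
  supnorm (j - i) (fun l => v (i + l)%N - v i).

(** The oscillation on [i..j] is cut at [r]; the left part stops at [r - 1] so
    that the two halves do not share the jump at [r]. *)
Lemma oscillation_split i r j v : (i < r)%N -> (r <= j)%N ->
  oscillation i j v <= Num.max (oscillation i r.-1 v) (oscillation r j v) + `|v r - v i|.
Proof.
move=> ir rj; apply: supnorm_le => [|l lji].
  by rewrite addr_ge0// le_max supnorm_ge0.
have [lr|rl] := ltnP (i + l) r.
  rewrite -[leLHS]addr0 lerD// le_max; apply/orP; left.
  by rewrite (@le_supnorm _ (fun l => v (i + l)%N - v i))//; lia.
rewrite -(subrKA (v r)) (le_trans (ler_normD _ _))// lerD// le_max; apply/orP; right.
have -> : (i + l = r + (i + l - r))%N by lia.
by rewrite (@le_supnorm _ (fun l => v (r + l)%N - v r))//; lia.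
Qed.

(** [216 / 125] is [(6 / 5) ^ 3]: in the chaining this factor, doubled and then
    divided by the gain [4] of a bisection, must stay below one. *)
Lemma max_add_pow4 (a b x : R) : 0 <= a -> 0 <= b -> 0 <= x ->
  (Num.max a b + x) ^+ 4 <= 216 / 125 * (a ^+ 4 + b ^+ 4) + 216 * x ^+ 4.
Proof.
have sq (p q : R) : (p + q) ^+ 2 <= 6 / 5 * p ^+ 2 + 6 * q ^+ 2.
  by have := sqr_ge0 (p - 5 * q); nra.
have key (p q : R) : (p + q) ^+ 4 <= 216 / 125 * p ^+ 4 + 216 * q ^+ 4.
  have h0 := sq p q; have h1 := sq (6 / 5 * p ^+ 2) (6 * q ^+ 2).
  have h2 := sqr_ge0 (p + q).
  have -> : (p + q) ^+ 4 = ((p + q) ^+ 2) ^+ 2 by rewrite -exprM.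
  apply: (@le_trans _ _ ((6 / 5 * p ^+ 2 + 6 * q ^+ 2) ^+ 2)).
    by rewrite ler_sqr ?nnegrE// (le_trans h2 h0).
  by apply: (le_trans h1); nra.
move=> a0 b0 x0; apply: le_trans (key _ _) _.
have a4 := exprn_ge0 4 a0; have b4 := exprn_ge0 4 b0.
rewrite lerD2r ler_wpM2l ?divr_ge0 ?ler0n//; case: (leP a b) => _; rewrite ?lerDl ?lerDr//.
Qed.

Lemma chaining_arith (a b e x y z H : R) : 0 <= x -> 0 <= y -> 0 <= z ->
  x <= H / 2 -> y <= H / 2 -> z <= H ->
  a <= 5000 * x ^+ 2 -> b <= 5000 * y ^+ 2 -> e <= 3 * z ^+ 2 ->
  216 / 125 * (a + b) + 216 * e <= 5000 * H ^+ 2.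
Proof.
move=> x0 y0 z0 xH yH zH ax ay az.
have qx : x ^+ 2 <= (H / 2) ^+ 2 by rewrite ler_sqr ?nnegrE// (le_trans x0).
have qy : y ^+ 2 <= (H / 2) ^+ 2 by rewrite ler_sqr ?nnegrE// (le_trans y0).
have qz : z ^+ 2 <= H ^+ 2 by rewrite ler_sqr ?nnegrE// (le_trans z0).
have qH : (H / 2) ^+ 2 = H ^+ 2 / 4 by field.
clear x0 y0 z0 xH yH zH; have := sqr_ge0 H; lra.
Qed.

(** Strong induction on [j - i].  With [r] the first index where [h] has made half
    of its way from [i] to [j], both halves have an [h]-increment at most half
    of the whole, so their two contributions shrink by a factor [4] each and
    [2 * (216 / 125) / 4 < 1] absorbs them; the jump to [r] costs a multiple of
    [(h j - h i) ^ 2].  Only monotonicity and linearity of [E] enter. *)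
Lemma chaining (E : ((nat -> R) -> R) -> R) (h : nat -> R) :
  (forall phi psi, (forall v, phi v <= psi v) -> E phi <= E psi) ->
  (forall phi psi, E (fun v => phi v + psi v) = E phi + E psi) ->
  (forall c phi, E (fun v => c * phi v) = c * E phi) ->
  (forall i j, (i <= j)%N -> h i <= h j) ->
  (forall i j, (i <= j)%N ->
     E (fun v => (v j - v i) ^+ 4) <= 3 * (h j - h i) ^+ 2) ->
  forall i j, (i <= j)%N ->
    E (fun v => oscillation i j v ^+ 4) <= 5000 * (h j - h i) ^+ 2.
Proof.
move=> Ele ED EZ hh Eh i j ij.
have [n] := ubnP (j - i); elim: n i j ij => // n IH i j.
rewrite leq_eqVlt => /predU1P[<- _|ij jin].
  rewrite subrr expr0n mulr0 -[leRHS](mul0r (E (fun=> 0))) -EZ; apply: Ele => v.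
  by rewrite mul0r /oscillation subnn /supnorm big_ord_recl big_ord0 /= addn0 subrr normr0 maxxx expr0n.
have half0 : 0 <= (h j - h i) / 2 by rewrite divr_ge0// subr_ge0 hh// ltnW.
(* the median index of h *)
have exr : exists r, (i < r)%N && ((h j - h i) / 2 <= h r - h i).
  by exists j; rewrite ij/= ler_pdivrMr//; move: half0; lra.
case: (ex_minnP exr) => r /andP[ir hr] rmin.
have rj : (r <= j)%N by apply: rmin; rewrite ij/= ler_pdivrMr//; move: half0; lra.
have hr1 : h r.-1 - h i <= (h j - h i) / 2.
  have [->|] := eqVneq r.-1 i; first by rewrite subrr.
  move=> ri; rewrite leNgt; apply/negP => hlt.
  by have := rmin r.-1; rewrite (ltW hlt) andbT; clear -ri ir; lia.
have hjr : h j - h r <= (h j - h i) / 2 by lra.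
have [ir1 ir1n jrn] : [/\ (i <= r.-1)%N, (r.-1 - i < n)%N & (j - r < n)%N].
  by clear -ir rj jin; split; lia.
have E1 := IH i r.-1 ir1 ir1n; have E2 := IH r j rj jrn; have E3 := Eh i r (ltnW ir).
have hir := hh i r (ltnW ir); have hrj := hh r j rj; have hir1 := hh i r.-1 ir1.
apply: (@le_trans _ _ (E (fun v => 216 / 125 * (oscillation i r.-1 v ^+ 4 + oscillation r j v ^+ 4)
   + 216 * (v r - v i) ^+ 4))).
  apply: Ele => v.
  apply: (@le_trans _ _ ((Num.max (oscillation i r.-1 v) (oscillation r j v) + `|v r - v i|) ^+ 4)).
    by rewrite lerXn2r ?nnegrE ?addr_ge0 ?supnorm_ge0 ?oscillation_split// le_max supnorm_ge0.
  apply: le_trans (max_add_pow4 _ _ _) _ => //; try exact: supnorm_ge0.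
  by rewrite -normrX (ger0_norm (_ : 0 <= (v r - v i) ^+ 4))// exprn_even_ge0.
rewrite ED !EZ ED.
by apply: chaining_arith E1 E2 E3; rewrite ?subr_ge0// lerD2r.
Qed.

(** Chaining applies with [h i] the sum of [L u * f u i], because
    [(f u j - f u i) ^ 2] is at most [L u * (f u j - f u i)] for a monotone
    [f u] with values in the interval from [0] to [L u].  The second moment
    follows from the fourth one. *)
Lemma rademacher_supnorm (T : Type) (f : T -> nat -> R) (L : T -> R) us m :
  (forall u, f u 0%N = 0) ->
  (forall u i j, (i <= j)%N -> f u i <= f u j) ->
  (forall u i, f u i <= L u) ->
  rademacher f us (fun v => supnorm m v ^+ 2) (fun=> 0) <=
    100 * \sum_(u <- us) L u ^+ 2.
Proof.
move=> f0 fh fL.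
pose h i := \sum_(u <- us) L u * f u i.
have fge0 u i : 0 <= f u i by rewrite -(f0 u) fh.
have L0 u : 0 <= L u by rewrite (le_trans (fge0 u 0%N)).
have hh i j : (i <= j)%N -> h i <= h j.
  by move=> ij; apply: ler_sum => u _; rewrite ler_wpM2l ?fh.
have h0 : h 0%N = 0 by rewrite /h big1// => u _; rewrite f0 mulr0.
have hm : 0 <= h m <= \sum_(u <- us) L u ^+ 2.
  rewrite sumr_ge0//=; first by apply: ler_sum => u _; rewrite expr2 ler_wpM2l.
  by move=> u _; rewrite mulr_ge0.
have step i j : (i <= j)%N ->
    rademacher f us (fun v => (v j - v i) ^+ 4) (fun=> 0) <= 3 * (h j - h i) ^+ 2.
  move=> ij; apply: le_trans (rademacher_pow4 _ _ _ _ _) _ => /=.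
  rewrite subrr !expr0n mulr0 mul0r !add0r ler_pM2l// ler_sqr ?nnegrE.
  - rewrite /h -sumrB; apply: ler_sum => u _; rewrite -mulrBr expr2 ler_wpM2r//.
      by rewrite subr_ge0 fh.
    by rewrite (le_trans _ (fL u j))// gerBl fge0.
  - by apply: sumr_ge0 => u _; exact: sqr_ge0.
  - by rewrite subr_ge0 hh.
have E4 := @chaining (fun phi => rademacher f us phi (fun=> 0)) h
  (fun phi psi le => rademacher_le f us _ le) (fun phi psi => rademacherD f us phi psi _)
  (fun c phi => rademacherZ f us c phi _) hh step 0%N m (leq0n m).
move: hm E4; rewrite h0 subr0; set q := \sum_(_ <- _) _; move=> /andP[hm0 hmq] E4.
(* 2 t x^2 <= x^4 + t^2, and 75^2 > 5000 *)
have X2 (t : R) : 0 < t -> 75 * q <= t ->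
    rademacher f us (fun v => supnorm m v ^+ 2) (fun=> 0) <= t.
  move=> t0 qt.
  rewrite -(@ler_pM2l _ (2 * t)) ?mulr_gt0// -rademacherZ.
  apply: (@le_trans _ _ (rademacher f us (fun v => oscillation 0 m v ^+ 4 + t ^+ 2) (fun=> 0))).
    apply: rademacher_le0 => // v v0.
    rewrite (_ : oscillation 0 m v = supnorm m v); last first.
      by rewrite /oscillation subn0; congr supnorm; apply/funext => l; rewrite add0n v0 subr0.
    rewrite -subr_ge0 (_ : _ - _ = (supnorm m v ^+ 2 - t) ^+ 2); last by ring.
    exact: sqr_ge0.
  rewrite rademacherD rademacher_cst.
  have hq : h m ^+ 2 <= q ^+ 2 by rewrite ler_sqr ?nnegrE// (le_trans hm0).
  have qt2 : (75 * q) ^+ 2 <= t ^+ 2.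
    by rewrite ler_sqr ?nnegrE ?(ltW t0)// mulr_ge0// (le_trans hm0).
  apply: (@le_trans _ _ (5000 * q ^+ 2 + t ^+ 2)); first lra.
  by rewrite (_ : (75 * q) ^+ 2 = 5625 * q ^+ 2) in qt2; [have := sqr_ge0 q; lra|ring].
have q0 : 0 <= q by rewrite (le_trans hm0).
apply/ler_addgt0Pr => e e0; apply: X2; last lra.
by rewrite ltr_wpDl// mulr_ge0.
Qed.
End chaining.

(** * Integrals of real functions *)

Section real_integrals.
Context (R : realType) (d : measure_display) (T : measurableType d).
Local Open Scope ereal_scope.

Lemma le_integral_EFin (mu : {measure set T -> \bar R}) (f g : T -> R) :
  measurable_fun setT f -> measurable_fun setT g ->
  (forall x, 0 <= f x)%R -> (forall x, f x <= g x)%R ->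
  \int[mu]_x (f x)%:E <= \int[mu]_x (g x)%:E.
Proof.
move=> mf mg f0 fg; apply: ge0_le_integral => //.
- by move=> x _; rewrite lee_fin.
- exact/measurable_EFinP.
- exact/measurable_EFinP.
- by move=> x _; rewrite lee_fin.
Qed.

Lemma ge0_integral_EFinD (mu : {measure set T -> \bar R}) (f g : T -> R) :
  measurable_fun setT f -> measurable_fun setT g ->
  (forall x, 0 <= f x)%R -> (forall x, 0 <= g x)%R ->
  \int[mu]_x (f x + g x)%:E = \int[mu]_x (f x)%:E + \int[mu]_x (g x)%:E.
Proof.
move=> mf mg f0 g0; under eq_integral do rewrite EFinD.
by apply: ge0_integralD => //; first [by move=> x _; rewrite lee_fin|exact/measurable_EFinP].
Qed.

Lemma ge0_integral_EFinZ (mu : {measure set T -> \bar R}) (c : R) (f : T -> R) :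
  measurable_fun setT f -> (0 <= c)%R -> (forall x, 0 <= f x)%R ->
  \int[mu]_x (c * f x)%:E = c%:E * \int[mu]_x (f x)%:E.
Proof.
move=> mf c0 f0; under eq_integral do rewrite EFinM.
by apply: ge0_integralZl_EFin => //; first [by move=> x _; rewrite lee_fin|exact/measurable_EFinP].
Qed.

Lemma integral_cst1 (Q : probability T R) (c : \bar R) : \int[Q]_x c = c.
Proof. by rewrite integral_cst// -[X in _ * X]/(Q setT) probability_setT mule1. Qed.

Lemma le_integral_indic (mu : {measure set T -> \bar R}) (A : set T) (c : R) (f : T -> R) :
  measurable A -> measurable_fun setT f -> (0 <= c)%R -> (forall x, 0 <= f x)%R ->
  (forall x, A x -> c <= f x)%R -> c%:E * mu A <= \int[mu]_x (f x)%:E.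
Proof.
move=> mA mf c0 f0 cf.
rewrite -(setIT A) -integral_indic// -ge0_integral_EFinZ//.
apply: le_integral_EFin => // [|x|x].
- by apply: measurable_funM => //; exact: measurable_indic.
- by rewrite mulr_ge0.
- rewrite indicE; case: (boolP (x \in A)) => [|_]; last by rewrite mulr0.
  by rewrite inE mulr1; exact: cf.
Qed.

Lemma measurable_le_fun (f g : T -> R) : measurable_fun setT f -> measurable_fun setT g ->
  measurable [set x | (f x <= g x)%R].
Proof.
move=> mf mg.
rewrite (_ : [set x | _] = setT `&` (fun x => g x - f x)%R @^-1` `[0%R, +oo[%classic); last first.
  by rewrite setTI; apply/seteqP; split => x /=; rewrite in_itv/= andbT subr_ge0.
by apply: measurable_funB.
Qed.

Section mean_zero.
Variables (Q : probability T R) (Z : T -> R).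
Hypotheses (mZ : measurable_fun setT Z) (Z2 : \int[Q]_x (Z x ^+ 2)%:E < +oo).

Lemma square_integrable_integrable : Q.-integrable setT (EFin \o Z).
Proof.
apply: (@le_integrable _ _ _ _ _ measurableT _ (EFin \o (fun x => 1 + Z x ^+ 2)%R)).
- exact/measurable_EFinP.
- move=> x _ /=; rewrite lee_fin [leRHS]ger0_norm ?addr_ge0 ?sqr_ge0//.
  rewrite -(real_normK (num_real (Z x))).
  by move: `|Z x|%R (normr_ge0 (Z x)) => y y0; have := sqr_ge0 (y - 1)%R; have := sqr_ge0 y; nra.
- apply/integrableP; split.
    by apply/measurable_EFinP; apply: measurable_funD => //; exact: measurable_funX.
  under eq_integral => x _ do rewrite /= ger0_norm ?addr_ge0 ?sqr_ge0//.
  rewrite ge0_integral_EFinD//; [|exact: measurable_funX|by move=> x; exact: sqr_ge0].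
  by rewrite integral_cst1 lte_add_pinfty// ltry.
Qed.

Hypothesis Z0 : \int[Q]_x (Z x)%:E = 0.

Lemma integral_sqr_centered (a : R) :
  \int[Q]_x ((a + Z x) ^+ 2)%:E = (a ^+ 2)%:E + \int[Q]_x (Z x ^+ 2)%:E.
Proof.
have iZ := square_integrable_integrable.
have iZ2 : Q.-integrable setT (EFin \o (fun x => Z x ^+ 2)%R).
  apply/integrableP; split; first by apply/measurable_EFinP; exact: measurable_funX.
  by under eq_integral => x _ do rewrite /= ger0_norm ?sqr_ge0//.
have i2 : Q.-integrable setT (EFin \o (fun x => 2 * a * Z x)%R).
  exact: (integrableZl measurableT (2 * a)%R iZ).
have i1 : Q.-integrable setT (EFin \o (fun x => a ^+ 2)%R).
  by apply: finite_measure_integrable_cst.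
rewrite (eq_integral (fun x => ((a ^+ 2)%:E + (2 * a * Z x)%:E) + (Z x ^+ 2)%:E)); last first.
  by move=> x _; rewrite -!EFinD; congr EFin; ring.
rewrite integralD//=; last exact: integrableD.
rewrite integralD//= integral_cst1.
by under eq_integral do rewrite EFinM; rewrite integralZl// Z0 mule0 addr0.
Qed.

End mean_zero.
End real_integrals.

(** * Sums over independent blocks *)

Lemma supnorm_attained (R : realType) m (v : nat -> R) :
  exists2 i, (i <= m)%N & supnorm m v = `|v i|.
Proof.
have [|j _ vj] := @eq_bigmax _ R _ 0 (@ord0 m) predT (fun i : 'I_m.+1 => `|v i|) isT.
  by move=> i _; exact: normr_ge0.
by exists j => //; rewrite -ltnS ltn_ord.
Qed.

Lemma measurable_supnorm (R : realType) d (T : measurableType d) m (v : T -> nat -> R) :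
  (forall i, measurable_fun setT (v^~ i)) ->
  measurable_fun setT (fun t => supnorm m (v t)).
Proof.
move=> mv; rewrite /supnorm; elim: m.+1 v mv => [|n IH] v mv.
  by under eq_fun do rewrite big_ord0; exact: measurable_cst.
under eq_fun do rewrite big_ord_recl/=.
apply: measurable_maxr; first exact: measurableT_comp.
exact: (IH (fun t i => v t i.+1)).
Qed.

Section supnorm2.
Context (R : realType) (m : nat).

Definition supnorm2 (v : nat -> R) : R := supnorm m v ^+ 2.

Lemma supnorm2_ge0 v : 0 <= supnorm2 v. Proof. exact: sqr_ge0. Qed.

Lemma le_supnorm2 v i : (i <= m)%N -> v i ^+ 2 <= supnorm2 v.
Proof.
by move=> im; rewrite -(real_normK (num_real (v i))) ler_sqr ?nnegrE ?supnorm_ge0// le_supnorm.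
Qed.

Lemma supnorm2_attained v : exists2 i, (i <= m)%N & supnorm2 v = v i ^+ 2.
Proof.
have [i im vi] := supnorm_attained m v; exists i => //.
by rewrite /supnorm2 vi real_normK// num_real.
Qed.

Lemma supnorm2_midpoint (a b : nat -> R) :
  supnorm2 (fun i => (a i + b i) / 2) <= (supnorm2 a + supnorm2 b) / 2.
Proof.
have [i im ->] := supnorm2_attained (fun i => (a i + b i) / 2).
apply: (@le_trans _ _ ((a i ^+ 2 + b i ^+ 2) / 2)); last first.
  by rewrite ler_wpM2r ?invr_ge0// lerD ?le_supnorm2.
by have := sqr_ge0 (a i - b i); nra.
Qed.

Lemma measurable_supnorm2 d (T : measurableType d) (v : T -> nat -> R) :
  (forall i, measurable_fun setT (v^~ i)) ->
  measurable_fun setT (fun t => supnorm2 (v t)).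
Proof. by move=> mv; apply: measurable_funX; exact: measurable_supnorm. Qed.

End supnorm2.

Section rademacher_convex.
Context (R : realType) (T : Type) (f : T -> nat -> R) (m : nat).
Local Notation rad us := (rademacher f us (@supnorm2 R m)).

Lemma rademacher_supnorm2_ge0 us a : 0 <= rad us a.
Proof.
by elim: us a => [|u us IH] a /=; rewrite ?supnorm2_ge0// divr_ge0// addr_ge0.
Qed.

Lemma rademacher_midpoint us (a b : nat -> R) :
  rad us (fun i => (a i + b i) / 2) <= (rad us a + rad us b) / 2.
Proof.
elim: us a b => [|u us IH] a b /=; first exact: supnorm2_midpoint.
have h1 := IH (fun i => a i + f u i) (fun i => b i + f u i).
have h2 := IH (fun i => a i - f u i) (fun i => b i - f u i).
rewrite (_ : (fun i => (a i + b i) / 2 + f u i) =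
             (fun i => (a i + f u i + (b i + f u i)) / 2)); last first.
  by apply/funext => i; lra.
rewrite (_ : (fun i => (a i + b i) / 2 - f u i) =
             (fun i => (a i - f u i + (b i - f u i)) / 2)); last first.
  by apply/funext => i; lra.
lra.
Qed.

Lemma measurable_rademacher d (X : measurableType d) us (a : X -> nat -> R) :
  (forall i, measurable_fun setT (a^~ i)) ->
  measurable_fun setT (fun t => rad us (a t)).
Proof.
elim: us a => [|u us IH] a ma /=; first exact: measurable_supnorm2.
apply: measurable_funM => //; apply: measurable_funD; apply: IH => i.
  exact: measurable_funD.
exact: measurable_funB.
Qed.

End rademacher_convex.

(** A linear map of the vectors can be moved from the summands to the
    functional. *)
Lemma rademacher_map (R : realType) (T : Type) (f g : T -> nat -> R)
    (L : (nat -> R) -> nat -> R) us phi a :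
  (forall v u, L (fun i => v i + g u i) = (fun i => L v i + f u i)) ->
  (forall v u, L (fun i => v i - g u i) = (fun i => L v i - f u i)) ->
  rademacher f us phi (L a) = rademacher g us (phi \o L) a.
Proof.
move=> LD LB; elim: us a => [|u us IH] a //=.
by rewrite -LD -LB !IH.
Qed.

Section regenerative_system.
Context (R : realType) (d dB : measure_display) (W : measurableType d)
  (B : measurableType dB) (Q : probability W R) (beta : W -> B) (sigma : W -> W).

(** [beta u] is the first block of [u] and [sigma u] the rest: under [Q] the rest
    is independent of the first block and has the law [Q] again.  This one-step
    form replaces an infinite product of block laws: every moment below is
    computed by induction on the number of blocks. *)
Definition regenerative :=
  [/\ measurable_fun setT beta, measurable_fun setT sigma &
  forall F : B * W -> \bar R, measurable_fun setT F -> (forall z, 0 <= F z)%E ->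
    (\int[Q]_u F (beta u, sigma u) = \int[Q]_u \int[Q]_v F (beta u, v))%E].

Hypothesis reg : regenerative.

Let mbeta : measurable_fun setT beta. Proof. by case: reg. Qed.
Let msigma : measurable_fun setT sigma. Proof. by case: reg. Qed.

Lemma regenerativeE (F : B -> W -> R) :
  measurable_fun setT (fun z : B * W => F z.1 z.2) -> (forall b v, 0 <= F b v) ->
  (\int[Q]_u (F (beta u) (sigma u))%:E = \int[Q]_u \int[Q]_v (F (beta u) v)%:E)%E.
Proof.
case: reg => _ _ rg mF F0; apply: (rg (fun z => (F z.1 z.2)%:E)).
  exact/measurable_EFinP.
by move=> z; rewrite lee_fin.
Qed.

Definition block_sum (f : B -> R) k u : R := \sum_(x <- traject sigma u k) f (beta x).

Lemma block_sumS f k u : block_sum f k.+1 u = f (beta u) + block_sum f k (sigma u).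
Proof. by rewrite /block_sum trajectS big_cons. Qed.

Lemma block_sum_ge0 f k u : (forall b, 0 <= f b) -> 0 <= block_sum f k u.
Proof. by move=> f0; apply: sumr_ge0. Qed.

Lemma block_sum_ge_term f k n u : (forall b, 0 <= f b) -> (k < n)%N ->
  f (beta (iter k sigma u)) <= block_sum f n u.
Proof.
move=> f0; elim: k n u => [|k IH] [//|n] u kn; rewrite block_sumS.
  by rewrite lerDl block_sum_ge0.
by rewrite iterSr (le_trans (IH n _ _))// lerDr.
Qed.

Lemma measurable_block_sum f k : measurable_fun setT f -> measurable_fun setT (block_sum f k).
Proof.
move=> mf; elim: k => [|k IH].
  by rewrite (_ : block_sum f 0 = cst 0)//; apply/funext => u; rewrite /block_sum big_nil.
rewrite (_ : block_sum f k.+1 = fun u => f (beta u) + block_sum f k (sigma u)); last first.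
  by apply/funext => u; exact: block_sumS.
by apply: measurable_funD; [exact: measurableT_comp|exact: measurableT_comp].
Qed.

Lemma measurable_block_sum_comp f k dT (T : measurableType dT) (v : T -> W) :
  measurable_fun setT f -> measurable_fun setT v ->
  measurable_fun setT (fun t => block_sum f k (v t)).
Proof. by move=> mf mv; exact: (measurableT_comp (measurable_block_sum k mf)). Qed.

Lemma measurable_fst_comp (f : B -> R) dT (T : measurableType dT) :
  measurable_fun setT f -> measurable_fun setT (fun z : B * T => f z.1 : R).
Proof. by move=> mf; exact: measurableT_comp. Qed.

Lemma integral_block_sum (f : B -> R) k : measurable_fun setT f -> (forall b, 0 <= f b) ->
  (\int[Q]_u (block_sum f k u)%:E = k%:R%:E * \int[Q]_u (f (beta u))%:E)%E.
Proof.
move=> mf f0; elim: k => [|k IH].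
  by rewrite mul0e; under eq_integral do rewrite /block_sum big_nil; rewrite integral0.
under eq_integral do rewrite block_sumS.
rewrite (@regenerativeE (fun b v => f b + block_sum f k v)).
- under eq_integral => u _.
    rewrite ge0_integral_EFinD//; last by move=> ?; exact: block_sum_ge0.
      rewrite integral_cst1 IH; over.
    exact: measurable_block_sum.
  rewrite ge0_integralD//=; last 3 first.
  + by move=> u _; rewrite lee_fin.
  + by apply/measurable_EFinP; exact: measurableT_comp.
  + by move=> u _; rewrite mule_ge0// integral_ge0// => ? _; rewrite lee_fin.
  rewrite integral_cst1 -[in RHS]natr1 EFinD ge0_muleDl ?lee_fin// mul1e addeC//.
- by apply: measurable_funD; [exact: measurable_fst_comp|exact: measurable_block_sum_comp].
- by move=> b v; rewrite addr_ge0// block_sum_ge0.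
Qed.

Lemma markov_block_sum (f : B -> R) k (t : R) : measurable_fun setT f -> (forall b, 0 <= f b) -> 0 <= t ->
  (t%:E * Q [set u | (t <= block_sum f k u)%R] <= k%:R%:E * \int[Q]_u (f (beta u))%:E)%E.
Proof.
move=> mf f0 t0; rewrite -integral_block_sum//; apply: le_integral_indic => //.
- by apply: measurable_le_fun => //; exact: measurable_block_sum.
- exact: measurable_block_sum.
- by move=> u; exact: block_sum_ge0.
Qed.

Section centered_sum.
Variable g : B -> R.
Hypotheses (mg : measurable_fun setT g) (g2 : (\int[Q]_u (g (beta u) ^+ 2)%:E < +oo)%E)
  (g0 : (\int[Q]_u (g (beta u))%:E = 0)%E).

(** The variance of a sum of independent centered blocks, with a starting point [a]
    so that the induction can absorb the first block into it. *)
Lemma integral_sqr_block_sum k (a : R) :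
  (\int[Q]_u ((a + block_sum g k u) ^+ 2)%:E =
   (a ^+ 2)%:E + k%:R%:E * \int[Q]_u (g (beta u) ^+ 2)%:E)%E.
Proof.
elim: k a => [|k IH] a.
  rewrite mul0e adde0; under eq_integral do rewrite /block_sum big_nil addr0.
  by rewrite integral_cst1.
under eq_integral do rewrite block_sumS addrA.
rewrite (@regenerativeE (fun b v => (a + g b + block_sum g k v) ^+ 2)).
- under eq_integral do rewrite IH.
  rewrite ge0_integralD//=; last 3 first.
  + by move=> u _; rewrite lee_fin sqr_ge0.
  + apply/measurable_EFinP; apply: measurable_funX; apply: measurable_funD => //.
    exact: measurableT_comp.
  + by move=> u _; rewrite mule_ge0// integral_ge0// => ? _; rewrite lee_fin sqr_ge0.
  rewrite integral_cst1 (@integral_sqr_centered _ _ _ Q (g \o beta))//; last first.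
    exact: measurableT_comp.
  rewrite -[in RHS]natr1 EFinD ge0_muleDl ?lee_fin// mul1e -addeA; congr (_ + _)%E.
  by rewrite addeC.
- apply: measurable_funX; apply: measurable_funD; last exact: measurable_block_sum_comp.
  by apply: measurable_funD => //; exact: measurable_fst_comp.
- by move=> b v; exact: sqr_ge0.
Qed.

End centered_sum.
End regenerative_system.

(** * Lower tails and symmetrization *)

Lemma measurable_integral_EFin (R : realType) d1 d2 (X : measurableType d1)
    (Y : measurableType d2) (Q : probability Y R) (F : X -> Y -> R) :
  measurable_fun setT (fun z : X * Y => F z.1 z.2) -> (forall x y, 0 <= F x y) ->
  measurable_fun setT (fun x => \int[Q]_y (F x y)%:E)%E.
Proof.
move=> mF F0.
apply: (@measurable_fun_fubini_tonelli_F _ _ _ _ _ Q (fun z => (F z.1 z.2)%:E)).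
  exact/measurable_EFinP.
by move=> z; rewrite lee_fin.
Qed.

Section tails_and_symmetrization.
Context (R : realType) (d dB : measure_display) (W : measurableType d)
  (B : measurableType dB) (Q : probability W R) (beta : W -> B) (sigma : W -> W).
Hypothesis reg : regenerative Q beta sigma.

Let mbeta : measurable_fun setT beta. Proof. by case: reg. Qed.
Let msigma : measurable_fun setT sigma. Proof. by case: reg. Qed.
Local Notation block_sum := (block_sum beta sigma).

(** Chebyshev's inequality at half of the mean, with the variance bounded by the
    second moment. *)
Lemma block_sum_lower_tail (f : B -> R) k (mu : R) : measurable_fun setT f ->
  (\int[Q]_u (f (beta u) ^+ 2)%:E < +oo)%E -> (\int[Q]_u (f (beta u))%:E = mu%:E)%E ->
  0 <= mu ->
  (((k%:R * mu / 2) ^+ 2)%:E * Q [set u | (block_sum f k u <= k%:R * mu / 2)%R] <=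
   k%:R%:E * \int[Q]_u (f (beta u) ^+ 2)%:E)%E.
Proof.
move=> mf f2 fmu mu0.
have mfb : measurable_fun setT (f \o beta) by exact: measurableT_comp.
pose g b := f b - mu.
have mg : measurable_fun setT g by apply: measurable_funB.
have mgb : measurable_fun setT (g \o beta) by exact: measurableT_comp.
have if1 := square_integrable_integrable mfb f2.
have g0 : (\int[Q]_u (g (beta u))%:E = 0)%E.
  under eq_integral do rewrite EFinB.
  rewrite integralB_EFin//; last exact: finite_measure_integrable_cst.
  by rewrite fmu /= integral_cst1 subee.
have g2 : (\int[Q]_u (g (beta u) ^+ 2)%:E < +oo)%E.
  apply: (@le_lt_trans _ _ (\int[Q]_u (2 * f (beta u) ^+ 2 + 2 * mu ^+ 2)%:E)%E).
    apply: le_integral_EFin => [||x|x].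
    - exact: measurable_funX.
    - apply: measurable_funD => //; apply: measurable_funM => //; exact: measurable_funX.
    - exact: sqr_ge0.
    - by rewrite /g; have := sqr_ge0 (f (beta x) + mu); nra.
  rewrite ge0_integral_EFinD//; last 3 first.
  - by apply: measurable_funM => //; exact: measurable_funX.
  - by move=> x; rewrite mulr_ge0 ?sqr_ge0.
  - by move=> x; rewrite mulr_ge0 ?sqr_ge0.
  rewrite integral_cst1 ge0_integral_EFinZ//; last 2 first.
  - exact: measurable_funX.
  - by move=> x; exact: sqr_ge0.
  by rewrite lte_add_pinfty ?ltry// lte_mul_pinfty.
have g2f2 : (\int[Q]_u (g (beta u) ^+ 2)%:E <= \int[Q]_u (f (beta u) ^+ 2)%:E)%E.
  rewrite [leRHS](eq_integral (fun u => ((mu + (g \o beta) u) ^+ 2)%:E)); last first.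
    by move=> u _; rewrite /g /= (addrC mu) subrK.
  by rewrite integral_sqr_centered// leeDr// lee_fin sqr_ge0.
have sg u : block_sum g k u = block_sum f k u - k%:R * mu.
  elim: k u => [|k IH] u; first by rewrite /block_sum !big_nil mul0r subr0.
  by rewrite !block_sumS IH /g -natr1; ring.
apply: (@le_trans _ _ (\int[Q]_u ((0 + block_sum g k u) ^+ 2)%:E)%E); last first.
  rewrite (integral_sqr_block_sum reg)// expr0n/= add0e.
  by apply: lee_pmul => //; rewrite ?lee_fin// integral_ge0// => ? _; rewrite lee_fin sqr_ge0.
apply: le_integral_indic => [||||u].
- by apply: measurable_le_fun => //; exact: (measurable_block_sum reg).
- by apply: measurable_funX; apply: measurable_funD => //; exact: (measurable_block_sum reg).
- exact: sqr_ge0.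
- by move=> u; exact: sqr_ge0.
- rewrite /= => ule; rewrite add0r sg -[leRHS]sqrrN ler_sqr ?nnegrE.
  + lra.
  + by rewrite divr_ge0// mulr_ge0.
  + by have : 0 <= k%:R * mu by [rewrite mulr_ge0]; lra.
Qed.

Section jensen.
Variables (m : nat) (T : Type) (f : T -> nat -> R) (Z : W -> nat -> R).
Hypotheses (mZ : forall i, measurable_fun setT (Z^~ i))
  (Z2 : forall i, (\int[Q]_u (Z u i ^+ 2)%:E < +oo)%E)
  (Z0 : forall i, (\int[Q]_u (Z u i)%:E = 0)%E).

(** Adding centered noise increases the mean of a convex function.  The supremum
    of squares is reduced to the coordinate where it is attained at [a], so that
    only the variance formula is needed. *)
Lemma rademacher_jensen us (a : nat -> R) :
  ((rademacher f us (@supnorm2 R m) a)%:E <=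
   \int[Q]_u (rademacher f us (@supnorm2 R m) (fun i => a i + Z u i))%:E)%E.
Proof.
elim: us a => [|x us IH] a /=.
  have [i im ->] := supnorm2_attained m a.
  apply: (@le_trans _ _ (\int[Q]_u ((a i + Z u i) ^+ 2)%:E)%E).
    rewrite integral_sqr_centered// leeDl// integral_ge0// => u _.
    by rewrite lee_fin sqr_ge0.
  apply: le_integral_EFin => [||u|u].
  - by apply: measurable_funX; exact: measurable_funD.
  - by apply: measurable_supnorm2 => j; exact: measurable_funD.
  - exact: sqr_ge0.
  - exact: (@le_supnorm2 _ _ (fun i => a i + Z u i)).
rewrite (eq_integral (fun u => (2^-1 *
    (rademacher f us (supnorm2 m) (fun i => a i + f x i + Z u i) +
     rademacher f us (supnorm2 m) (fun i => a i - f x i + Z u i)))%:E)); last first.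
  move=> u _; congr EFin; rewrite (mulrC 2^-1).
  by congr (_ / _); congr (_ + _); congr rademacher; apply/funext => i; rewrite addrAC.
have mr b : measurable_fun setT
    (fun u => rademacher f us (supnorm2 m) (fun i => b i + Z u i)).
  by apply: measurable_rademacher => i; exact: measurable_funD.
rewrite ge0_integral_EFinZ//; last 2 first.
- exact: measurable_funD.
- by move=> u; rewrite addr_ge0 ?rademacher_supnorm2_ge0.
rewrite ge0_integral_EFinD//; try by move=> u; exact: rademacher_supnorm2_ge0.
by rewrite mulrC EFinM lee_wpmul2l ?lee_fin ?invr_ge0// EFinD leeD.
Qed.

End jensen.

Lemma measurable_rademacher_traject (m : nat) (f : B -> nat -> R) k dT
    (T : measurableType dT) (a : T -> nat -> R) (v : T -> W) :
  (forall i, measurable_fun setT (f^~ i)) ->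
  (forall i, measurable_fun setT (a^~ i)) -> measurable_fun setT v ->
  measurable_fun setT (fun t =>
    rademacher (f \o beta) (traject sigma (v t) k) (@supnorm2 R m) (a t)).
Proof.
move=> mf; elim: k a v => [|k IH] a v ma mv /=; first exact: measurable_supnorm2.
have mfv i : measurable_fun setT (fun t => f (beta (v t)) i).
  apply: (measurableT_comp (mf i)); exact: measurableT_comp.
apply: measurable_funM => //; apply: measurable_funD; apply: IH.
- by move=> i; exact: measurable_funD.
- exact: measurableT_comp.
- by move=> i; exact: measurable_funB.
- exact: measurableT_comp.
Qed.

Section symmetrization.
Variables (m : nat) (g : B -> nat -> R).
Hypotheses (mg : forall i, measurable_fun setT (g^~ i))
  (g2 : forall i, (\int[Q]_u (g (beta u) i ^+ 2)%:E < +oo)%E)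
  (g0 : forall i, (\int[Q]_u (g (beta u) i)%:E = 0)%E).

(** The vector-valued random walk started at [a] with steps [g] of the blocks. *)
Definition walk (a : nat -> R) k u i : R := a i + block_sum (g^~ i) k u.
Local Notation g2x := (fun b i => 2 * g b i).
Local Notation rad u k := (rademacher (g2x \o beta) (traject sigma u k) (@supnorm2 R m)).

Lemma walkS a k u : walk a k.+1 u = walk (fun i => a i + g (beta u) i) k (sigma u).
Proof. by apply/funext => i; rewrite /walk block_sumS addrA. Qed.

Lemma walk0 a u : walk a 0 u = a.
Proof. by apply/funext => i; rewrite /walk /block_sum big_nil addr0. Qed.

Lemma measurable_walk dT (T : measurableType dT) (a : T -> nat -> R) (v : T -> W) k i :
  (forall i, measurable_fun setT (a^~ i)) -> measurable_fun setT v ->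
  measurable_fun setT (fun t => walk (a t) k (v t) i).
Proof.
by move=> ma mv; apply: measurable_funD => //; exact: (measurable_block_sum_comp reg).
Qed.

Lemma jensen_walk a k : ((supnorm2 m a)%:E <= \int[Q]_u (supnorm2 m (walk a k u))%:E)%E.
Proof.
have mgb i : measurable_fun setT (fun u => g (beta u) i).
  exact: (measurableT_comp (mg i)).
elim: k a => [|k IH] a.
  by under eq_integral do rewrite walk0; rewrite integral_cst1.
under eq_integral do rewrite walkS.
rewrite (regenerativeE reg (F := fun b v => supnorm2 m (walk (fun i => a i + g b i) k v))).
- apply: le_trans
    (@rademacher_jensen m unit (fun=> fun=> 0) (fun u => g (beta u)) mgb g2 g0 [::] a) _.
  apply: ge0_le_integral => //=.
  + by move=> u _; rewrite lee_fin supnorm2_ge0.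
  + apply/measurable_EFinP; apply: measurable_supnorm2 => i; exact: measurable_funD.
  + apply: (measurable_integral_EFin Q
      (F := fun u v => supnorm2 m (walk (fun i => a i + g (beta u) i) k v))).
      apply: measurable_supnorm2 => i.
      apply: (measurable_walk (a := fun z i => a i + g (beta z.1) i) (v := snd)) => // j.
      by apply: measurable_funD => //; exact: (measurableT_comp (mgb j) measurable_fst).
    by move=> *; exact: supnorm2_ge0.
- apply: measurable_supnorm2 => i.
  apply: (measurable_walk (a := fun z i => a i + g z.1 i) (v := snd)) => // j.
  by apply: measurable_funD => //; exact: (measurableT_comp (mg j) measurable_fst).
- by move=> b v; exact: supnorm2_ge0.
Qed.

(** Subtract an independent copy [g (beta w)] by Jensen's inequality; then
    [x + g u - g w] is the midpoint of [x + 2 g u] and [x - 2 g w], and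
    convexity gives one symmetric sign to the doubled summand. *)
Lemma symmetrization_step us a u :
  ((rademacher (g2x \o beta) us (@supnorm2 R m) (fun i => a i + g (beta u) i))%:E <=
   (2^-1 * rademacher (g2x \o beta) us (@supnorm2 R m) (fun i => a i + 2 * g (beta u) i))%:E +
   \int[Q]_w (2^-1 * rademacher (g2x \o beta) us (@supnorm2 R m)
     (fun i => a i - 2 * g (beta w) i))%:E)%E.
Proof.
have mgb i : measurable_fun setT (fun u => g (beta u) i).
  exact: (measurableT_comp (mg i)).
have mN i : measurable_fun setT (fun w => - g (beta w) i).
  rewrite (_ : (fun w => _) = (fun w => 0 - g (beta w) i)); first exact: measurable_funB.
  by apply/funext => w; rewrite sub0r.
have N2 i : (\int[Q]_w ((- g (beta w) i) ^+ 2)%:E < +oo)%E.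
  by under eq_integral do rewrite sqrrN; exact: g2.
have N0 i : (\int[Q]_w (- g (beta w) i)%:E = 0)%E.
  under eq_integral do rewrite -mulN1r EFinM.
  rewrite (integralZl measurableT (square_integrable_integrable (mgb i) (g2 i))).
  by rewrite g0 mule0.
have mr (c : R) b : measurable_fun setT (fun w => rademacher (g2x \o beta) us (@supnorm2 R m)
    (fun i => b i - c * g (beta w) i)).
  apply: measurable_rademacher => i; apply: measurable_funB => //.
  exact: measurable_funM.
apply: le_trans (rademacher_jensen _ _ mN N2 N0 us _) _.
rewrite -[X in (_ <= X + _)%E](integral_cst1 Q) -ge0_integral_EFinD//; last 3 first.
- exact: measurable_funM.
- by move=> w; rewrite mulr_ge0 ?rademacher_supnorm2_ge0.
- by move=> w; rewrite mulr_ge0 ?rademacher_supnorm2_ge0.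
apply: le_integral_EFin => [||w|w].
- by apply: measurable_rademacher => i; exact: measurable_funD.
- by apply: measurable_funD => //; exact: measurable_funM.
- exact: rademacher_supnorm2_ge0.
- rewrite -mulrDr mulrC.
  apply: le_trans (rademacher_midpoint _ _ _ _ _); rewrite le_eqVlt; apply/orP; left.
  by apply/eqP; congr rademacher; apply/funext => i; field.
Qed.

(** The steps are symmetrized one at a time, the first block being treated after
    the others; its independent copy has the same law, so Tonelli's theorem
    reassembles the two halves into a fair sign.  The price is a factor [2] in
    the summands. *)
Lemma symmetrization a k :
  (\int[Q]_u (supnorm2 m (walk a k u))%:E <= \int[Q]_u (rad u k a)%:E)%E.
Proof.
have mgb i : measurable_fun setT (fun u => g (beta u) i).
  exact: (measurableT_comp (mg i)).
have m2g i : measurable_fun setT (fun b => 2 * g b i) by exact: measurable_funM.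
elim: k a => [|k IH] a.
  by under eq_integral do rewrite walk0.
under eq_integral do rewrite walkS.
rewrite (regenerativeE reg (F := fun b v => supnorm2 m (walk (fun i => a i + g b i) k v))); last 2 first.
- apply: measurable_supnorm2 => i.
  apply: (measurable_walk (a := fun z i => a i + g z.1 i) (v := snd)) => // j.
  by apply: measurable_funD => //; exact: (measurableT_comp (mg j) measurable_fst).
- by move=> b v; exact: supnorm2_ge0.
have mradW dT (T : measurableType dT) (b : T -> nat -> R) (v : T -> W) :
    (forall i, measurable_fun setT (b^~ i)) -> measurable_fun setT v ->
    measurable_fun setT (fun t => rad (v t) k (b t)).
  exact: measurable_rademacher_traject.
pose r (s : R) (b : B) v := 2^-1 * rad v k (fun i => a i + s * (2 * g b i)).
have r0 s b v : 0 <= r s b v by rewrite mulr_ge0 ?rademacher_supnorm2_ge0.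
have mr s dT (T : measurableType dT) (b : T -> B) (v : T -> W) :
    measurable_fun setT b -> measurable_fun setT v ->
    measurable_fun setT (fun t => r s (b t) (v t)).
  move=> mb mv; apply: measurable_funM => //; apply: mradW => // i.
  apply: measurable_funD => //; apply: measurable_funM => //.
  exact: (measurableT_comp (m2g i)).
have -> : (\int[Q]_u (rad u k.+1 a)%:E =
    \int[Q]_u \int[Q]_v (r 1 (beta u) v + r (-1) (beta u) v)%:E)%E.
  rewrite -(regenerativeE reg (F := fun b v => r 1 b v + r (-1) b v)).
  - apply: eq_integral => u _; rewrite /= /r -mulrDr mulrC; congr ((_ * (_ + _))%:E).
      by congr rademacher; apply/funext => i; rewrite mul1r.
    by congr rademacher; apply/funext => i; rewrite mulN1r.
  - by apply: measurable_funD; exact: mr.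
  - by move=> b v; rewrite addr_ge0.
have mint (F : W -> W -> R) : measurable_fun setT (fun z : W * W => F z.1 z.2) ->
    (forall x y, 0 <= F x y) -> measurable_fun setT (fun x => \int[Q]_y (F x y)%:E)%E.
  exact: measurable_integral_EFin.
have int0 (F : W -> R) : (forall x, 0 <= F x) -> (0 <= \int[Q]_x (F x)%:E)%E.
  by move=> F0; apply: integral_ge0 => x _; rewrite lee_fin.
pose h v := (\int[Q]_w (r (-1) (beta w) v)%:E)%E.
have mh : measurable_fun setT h.
  by apply: (mint (fun v w => r (-1) (beta w) v)) => //; exact: mr (measurableT_comp _ _) _.
have h0 v : (0 <= h v)%E by exact: int0.
have mr1 : measurable_fun setT (fun u => \int[Q]_v (r 1 (beta u) v)%:E)%E.
  by apply: (mint (fun u v => r 1 (beta u) v)) => //; exact: mr (measurableT_comp _ _) _.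
have mrb s u : measurable_fun setT (fun v => (r s (beta u) v)%:E).
  by apply/measurable_EFinP; exact: mr.
apply: (@le_trans _ _ (\int[Q]_u \int[Q]_v ((r 1 (beta u) v)%:E + h v))%E).
  apply: ge0_le_integral => //.
  - by move=> u _; apply: int0 => v; exact: supnorm2_ge0.
  - apply: (mint (fun u v => supnorm2 m (walk (fun i => a i + g (beta u) i) k v))).
      apply: measurable_supnorm2 => i.
      apply: (measurable_walk (a := fun z i => a i + g (beta z.1) i) (v := snd)) => // j.
      by apply: measurable_funD => //; exact: (measurableT_comp (mgb j) measurable_fst).
    by move=> *; exact: supnorm2_ge0.
  - apply: (@measurable_fun_fubini_tonelli_F _ _ _ _ _ Q
      (fun z => (r 1 (beta z.1) z.2)%:E + h z.2)%E).
      apply: emeasurable_funD; last exact: measurableT_comp.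
      by apply/measurable_EFinP; exact: mr (measurableT_comp _ _) _.
    by move=> z; rewrite adde_ge0 ?lee_fin.
  - move=> u _; apply: le_trans (IH _) _; apply: ge0_le_integral => //.
    + by move=> v _; rewrite lee_fin rademacher_supnorm2_ge0.
    + by apply/measurable_EFinP; exact: mradW.
    + exact: emeasurable_funD.
    + move=> v _; apply: le_trans (symmetrization_step _ _ _) _.
      rewrite le_eqVlt; apply/orP; left; apply/eqP; congr (_ + _)%E.
        by rewrite /r; congr ((_ * rademacher _ _ _ _)%:E); apply/funext => i; rewrite mul1r.
      apply: eq_integral => w _; rewrite /r.
      by congr ((_ * rademacher _ _ _ _)%:E); apply/funext => i; rewrite mulN1r.
rewrite (eq_integral (fun u => \int[Q]_v (r 1 (beta u) v)%:E + \int[Q]_v h v)%E); last first.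
  by move=> u _; rewrite ge0_integralD// => v _; rewrite lee_fin.
under [leRHS]eq_integral => u _.
  rewrite ge0_integral_EFinD//; try exact: mr.
  over.
rewrite ge0_integralD//; last 2 first.
- by move=> u _; exact: int0.
- by move=> u _; exact: integral_ge0.
rewrite [leRHS]ge0_integralD//; last 3 first.
- by move=> u _; exact: int0.
- by move=> u _; exact: int0.
- by apply: (mint (fun u v => r (-1) (beta u) v)) => //; exact: mr (measurableT_comp _ _) _.
rewrite integral_cst1 /h.
rewrite (@fubini_tonelli _ _ _ _ _ Q Q (fun z => (r (-1) (beta z.1) z.2)%:E)).
- exact: lexx.
- by apply/measurable_EFinP; exact: mr (measurableT_comp _ _) _.
- by move=> z; rewrite lee_fin.
Qed.

End symmetrization.
End tails_and_symmetrization.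

(** * A maximal inequality for monotone block functionals *)

Section maximal_inequality.
Context (R : realType) (d dB : measure_display) (W : measurableType d)
  (B : measurableType dB) (Q : probability W R) (beta : W -> B) (sigma : W -> W).
Hypothesis reg : regenerative Q beta sigma.

Let mbeta : measurable_fun setT beta. Proof. by case: reg. Qed.
Let msigma : measurable_fun setT sigma. Proof. by case: reg. Qed.
Local Notation block_sum := (block_sum beta sigma).

Section walk_maximum.
Variables (m : nat) (g : B -> nat -> R).
Hypotheses (mg : forall i, measurable_fun setT (g^~ i))
  (g2 : forall i, (\int[Q]_u (g (beta u) i ^+ 2)%:E < +oo)%E)
  (g0 : forall i, (\int[Q]_u (g (beta u) i)%:E = 0)%E).
Local Notation walk := (walk beta sigma g).
Variable lam : R.

(** Whether the walk started at [a] reaches a squared supremum norm [lam] within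
    [k] steps, in the recursive form that a decomposition along the first block
    requires. *)
Fixpoint crosses k (a : nat -> R) u : bool :=
  (lam <= supnorm2 m a) ||
  (if k is k'.+1 then crosses k' (fun i => a i + g (beta u) i) (sigma u) else false).

Lemma crossesP k a u j : (j <= k)%N -> lam <= supnorm2 m (walk a j u) -> crosses k a u.
Proof.
elim: k a u j => [|k IH] a u [|j] //= jk; rewrite ?walk0; try by move=> ->.
by rewrite walkS => h; rewrite (IH _ _ j)// orbT.
Qed.

Lemma measurable_crosses k dT (T : measurableType dT) (a : T -> nat -> R) (v : T -> W) :
  (forall i, measurable_fun setT (a^~ i)) -> measurable_fun setT v ->
  measurable_fun setT (fun t => crosses k (a t) (v t)).
Proof.
elim: k a v => [|k IH] a v ma mv /=; apply: measurable_or => //.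
- by apply: measurable_fun_ler => //; exact: measurable_supnorm2.
- by apply: measurable_fun_ler => //; exact: measurable_supnorm2.
- apply: IH; last exact: measurableT_comp.
  move=> i; apply: measurable_funD => //; apply: (measurableT_comp (mg i)).
  exact: measurableT_comp.
Qed.

Lemma measurable_crosses_indicator k dT (T : measurableType dT) (a : T -> nat -> R)
    (v : T -> W) :
  (forall i, measurable_fun setT (a^~ i)) -> measurable_fun setT v ->
  measurable_fun setT (fun t => (crosses k (a t) (v t))%:R : R).
Proof.
move=> ma mv; rewrite (_ : (fun _ => _) =
  fun t => if crosses k (a t) (v t) then 1 else 0); last first.
  by apply/funext => t; case: ifP.
by apply: measurable_fun_ifT => //; exact: measurable_crosses.
Qed.

(** Doob's inequality for the submartingale of squared supremum norms.  If the
    level is already reached at the start, [jensen_walk] says that the final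
    mean is no smaller; otherwise one block is removed and the induction
    hypothesis is integrated. *)
Lemma maximal_inequality_crosses k a : 0 <= lam ->
  (lam%:E * \int[Q]_u (crosses k a u)%:R%:E <= \int[Q]_u (supnorm2 m (walk a k u))%:E)%E.
Proof.
move=> lam0; have mgb i : measurable_fun setT (fun u => g (beta u) i).
  exact: (measurableT_comp (mg i)).
have int1 k' a' : (\int[Q]_u (crosses k' a' u)%:R%:E <= 1)%E.
  rewrite -[leRHS](integral_cst1 Q).
  apply: (@le_integral_EFin _ _ _ _ _ (fun=> 1)) => // [|u].
    exact: (@measurable_crosses_indicator _ _ _ (fun=> a') id).
  by case: crosses.
elim: k a => [|k IH] a.
  under eq_integral do rewrite /= orbF.
  under [leRHS]eq_integral do rewrite walk0.
  rewrite !integral_cst1 -EFinM lee_fin; case: (boolP (lam <= _)) => h /=; first by rewrite mulr1.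
  by rewrite mulr0 supnorm2_ge0.
have [h|h] := leP lam (supnorm2 m a).
  apply: le_trans (jensen_walk reg m mg g2 g0 a k.+1).
  apply: (@le_trans _ _ lam%:E); last by rewrite lee_fin.
  by rewrite -[leRHS]mule1 lee_wpmul2l// lee_fin.
under eq_integral do rewrite /= leNgt h/=.
under [leRHS]eq_integral do rewrite walkS.
rewrite (regenerativeE reg (F := fun b v => (crosses k (fun i => a i + g b i) v)%:R)) //; last first.
  apply: (@measurable_crosses_indicator _ _ (B * W)%type (fun z i => a i + g z.1 i) snd) => // i.
  by apply: measurable_funD => //; exact: (measurableT_comp (mg i) measurable_fst).
rewrite (regenerativeE reg (F := fun b v => supnorm2 m (walk (fun i => a i + g b i) k v))); last 2 first.
- apply: measurable_supnorm2 => i.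
  apply: (measurable_walk reg mg (a := fun z i => a i + g z.1 i) (v := snd)) => // j.
  by apply: measurable_funD => //; exact: (measurableT_comp (mg j) measurable_fst).
- by move=> b v; exact: supnorm2_ge0.
have mc : measurable_fun setT
    (fun u => \int[Q]_v (crosses k (fun i => a i + g (beta u) i) v)%:R%:E)%E.
  apply: (measurable_integral_EFin Q
    (F := fun u v => (crosses k (fun i => a i + g (beta u) i) v)%:R)) => //.
  apply: (@measurable_crosses_indicator _ _ (W * W)%type
    (fun z i => a i + g (beta z.1) i) snd) => // i.
  by apply: measurable_funD => //; exact: (measurableT_comp (mgb i) measurable_fst).
rewrite -ge0_integralZl_EFin//; last first.
  by move=> u _; apply: integral_ge0 => v _; rewrite lee_fin.
apply: ge0_le_integral => //.
- by move=> u _; rewrite mule_ge0 ?lee_fin// integral_ge0// => v _; rewrite lee_fin.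
- exact: measurable_funeM.
- apply: (measurable_integral_EFin Q
      (F := fun u v => supnorm2 m (walk (fun i => a i + g (beta u) i) k v))).
    apply: measurable_supnorm2 => i.
    apply: (measurable_walk reg mg (a := fun z i => a i + g (beta z.1) i) (v := snd)) => // j.
    by apply: measurable_funD => //; exact: (measurableT_comp (mgb j) measurable_fst).
  by move=> *; exact: supnorm2_ge0.
Qed.

Lemma measurable_crosses_set k a : measurable [set u | crosses k a u].
Proof.
have := measurable_crosses k (a := fun (_ : W) i => a i) (v := id).
move=> /(_ (fun i => measurable_cst _) (@measurable_id _ _ _) measurableT [set true]).
by rewrite setTI; apply.
Qed.

Lemma walk_maximal_inequality k a : 0 <= lam ->
  (lam%:E * Q [set u | crosses k a u] <= \int[Q]_u (supnorm2 m (walk a k u))%:E)%E.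
Proof.
move=> lam0; apply: le_trans (maximal_inequality_crosses k a lam0).
rewrite lee_wpmul2l// -[leLHS]mul1e; apply: le_integral_indic => // [||u /= ->//].
  exact: measurable_crosses_set.
exact: (@measurable_crosses_indicator _ _ _ (fun=> a) id).
Qed.

End walk_maximum.

Section monotone_blocks.
Variables (m : nat) (G : B -> nat -> R) (p : nat -> R).
Hypotheses (mG : forall i, measurable_fun setT (G^~ i))
  (G0 : forall b, G b 0%N = 0) (Ghomo : forall b i j, (i <= j)%N -> G b i <= G b j)
  (Gm : forall b i, G b i <= G b m) (p1 : forall i, `|p i| <= 1)
  (G2 : (\int[Q]_u (G (beta u) m ^+ 2)%:E < +oo)%E)
  (Gp : forall i, (\int[Q]_u (G (beta u) i - p i * G (beta u) m)%:E = 0)%E).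

(** The last coordinate [m] carries the total count, so [p i * G b m] is the
    expected share of the coordinate [i]. *)
Definition centered b i : R := G b i - p i * G b m.

Lemma measurable_centered i : measurable_fun setT (centered^~ i).
Proof. by apply: measurable_funB => //; exact: measurable_funM. Qed.

Lemma centered_sqr_le b i : centered b i ^+ 2 <= 4 * G b m ^+ 2.
Proof.
have Gi : 0 <= G b i by rewrite -(G0 b) Ghomo.
have Gmi := Gm b i; have := p1 i; rewrite ler_norml => /andP[pi1 pi2].
rewrite /centered; have h1 : `|G b i - p i * G b m| <= 2 * G b m.
  by rewrite ler_norml; apply/andP; split; nra.
rewrite -(real_normK (num_real (_ - _))) (_ : 4 * _ = (2 * G b m) ^+ 2); last by ring.
by rewrite ler_sqr ?nnegrE//; nra.
Qed.

Lemma centered_sqr_lty i : (\int[Q]_u (centered (beta u) i ^+ 2)%:E < +oo)%E.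
Proof.
have mGb : measurable_fun setT (fun u => G (beta u) m ^+ 2).
  by apply: measurable_funX; exact: (measurableT_comp (mG m)).
apply: (@le_lt_trans _ _ (\int[Q]_u (4 * G (beta u) m ^+ 2)%:E)%E).
  apply: le_integral_EFin => [||u|u].
  - apply: measurable_funX; exact: (measurableT_comp (measurable_centered i)).
  - exact: measurable_funM.
  - exact: sqr_ge0.
  - exact: centered_sqr_le.
rewrite ge0_integral_EFinZ//; last by move=> u; exact: sqr_ge0.
by rewrite lte_mul_pinfty.
Qed.

(** The centering is a linear map of the vector of counts; applying it inside the
    norm reduces centered counts to the monotone counts that chaining can
    handle. *)
Lemma supnorm2_centered (v : nat -> R) :
  supnorm2 m (fun i => 2 * (v i - p i * v m)) <= 16 * supnorm2 m v.
Proof.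
have [i im ->] := supnorm2_attained m (fun i => 2 * (v i - p i * v m)).
rewrite -(real_normK (num_real (2 * _))) (_ : 16 * _ = (4 * supnorm m v) ^+ 2); last first.
  by rewrite /supnorm2; ring.
rewrite ler_sqr ?nnegrE ?mulr_ge0 ?supnorm_ge0// normrM ger0_norm//.
have := ler_normB (v i) (p i * v m); rewrite normrM.
have := le_supnorm v im; have := le_supnorm v (leqnn m); have := p1 i.
have := normr_ge0 (p i); have := normr_ge0 (v m); nra.
Qed.

(** [1600 = 16 * 100]: the factor [16] comes from [supnorm2_centered], the
    factor [100] from [rademacher_supnorm]. *)
Lemma centered_sum_second_moment k :
  (\int[Q]_u (supnorm2 m (walk beta sigma centered (fun=> 0) k u))%:E <=
   (1600 * k%:R)%:E * \int[Q]_u (G (beta u) m ^+ 2)%:E)%E.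
Proof.
have mg i := measurable_centered i.
apply: le_trans (symmetrization reg m mg centered_sqr_lty Gp (fun=> 0) k) _.
have mG2 : measurable_fun setT (fun b => G b m ^+ 2) by exact: measurable_funX.
have G20 b : 0 <= G b m ^+ 2 by exact: sqr_ge0.
apply: (@le_trans _ _ (\int[Q]_u (1600 * block_sum (fun b => G b m ^+ 2) k u)%:E)%E).
  apply: le_integral_EFin => [||u|u].
  - have m2c i : measurable_fun setT (fun b => 2 * centered b i) by exact: measurable_funM.
    exact: (measurable_rademacher_traject reg m k m2c (fun=> measurable_cst _)
      (@measurable_id _ _ _)).
  - by apply: measurable_funM => //; exact: (measurable_block_sum reg).
  - exact: rademacher_supnorm2_ge0.
  - pose L (v : nat -> R) i := 2 * (v i - p i * v m).
    have -> : (fun=> 0) = L (fun=> 0) by apply/funext => i; rewrite /L; ring.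
    rewrite (@rademacher_map _ _ _ (G \o beta)); last 2 first.
    + by move=> v w; apply/funext => i; rewrite /L /centered /=; ring.
    + by move=> v w; apply/funext => i; rewrite /L /centered /=; ring.
    apply: (@le_trans _ _ (rademacher (G \o beta) (traject sigma u k)
      (fun v => 16 * supnorm2 m v) (fun=> 0))).
      by apply: rademacher_le => v; exact: supnorm2_centered.
    rewrite rademacherZ (_ : 1600 * _ = 16 * (100 * block_sum (fun b => G b m ^+ 2) k u)); last by ring.
    rewrite ler_pM2l//.
    apply: (rademacher_supnorm (L := fun u => G (beta u) m)) => [w|w i j|w i] /=.
    + exact: G0.
    + exact: Ghomo.
    + exact: Gm.
rewrite (ge0_integral_EFinZ Q (measurable_block_sum reg k mG2) (ler0n R 1600)); last first.
  by move=> u; exact: block_sum_ge0.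
rewrite (integral_block_sum reg k mG2 G20) [(1600 * k%:R)%:E]EFinM.
by rewrite -muleA lexx.
Qed.

End monotone_blocks.
End maximal_inequality.

(** * The invariant measure as an occupation measure *)

Section mixture.
Context (R : realType) (d1 d2 : measure_display) (T : measurableType d1)
  (Y : measurableType d2).
Variables (rho : {measure set T -> \bar R}) (k : T -> {measure set Y -> \bar R})
  (rho' : {measure set Y -> \bar R}).
Hypothesis mk : forall U, measurable U -> measurable_fun setT (k ^~ U).
Hypothesis rhoE : forall U, measurable U -> (rho' U = \int[rho]_x k x U)%E.
Import HBNNSimple.
Local Open Scope ereal_scope.

Let mixture_nnsfun (f : {nnsfun Y >-> R}) :
  \int[rho']_y (f y)%:E = \int[rho]_x \int[k x]_y (f y)%:E.
Proof.
have fE (m : {measure set Y -> \bar R}) :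
    \int[m]_y (f y)%:E = \sum_(r \in range f) (r%:E * m (f @^-1` [set r])).
  under eq_integral do rewrite fimfunE -fsumEFin//.
  rewrite ge0_integral_fsum//; last 2 first.
  - by move=> r; exact/measurable_EFinP/measurableT_comp.
  - by move=> r z _; rewrite EFinM nnfun_muleindic_ge0.
  apply: eq_fsbigr => r _; rewrite (integralZl_indic _ (fun r => f @^-1` [set r]))//; last first.
    by move=> r0; exact: preimage_nnfun0.
  by rewrite integral_indic// setIT.
have rf0 r x : 0 <= r%:E * k x (f @^-1` [set r]).
  by have := mulemu_ge0 (mu := k x) (fun n => f @^-1` [set n]); apply; exact: preimage_nnfun0.
rewrite fE; under [RHS]eq_integral do rewrite fE.
rewrite ge0_integral_fsum//; last first.
  by move=> r; apply: measurable_funeM; exact: mk.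
apply: eq_fsbigr => r _; have [r0|r0] := leP 0%R r.
  by rewrite ge0_integralZl_EFin// ?rhoE//; exact: mk.
rewrite preimage_nnfun0// measure0 mule0 integral0_eq// => x _.
by rewrite measure0 mule0.
Qed.

(** Kernels act on functions as on sets; proved by approximation with simple
    functions. *)
Lemma integral_mixture (f : Y -> \bar R) : measurable_fun setT f ->
  (forall y, 0 <= f y) -> \int[rho']_y f y = \int[rho]_x \int[k x]_y f y.
Proof.
move=> mf f0; pose f_ := nnsfun_approx measurableT mf.
have fE (m : {measure set Y -> \bar R}) :
    \int[m]_y f y = limn (fun n => \int[m]_y (f_ n y)%:E).
  rewrite -monotone_convergence//.
  - by apply: eq_integral => y _; apply/esym/cvg_lim => //; exact: cvg_nnsfun_approx.
  - by move=> n; exact/measurable_EFinP.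
  - by move=> n y _; rewrite lee_fin.
  - by move=> y _ a b ab; rewrite lee_fin; exact/lefP/nd_nnsfun_approx.
rewrite fE; under [RHS]eq_integral do rewrite fE.
rewrite monotone_convergence//.
- by apply: congr_lim; apply/funext => n; exact: mixture_nnsfun.
- move=> n; apply: measurable_fun_integral_kernel => //.
    by move=> y; rewrite lee_fin.
  exact/measurable_EFinP.
- by move=> n x _; apply: integral_ge0 => y _; rewrite lee_fin.
- move=> x _ a b ab; apply: ge0_le_integral => //.
  + by move=> y _; rewrite lee_fin.
  + exact/measurable_EFinP.
  + exact/measurable_EFinP.
  + by move=> y _; rewrite lee_fin; exact/lefP/nd_nnsfun_approx.
Qed.
End mixture.

Lemma measurable_gt0 (R : realType) d (T : measurableType d) (f : T -> \bar R) :
  measurable_fun setT f -> measurable [set x | (0 < f x)%E].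
Proof. by move=> mf; rewrite -[X in measurable X]setTI; exact: emeasurable_fun_o_infty. Qed.

Lemma integral_eq0_gt0_null (R : realType) d (T : measurableType d)
    (m : {measure set T -> \bar R}) (f : T -> \bar R) :
  measurable_fun setT f -> (forall x, 0 <= f x)%E -> (\int[m]_x f x = 0)%E ->
  m [set x | (0 < f x)%E] = 0%E.
Proof.
move=> mf f0 If; apply/negligibleP; first exact: measurable_gt0.
have [h _] := ae_eq_integral_abs m measurableT mf.
have : ae_eq m setT f (cst 0%E).
  by apply: h; rewrite -[RHS]If; apply: eq_integral => x _; rewrite gee0_abs.
by apply: negligibleS => x /= fx h0; move: fx; rewrite (h0 I) ltxx.
Qed.

Lemma measure_eq_on_cover (R : realType) d (T : measurableType d)
    (m1 m2 : {measure set T -> \bar R}) (D : nat -> set T) A :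
  (forall i, measurable (D i)) -> A `<=` \bigcup_i D i ->
  (forall i B, measurable B -> B `<=` D i -> m1 B = m2 B) ->
  measurable A -> m1 A = m2 A.
Proof.
move=> mD AD eqD mA.
have mA' i : measurable (A `&` seqDU D i).
  by apply: measurableI => //; apply: measurableD => //; exact: bigsetU_measurable.
have -> : A = \bigcup_i (A `&` seqDU D i).
  by rewrite -setI_bigcupr -seqDU_bigcup_eq; apply/esym/setIidPl.
rewrite !measure_semi_bigcup//; try exact: trivIset_setIl (trivIset_seqDU _).
- apply: eq_eseriesr => i _; apply: (eqD i) => // x [_]; exact: subset_seqDU.
- exact: bigcup_measurable.
- exact: bigcup_measurable.
Qed.

Section minorized_kernel.
Context (R : realType) (d : measure_display) (S : measurableType d)
  (P : R.-pker S ~> S) (s : S -> R) (nu : probability S R).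
Hypothesis hmin : minorized P s nu.
Local Open Scope ereal_scope.

Lemma measurable_minorant : measurable_fun setT (fun x => (s x)%:E).
Proof. by apply/measurable_EFinP; case: hmin. Qed.

Lemma minorant_ge0 x : (0 <= s x)%R. Proof. by case: hmin => _ /(_ x)/andP[]. Qed.

Lemma minorant_le1 x : (s x <= 1)%R. Proof. by case: hmin => _ /(_ x)/andP[]. Qed.

Lemma minorant_le x A : measurable A -> (s x)%:E * nu A <= P x A.
Proof. by case: hmin => _ _ h _; exact: h. Qed.

Lemma measurable_pker B : measurable B -> measurable_fun setT (fun x => P x B).
Proof. exact: measurable_kernel. Qed.

(** The sub-Markov kernel that moves the chain when it does not regenerate. *)
Definition excess B x := P x B - (s x)%:E * nu B.

Let snu_fin B x : measurable B -> (s x)%:E * nu B \is a fin_num.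
Proof. by move=> mB; rewrite fin_numM// fin_num_measure. Qed.

Lemma excess_ge0 B x : measurable B -> 0 <= excess B x.
Proof. by move=> mB; rewrite sube_ge0 ?minorant_le// snu_fin. Qed.

Lemma measurable_excess B : measurable B -> measurable_fun setT (excess B).
Proof.
move=> mB; apply: emeasurable_funB; first exact: measurable_pker.
by apply: emeasurable_funM; [exact: measurable_minorant|exact: measurable_cst].
Qed.

Lemma excessK B x : measurable B -> (s x)%:E * nu B + excess B x = P x B.
Proof. by move=> mB; rewrite /excess addeC subeK// snu_fin. Qed.

Lemma integral_minorized (m : {measure set S -> \bar R}) B : measurable B ->
  \int[m]_x P x B = (\int[m]_x (s x)%:E) * nu B + \int[m]_x excess B x.
Proof.
move=> mB; under eq_integral do rewrite -(excessK _ mB).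
rewrite ge0_integralD//.
- rewrite ge0_integralZr//; first exact: measurable_minorant.
  by move=> x _; rewrite lee_fin minorant_ge0.
- by move=> x _; rewrite mule_ge0// lee_fin minorant_ge0.
- by apply: emeasurable_funM; [exact: measurable_minorant|exact: measurable_cst].
- by move=> x _; exact: excess_ge0.
- exact: measurable_excess.
Qed.

End minorized_kernel.

Section occupation_measure.
Context (R : realType) (d : measure_display) (S : measurableType d)
  (P : R.-pker S ~> S) (s : S -> R) (nu : probability S R).
Hypothesis hmin : minorized P s nu.
Variables (pi : {sigma_finite_measure set S -> \bar R}) (psi : {measure set S -> \bar R}).
Hypotheses (hpi : invariant_measure P pi) (hpsi : irreducibility_measure P psi).
Variable q : nat -> {measure set S -> \bar R}.
Local Open Scope ereal_scope.
Local Notation res := (excess P s nu).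
Hypotheses (q0 : forall B, measurable B -> q 0%N B = nu B)
  (qS : forall i B, measurable B -> q i.+1 B = \int[q i]_x res B x)
  (q_lim : (fun i => q i setT) @ \oo --> 0).

Let mes : measurable_fun setT (fun x => (s x)%:E) := measurable_minorant hmin.
Let s0 : forall x, (0 <= s x)%R := minorant_ge0 hmin.
Let mP : forall B, measurable B -> measurable_fun setT (fun x => P x B) := measurable_pker P.
Let res0 : forall B x, measurable B -> 0 <= res B x := excess_ge0 hmin.
Let mres : forall B, measurable B -> measurable_fun setT (res B) := measurable_excess hmin.
Let split_integral : forall (m : {measure set S -> \bar R}) B, measurable B ->
  \int[m]_x P x B = (\int[m]_x (s x)%:E) * nu B + \int[m]_x res B x :=
  integral_minorized hmin.

Let c := \int[pi]_x (s x)%:E.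

(** The balance [pi B = c * nu B + rest], with [c] the integral of [s], forces
    [c] to be finite: otherwise every set of finite [pi]-measure would be
    [nu]-null. *)
Lemma integral_regeneration_lty : c < +oo.
Proof.
rewrite ltNge; apply/negP; rewrite leye_eq => /eqP coo.
have [F FT Ffin'] := sigma_finiteT pi.
have Ffin i : measurable (F i) /\ pi (F i) < +oo := Ffin' i.
have nuF i : nu (F i) = 0.
  have [mF piF] := Ffin i; apply/eqP; rewrite eq_le measure_ge0 andbT leNgt; apply/negP => nuF.
  have : pi (F i) = +oo.
    rewrite -(hpi.2 _ mF) split_integral// -/c coo gt0_mulye// addye//.
    by rewrite gt_eqF// (lt_le_trans ltNy0)// integral_ge0// => x _; exact: res0.
  by move=> h; move: piF; rewrite h.
have : nu setT <= 0.
  rewrite FT; apply: le_trans (generalized_Boole_inequality nu _ _) _.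
  - by move=> i; exact: (Ffin i).1.
  - by apply: bigcup_measurable => i _; exact: (Ffin i).1.
  - rewrite eseries0//; first by move=> i _ _; exact: nuF.
by rewrite probability_setT lee_fin ler10.
Qed.

Let c_ge0 : 0 <= c. Proof. by apply: integral_ge0 => x _; rewrite lee_fin. Qed.

Let cn : {nonneg R} := NngNum (fine_ge0 c_ge0).

Let cE : c = cn%:num%:E.
Proof. by rewrite /= fineK// ge0_fin_numE// integral_regeneration_lty. Qed.

Let cq i : {measure set S -> \bar R} := mscale cn (q i).
Let M : {measure set S -> \bar R} := mseries cq 0.

Let integral_cq (f : S -> \bar R) i : measurable_fun setT f -> (forall x, 0 <= f x) ->
  \int[cq i]_x f x = c * \int[q i]_x f x.
Proof. by move=> mf f0; rewrite cE ge0_integral_mscale. Qed.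

Let cqE i B : cq i B = c * q i B. Proof. by rewrite cE. Qed.

(** Unfolding the balance equation [n] times exhibits the first [n] terms of the
    occupation series below [pi]. *)
Let partial_occupation_le n B : measurable B -> msum cq n B <= pi B.
Proof.
elim: n B => [|n IH] B mB; first by rewrite /msum big_ord0.
rewrite /msum big_ord_recl cqE q0// -(hpi.2 _ mB) split_integral// -/c leeD2l//.
rewrite (_ : (\sum_(i < n) _)%R = \int[msum cq n]_x res B x); last first.
  rewrite ge0_integral_measure_sum//; [|by move=> x _; exact: res0|exact: mres].
  apply: eq_bigr => i _; rewrite integral_cq//; [|exact: mres|by move=> x; exact: res0].
  by rewrite cqE lift0 qS.
by apply: ge0_le_measure_integral => //; [by move=> x; exact: res0|exact: mres].
Qed.

Let M_le_pi B : measurable B -> M B <= pi B.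
Proof.
move=> mB; apply: lime_le.
  by apply: is_cvg_nneseries => i _ _; exact: measure_ge0.
apply: nearW => n; have := partial_occupation_le n mB; rewrite /msum.
by rewrite big_mkord.
Qed.

Let integral_M (f : S -> \bar R) : measurable_fun setT f -> (forall x, 0 <= f x) ->
  \int[M]_x f x = c * \sum_(0 <= i <oo) \int[q i]_x f x.
Proof.
move=> mf f0; rewrite /M ge0_integral_measure_series//.
under eq_eseriesr do rewrite integral_cq//.
by rewrite cE nneseriesZl// => i _; exact: integral_ge0.
Qed.

Let regeneration_balance i :
  q i setT = q i.+1 setT + \int[q i]_x (s x)%:E.
Proof.
rewrite qS//; transitivity (\int[q i]_x P x setT).
  by under eq_integral do rewrite prob_kernel; rewrite integral_cst// mul1e.
rewrite split_integral// addeC; congr (_ + _).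
by rewrite probability_setT mule1.
Qed.

Let int_s_ge0 i : 0 <= \int[q i]_x (s x)%:E.
Proof. by apply: integral_ge0 => x _; rewrite lee_fin. Qed.

Let q_le1 i : q i setT <= 1.
Proof.
elim: i => [|i]; first by rewrite q0// probability_setT.
by apply: le_trans; rewrite (regeneration_balance i) leeDl.
Qed.

Let q_fin i : q i setT \is a fin_num.
Proof. by rewrite ge0_fin_numE// (le_lt_trans (q_le1 i)) ?ltry. Qed.

Let partial_regeneration n :
  \sum_(0 <= i < n) \int[q i]_x (s x)%:E + q n setT = 1.
Proof.
elim: n => [|n IH]; first by rewrite big_geq// add0e q0// probability_setT.
by rewrite big_nat_recr//= -addeA (addeC _ (q n.+1 setT)) -regeneration_balance.
Qed.

(** The excursion ends almost surely, and [q_i] charges [s] by the probability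
    that it ends at the time [i]. *)
Let total_regeneration : \sum_(0 <= i <oo) \int[q i]_x (s x)%:E = 1.
Proof.
apply/cvg_lim => //.
rewrite (_ : (fun n => _) = (fun n => 1 - q n setT)); last first.
  by apply/funext => n; rewrite -(partial_regeneration n) addeK.
rewrite -[X in _ --> X](sube0 1); apply: cvgeB => //; exact: cvg_cst.
Qed.

Let N : {measure set S -> \bar R} := mseries q 0.

Let integral_N (f : S -> \bar R) : measurable_fun setT f -> (forall x, 0 <= f x) ->
  \int[N]_x f x = \sum_(0 <= i <oo) \int[q i]_x f x.
Proof. by move=> mf f0; rewrite /N ge0_integral_measure_series. Qed.

Let N_invariant B : measurable B -> \int[N]_x P x B = N B.
Proof.
move=> mB; rewrite integral_N//; last by apply: mP.
under eq_eseriesr => i _ do rewrite split_integral// -qS// muleC.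
rewrite nneseriesD//; last by move=> i _ _; rewrite mule_ge0.
rewrite -{1}(@fineK _ (nu B)) ?fin_num_measure// nneseriesZl//.
rewrite total_regeneration mule1 fineK ?fin_num_measure//.
rewrite -q0//; under [X in _ + X]eq_eseriesr do rewrite -addn1.
rewrite (nneseries_addn (f := fun i => q i B) 1%N)//.
by rewrite -(nneseries_recl (f := fun i => q i B)).
Qed.

Let ME B : M B = c * N B.
Proof. by rewrite cE -nneseriesZl. Qed.

Let M_invariant B : measurable B -> \int[M]_x P x B = M B.
Proof.
by move=> mB; rewrite integral_M//; [rewrite -integral_N// ?N_invariant// ?ME//; exact: mP|exact: mP].
Qed.

(** Mean regeneration rate [n] steps later.  Its integral is the same, and finite,
    for the two invariant measures [pi] and [M]; this is what separates them. *)
Fixpoint reach n x : \bar R := if n is m.+1 then \int[P x]_y reach m y else (s x)%:E.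

Let reach_ge0 n x : 0 <= reach n x.
Proof.
elim: n x => [|n IH] x /=; first by rewrite lee_fin.
by apply: integral_ge0 => y _; exact: IH.
Qed.

Let measurable_reach n : measurable_fun setT (reach n).
Proof.
elim: n => [//|n IH] /=.
by apply: measurable_fun_integral_kernel => //; exact: measurable_kernel.
Qed.

Let integral_reach (m : {measure set S -> \bar R}) n :
  (forall B, measurable B -> \int[m]_x P x B = m B) ->
  \int[m]_x reach n x = \int[m]_x (s x)%:E.
Proof.
move=> inv; elim: n => [//|n <-] /=.
rewrite [RHS](integral_mixture (k := P) (rho := m))//.
by move=> U mU; rewrite inv.
Qed.

Let reach_M n : \int[M]_x reach n x = c.
Proof.
rewrite integral_reach; last exact: M_invariant.
by rewrite integral_M// total_regeneration mule1.
Qed.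

Let reach_pi n : \int[pi]_x reach n x = c.
Proof. by rewrite integral_reach//; exact: hpi.2. Qed.

Let unreached : set S := [set x | forall n, reach n x = 0].

Let measurable_reach_gt0 n : measurable [set x | 0 < reach n x].
Proof. exact: measurable_gt0. Qed.

Let reached_bigcup : ~` unreached = \bigcup_n [set x | 0 < reach n x].
Proof.
apply/seteqP; split => x /=.
  move=> /existsNP[n hn]; exists n => //=.
  by rewrite lt_neqAle reach_ge0 andbT eq_sym; apply/eqP.
by move=> [n _ /= hn] /(_ n) h; move: hn; rewrite h ltxx.
Qed.

Let measurable_unreached : measurable unreached.
Proof.
by rewrite -(setCK unreached) reached_bigcup; apply: measurableC; exact: bigcup_measurable.
Qed.

(** A point from which no regeneration can occur only leads to such points. *)
Let unreached_absorbing x : unreached x -> P x (~` unreached) = 0.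
Proof.
move=> ux; rewrite reached_bigcup; apply/eqP; rewrite eq_le measure_ge0 andbT.
apply: le_trans (generalized_Boole_inequality (P x) _ _) _ => //.
  exact: bigcup_measurable.
rewrite eseries0// => n _ _.
exact: (integral_eq0_gt0_null (measurable_reach n) (reach_ge0 n) (ux n.+1)).
Qed.

Let kiter_ge0 n x A : 0 <= kiter P n x A.
Proof. by elim: n x => [|n IH] x /=; [exact: measure_ge0|apply: integral_ge0]. Qed.

Let measurable_kiter n A : measurable A -> measurable_fun setT (fun x => kiter P n x A).
Proof.
move=> mA; elim: n => [|n IH] /=.
  by rewrite /dirac; apply/measurable_EFinP; exact: measurable_indic.
by apply: measurable_fun_integral_kernel => // ?; exact: measurable_kernel.
Qed.

Let kiter_unreached n x : unreached x -> kiter P n x (~` unreached) = 0.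
Proof.
elim: n x => [|n IH] x ux /=.
  by rewrite diracE memNset//= => /(_ ux).
have mU : measurable (~` unreached) by exact: measurableC.
rewrite (ge0_negligible_integral mU)//.
- by apply: integral0_eq => y [_ /= /contrapT]; exact: IH.
- exact: measurable_kiter.
- exact: unreached_absorbing.
Qed.

(** On [unreached] no mass is lost to regeneration, so the mass of [q_i] there
    is nondecreasing in [i]; but the total mass of [q_i] vanishes. *)
Let q_unreached i : q i unreached = 0.
Proof.
have step j : q j unreached <= q j.+1 unreached.
  rewrite qS// -[leLHS]mul1e -[unreached]setIT -integral_indic// setIT mul1e.
  apply: ge0_le_integral => //.
  - by apply/measurable_EFinP; exact: measurable_indic.
  - exact: mres.
  - move=> x _; rewrite indicE; have [|_] := boolP (x \in unreached); last exact: res0.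
    rewrite inE => ux; rewrite /excess (_ : s x = 0%R) ?mul0e ?sube0; last first.
      by have /= [] := ux 0%N.
    have <- : P x setT = 1 by rewrite prob_kernel.
    rewrite -(setUv unreached) measureU//.
    + by rewrite [X in (_ + X)%R](unreached_absorbing ux) addr0.
    + exact: measurableC.
    + by rewrite setICr.
have mono k : q i unreached <= q (k + i)%N unreached.
  by elim: k => [//|k IH]; exact: le_trans IH (step _).
apply/eqP; rewrite eq_le measure_ge0 andbT.
have qk : (fun k => q (k + i)%N setT) @ \oo --> 0.
  by rewrite (cvg_shiftn i (fun k => q k setT)).
rewrite -(cvg_lim _ qk)//; apply: lime_ge; first by apply/cvg_ex; exists 0.
apply: nearW => k; apply: le_trans (mono k) _.
by apply: le_measure; rewrite ?inE.
Qed.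

(** If [psi] charges the absorbing set [unreached], every point leads to it, and the
    invariant measure [N], which vanishes on it, would be zero; if not, [psi]
    charges the complement, which cannot be reached from [unreached]. *)
Let unreached0 : unreached = set0.
Proof.
apply/eqP/negPn/negP => /set0P[x ux].
have [psi_gt0 irr] := hpsi.
have [pu|pu] := eqVneq (psi unreached) 0; last first.
  have {}pu : 0 < psi unreached by rewrite lt0e pu /=.
  have NU : N unreached = 0 by apply: eseries0 => i _ _; exact: q_unreached.
  have hit n : N [set y | 0 < kiter P n y unreached] = 0.
    apply: integral_eq0_gt0_null => //; first exact: measurable_kiter.
    rewrite -[RHS]NU; elim: n => [|n IH].
      rewrite -[RHS]mul1e -[in RHS](setIT unreached) -integral_indic// mul1e.
      by apply: eq_integral.
    rewrite /= -[RHS]IH -(integral_mixture (k := P) (rho' := N))//.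
    - by move=> U mU; rewrite N_invariant.
    - exact: measurable_kiter.
  have : N setT = 0.
    apply/eqP; rewrite eq_le measure_ge0 andbT.
    rewrite (_ : setT = \bigcup_n [set y | 0 < kiter P n y unreached]); last first.
      apply/seteqP; split => // y _; have [n _ hn] := irr _ measurable_unreached pu y.
      by exists n.
    apply: le_trans (generalized_Boole_inequality N _ _) _.
    - by move=> n; apply: measurable_gt0; exact: measurable_kiter.
    - by apply: bigcup_measurable => n _; apply: measurable_gt0; exact: measurable_kiter.
    - by rewrite eseries0// => n _ _; exact: hit.
  move=> NT; have : q 0%N setT <= N setT.
    by rewrite /N /= /mseries (nneseriesD1 (n := 0%N))// leeDl// nneseries_ge0.
  by rewrite NT q0// probability_setT lee_fin ler10.
have mU : measurable (~` unreached) by exact: measurableC.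
have puC : 0 < psi (~` unreached).
  move: psi_gt0; rewrite -(setUv unreached) measureU//; last by rewrite setICr.
  by rewrite [X in (X + _)%R]pu add0r.
by have [n _] := irr _ mU puC x; rewrite kiter_unreached// ltxx.
Qed.

(** [M <= pi], while [reach n] has the same finite integral for both; hence they
    agree wherever [reach n] is bounded below. *)
Let pi_eq_M_at n (e : R) A : (0 < e)%R -> measurable A ->
  (forall x, A x -> e%:E <= reach n x) -> pi A = M A.
Proof.
move=> e0 mA Ae.
pose r x := reach n x - (e * \1_A x)%:E.
have r0 x : 0 <= r x.
  rewrite sube_ge0// indicE; have [|_] := boolP (x \in A); last by rewrite mulr0.
  by rewrite inE mulr1; exact: Ae.
have mr : measurable_fun setT r.
  apply: emeasurable_funB => //; apply/measurable_EFinP; apply: measurable_funM => //.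
have split (m : {measure set S -> \bar R}) :
    \int[m]_x reach n x = e%:E * m A + \int[m]_x r x.
  rewrite -[A in m A]setIT -integral_indic// -ge0_integral_EFinZ//; last exact: ltW.
  rewrite -ge0_integralD//.
  - by apply: eq_integral => x _; rewrite addeC subeK.
  - by move=> x _; rewrite lee_fin mulr_ge0// ltW.
  - by apply/measurable_EFinP; apply: measurable_funM.
have sp := split pi; have sM := split M; rewrite reach_pi in sp; rewrite reach_M in sM.
have rle : \int[M]_x r x <= \int[pi]_x r x by apply: ge0_le_measure_integral.
have rfin : \int[pi]_x r x \is a fin_num.
  rewrite ge0_fin_numE ?integral_ge0//.
  apply: le_lt_trans integral_regeneration_lty; rewrite -/c sp leeDr// mule_ge0// lee_fin ltW//.
apply/eqP; rewrite eq_le M_le_pi// andbT -(@lee_pmul2l _ e%:E)//.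
by rewrite -(leeD2rE _ _ rfin) -sp sM leeD2l.
Qed.

Let pi_eq_M A : measurable A -> pi A = M A.
Proof.
move=> mA; apply: (measure_eq_on_cover (D := fun n => [set x | 0 < reach n x])) => //.
  by rewrite -reached_bigcup unreached0 setC0.
move=> n B mB BD.
apply: (measure_eq_on_cover (D := fun k => [set x | (k.+1%:R^-1)%:E <= reach n x])) => //.
- by move=> k; rewrite -[X in measurable X]setTI; exact: emeasurable_fun_c_infty.
- move=> x Bx; have := BD x Bx; rewrite /= lt0e => /andP[rn0 rn_ge0].
  have [rfin|] := boolP (reach n x \is a fin_num); last first.
    by rewrite ge0_fin_numE// -leNgt leye_eq => /eqP roo; exists 0%N => //=; rewrite roo leey.
  have f0 : (0 < fine (reach n x))%R.
    by rewrite fine_gt0// lt0e rn0 rn_ge0/= -ge0_fin_numE.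
  exists (Num.trunc (fine (reach n x))^-1) => //=.
  rewrite -[leRHS]fineK// lee_fin -[leRHS]invrK lef_pV2 ?posrE ?invr_gt0//.
  by rewrite ltW// truncnS_gt.
- by move=> k E mE ED; apply: (@pi_eq_M_at n k.+1%:R^-1) => // x /ED.
Qed.

(** The measures [q_i] are the laws of the state at the time [i] of an excursion
    that is not yet over.  The multiple [M] of their sum is invariant and below
    [pi]; it equals [pi] because both give the same finite integral to the
    functions [reach n], one of which is positive at each point. *)
Lemma invariant_measure_occupation : exists2 c' : R, (0 < c')%R &
  forall A, measurable A -> pi A = c'%:E * \sum_(0 <= i <oo) q i A.
Proof.
exists cn%:num%R; last by move=> A mA; rewrite pi_eq_M// ME cE.
rewrite lt_def ge0 andbT; apply/negP => /eqP cn0.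
by have : 0 < pi setT := hpi.1; rewrite pi_eq_M// ME cE cn0 mul0e ltxx.
Qed.
End occupation_measure.

(** * One step of the split chain *)

Definition image_measure (R : realType) d1 d2 (T1 : measurableType d1)
    (T2 : measurableType d2) (m : {measure set T1 -> \bar R}) (f : T1 -> T2)
    (mf : measurable_fun setT f) : {measure set T2 -> \bar R} :=
  measure_function_pushforward__canonical__measure_function_Measure m mf.

Lemma image_measureE (R : realType) d1 d2 (T1 : measurableType d1)
    (T2 : measurableType d2) (m : {measure set T1 -> \bar R}) (f : T1 -> T2)
    (mf : measurable_fun setT f) A : image_measure m mf A = m (f @^-1` A).
Proof. by []. Qed.

Section history_laws.
Context (R : realType) (d d' : measure_display) (S : measurableType d)
  (Omega : measurableType d').
Variables (X : nat -> {mfun Omega >-> S}) (xi : nat -> {mfun Omega >-> bool}).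

Local Notation sh := (split_history X xi).
Local Notation shT n m := (g_sigma_algebraType (history X n `|` history xi m)).

Lemma history_sub dT (T : measurableType dT) (Y : nat -> {mfun Omega >-> T}) n m :
  (n <= m)%N -> history Y n `<=` history Y m.
Proof.
move=> nm; apply: sub_smallest2r; first exact: smallest_sigma_algebra.
by apply: bigcup_subset => k /= /leq_trans; apply.
Qed.

Lemma split_history_sub n m n' m' : (n <= n')%N -> (m <= m')%N -> sh n m `<=` sh n' m'.
Proof.
move=> nn mm; apply: sub_smallest2r; first exact: smallest_sigma_algebra.
by apply: setUSS; exact: history_sub.
Qed.

Lemma history_measurable dT (T : measurableType dT) (Y : nat -> {mfun Omega >-> T}) n :
  history Y n `<=` measurable.
Proof.
apply: smallest_sub; first exact: sigma_algebra_measurable.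
by move=> _ [k _ [B mB <-]]; rewrite setTI; exact: measurable_funPTI.
Qed.

Lemma split_history_measurable n m : sh n m `<=` measurable.
Proof.
apply: smallest_sub; first exact: sigma_algebra_measurable.
by move=> H [] /history_measurable.
Qed.

Lemma split_history_X n m k B : (k < n)%N -> measurable B -> sh n m (X k @^-1` B).
Proof.
move=> kn mB; apply: sub_gen_smallest; left; apply: sub_gen_smallest.
by exists k => //; exists B => //; rewrite setTI.
Qed.

Lemma split_history_xi n m k (B : set bool) : (k < m)%N -> sh n m (xi k @^-1` B).
Proof.
move=> km; apply: sub_gen_smallest; right; apply: sub_gen_smallest.
by exists k => //; exists B => //; rewrite setTI.
Qed.

Lemma split_historyI n m A B : sh n m A -> sh n m B -> sh n m (A `&` B).
Proof. exact: (@measurableI _ (shT n m)). Qed.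

Lemma split_historyT n m : sh n m setT.
Proof. exact: (@measurableT _ (shT n m)). Qed.

Lemma split_history_bigcap n m (F : nat -> set Omega) k :
  (forall i, (i < k)%N -> sh n m (F i)) -> sh n m (\bigcap_(i in `I_k) F i).
Proof.
move=> hF; case: k hF => [|k] hF; first by rewrite II0 bigcap_set0; exact: split_historyT.
by apply: (@bigcap_measurable _ (shT n m)); [exists 0%N|move=> i /= ik; exact: hF].
Qed.

Variable Pr : probability Omega R.

(** The law of [X_n] on the event [H], a finite measure that is not normalized. *)
Definition law (H : set Omega) (mH : measurable H) n : {measure set S -> \bar R} :=
  image_measure (mrestr Pr mH) (@measurable_funPT _ _ _ _ (X n)).

Lemma lawE H (mH : measurable H) n A : law mH n A = Pr (H `&` X n @^-1` A).
Proof. by rewrite /law image_measureE /= /mrestr setIC. Qed.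

Lemma integral_law H (mH : measurable H) n (f : S -> \bar R) :
  measurable_fun setT f -> (forall x, 0 <= f x)%E ->
  (\int[law mH n]_x f x = \int[Pr]_(w in H) f (X n w))%E.
Proof.
move=> mf f0.
have i0 w : 0 <= (\1_H w : R) by [].
rewrite (@integral_mixture _ _ _ _ _ Pr (fun w => mscale (NngNum (i0 w)) (\d_(X n w)))) //.
- rewrite [RHS]integral_mkcond; apply: eq_integral => w _.
  rewrite ge0_integral_mscale//= integral_dirac//= diracT mul1e.
  by rewrite patchE indicE; case: ifPn => _; rewrite ?mul1e ?mul0e.
- move=> U mU; apply: emeasurable_funM.
    by apply/measurable_EFinP; exact: measurable_indic.
  exact: (measurableT_comp (measurable_fun_dirac mU) (@measurable_funPT _ _ _ _ (X n))).
- move=> U mU; rewrite lawE -[X in Pr X]setIT -integral_indic//; last first.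
    by apply: measurableI => //; exact: measurable_funPTI.
  by apply: eq_integral => w _; rewrite indicI EFinM.
Qed.

Variables (P : R.-pker S ~> S) (s : S -> R) (nu : probability S R).
Hypotheses (hmin : minorized P s nu) (hsplit : split_chain X xi P s nu Pr).
Local Open Scope ereal_scope.

Let mes : measurable_fun setT (fun x => (s x)%:E) := measurable_minorant hmin.
Let s0 : forall x, (0 <= s x)%R := minorant_ge0 hmin.
Let s1 : forall x, (s x <= 1)%R := minorant_le1 hmin.

Definition regen n : set Omega := [set w | xi n w].

Lemma sh_regen n m k : (k < m)%N -> sh n m (regen k).
Proof.
move=> km; have := @split_history_xi n m k [set true] km.
by congr sh; apply/seteqP; split => w /=; rewrite /regen /=; case: (xi k w).
Qed.

Lemma nregenE n : ~` regen n = [set w | ~~ xi n w].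
Proof. by apply/seteqP; split => w /= /negP. Qed.

Lemma sh_nregen n m k : (k < m)%N -> sh n m (~` regen k).
Proof. by move=> /(@sh_regen n); exact: (@measurableC _ (shT n m)). Qed.

Section one_step.
Variables (n : nat) (H : set Omega) (shH : sh n.+1 n H).
Let mH : measurable H. Proof. exact: split_history_measurable shH. Qed.
Let mR : measurable (H `&` regen n).
Proof. by apply: measurableI => //; apply: split_history_measurable (@sh_regen 0 _ _ (ltnSn n)). Qed.
Let mN : measurable (H `&` ~` regen n).
Proof. by apply: measurableI => //; apply: split_history_measurable (@sh_nregen 0 _ _ (ltnSn n)). Qed.
Let shH' : sh n.+1 n.+1 H. Proof. exact: split_history_sub shH. Qed.

Lemma law_regen A : measurable A -> law mR n A = \int[law mH n]_(x in A) (s x)%:E.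
Proof.
move=> mA; have [h _ _] := hsplit.
have hHA : sh n.+1 n (H `&` X n @^-1` A).
  by apply: split_historyI => //; exact: split_history_X.
rewrite lawE setIAC h//.
rewrite [RHS]integral_mkcond integral_law.
- rewrite integral_mkcondr; apply: eq_integral => w _.
  by rewrite !patchE.
- by apply/(measurable_restrictT _ mA); exact: measurable_funTS.
- by move=> x; rewrite patchE; case: ifP => // _; rewrite lee_fin.
Qed.

Lemma law_next_regen B : measurable B -> law mR n.+1 B = Pr (H `&` regen n) * nu B.
Proof. by move=> mB; have [_ h _] := hsplit; rewrite lawE h. Qed.

Let law_split k A : measurable A -> law mH k A = law mR k A + law mN k A.
Proof.
move=> mA; have mXA : measurable (X k @^-1` A) by exact: measurable_funPTI.
rewrite !lawE -measureU//.
- by rewrite -setIUl -setIUr setUv setIT.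
- exact: measurableI.
- exact: measurableI.
- by apply/seteqP; split => // w [[[_ rw] _] [[_ nrw] _]].
Qed.

Let law_fin (H' : set Omega) (mH' : measurable H') k A : measurable A ->
  law mH' k A \is a fin_num.
Proof.
by move=> mA; rewrite lawE fin_num_measure//; apply: measurableI => //; exact: measurable_funPTI.
Qed.

Let m1s : measurable_fun setT (fun x => (1 - s x)%:E).
Proof. by apply/measurable_EFinP; apply: measurable_funB => //; exact/measurable_EFinP. Qed.

Let s1' x : (0 <= 1 - s x)%R. Proof. by rewrite subr_ge0. Qed.

Lemma law_nregen A : measurable A -> law mN n A = \int[law mH n]_(x in A) (1 - s x)%:E.
Proof.
move=> mA; have Rfin := law_fin mR n mA.
rewrite -[LHS](addeK _ Rfin) -[RHS](addeK _ Rfin); congr (_ - _).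
rewrite addeC -law_split// law_regen// -ge0_integralD//; last 4 first.
- by move=> x _; rewrite lee_fin.
- exact: measurable_funTS.
- by move=> x _; rewrite lee_fin.
- exact: measurable_funTS.
under eq_integral do rewrite -EFinD subrK.
by rewrite integral_cst// mul1e.
Qed.

(** Here the factor [1 - s x] of the event of no regeneration cancels the
    normalization of the residual kernel.  At points with [s x = 1] the
    normalization divides by zero, but there the excess vanishes. *)
Lemma law_next_nregen B : measurable B ->
  law mN n.+1 B = \int[law mH n]_x excess P s nu B x.
Proof.
move=> mB; have [_ _ h] := hsplit; rewrite lawE nregenE h// -nregenE.
have mrk : measurable_fun setT (fun x => residual_kernel P s nu x B).
  apply: emeasurable_funM; first exact: measurable_excess.
  apply/measurable_EFinP; under eq_fun do rewrite -powR_inv1//.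
  have m1s' : measurable_fun setT (fun x => 1 - s x)%R by move/measurable_EFinP : m1s.
  exact: (measurableT_comp (@measurable_powR _ (-1)%R) m1s').
have rk0 x : 0 <= residual_kernel P s nu x B.
  by rewrite mule_ge0//; [exact: excess_ge0|rewrite lee_fin invr_ge0].
rewrite -(integral_law mN n mrk rk0).
rewrite (integral_mixture (rho := law mH n) (k := fun x => mscale (NngNum (s1' x)) (\d_x))) //.
- apply: eq_integral => x _; rewrite ge0_integral_mscale//= integral_dirac//= diracT mul1e.
  rewrite /residual_kernel -/(excess P s nu B x) muleCA -EFinM.
  have [s1x|s1x] := eqVneq (s x) 1%R; last by rewrite divff ?mule1// subr_eq0 eq_sym.
  rewrite s1x subrr invr0 mulr0 mule0; apply/esym/eqP.
  rewrite eq_le excess_ge0// andbT /excess s1x mul1e leeBlDr ?fin_num_measure// add0e.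
  have mBC := measurableC mB.
  have le1 : nu (~` B) <= P x (~` B).
    by rewrite -[leLHS]mul1e -s1x; apply: (minorant_le hmin).
  have nuC : nu B + nu (~` B) = 1.
    by rewrite -measureU// ?setICr// setUv; exact: probability_setT.
  have PC : P x B + P x (~` B) = 1.
    by rewrite -measureU// ?setICr// setUv; exact: prob_kernel.
  by rewrite -(leeD2rE _ _ (fin_num_measure nu _ mBC)) nuC -PC leeD2l.
- move=> U mU; apply: emeasurable_funM => //; exact: measurable_fun_dirac.
- move=> U mU; rewrite law_nregen// integral_mkcond; apply: eq_integral => x _.
  transitivity ((1 - s x)%:E * \d_x U) => //.
  by rewrite patchE diracE; case: ifP => _; rewrite ?mule1 ?mule0.
Qed.

Lemma law_next B : measurable B -> law mH n.+1 B = \int[law mH n]_x P x B.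
Proof.
move=> mB; rewrite (integral_minorized hmin)// law_split// law_next_regen// law_next_nregen//.
by congr (_ * _ + _); rewrite -law_regen// lawE preimage_setT setIT.
Qed.

End one_step.
End history_laws.

(** * The future after a regeneration *)

Section cylinders.
Context (R : realType) (d d' : measure_display) (S : measurableType d)
  (Omega : measurableType d').
Variables (X : nat -> {mfun Omega >-> S}) (xi : nat -> {mfun Omega >-> bool}).
Variable Pr : probability Omega R.
Variables (P : R.-pker S ~> S) (s : S -> R) (nu : probability S R).
Hypotheses (hmin : minorized P s nu) (hsplit : split_chain X xi P s nu Pr).
Local Open Scope ereal_scope.
Local Notation sh := (split_history X xi).
Local Notation law := (law X Pr).
Local Notation regen := (regen xi).

Let mes : measurable_fun setT (fun x => (s x)%:E) := measurable_minorant hmin.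
Let s0 : forall x, (0 <= s x)%R := minorant_ge0 hmin.
Let s1 : forall x, (s x <= 1)%R := minorant_le1 hmin.

Lemma integral_law_restrict H (mH : measurable H) n A
    (mHA : measurable (H `&` X n @^-1` A)) (g : S -> \bar R) :
  measurable A -> measurable_fun setT g -> (forall x, 0 <= g x) ->
  \int[law mHA n]_x g x = \int[law mH n]_(x in A) g x.
Proof.
move=> mA mg g0; rewrite [RHS]integral_mkcond !integral_law//.
- by rewrite integral_mkcondr; apply: eq_integral => w _; rewrite !patchE.
- by apply/(measurable_restrictT _ mA); exact: measurable_funTS.
- by move=> x; rewrite patchE; case: ifP.
Qed.

Definition cylinder_from n m (B : nat -> set (S * bool)) : set Omega :=
  [set w | forall i, (i < m)%N -> B i (X (n + i) w, xi (n + i) w)].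

Lemma measurable_cylinder_from n m B : (forall i, measurable (B i)) ->
  measurable (cylinder_from n m B).
Proof.
move=> mB; rewrite (_ : cylinder_from n m B =
  \bigcap_(i in `I_m) (fun w => (X (n + i) w, xi (n + i) w)) @^-1` (B i)); last first.
  by apply/seteqP; split => w h i; exact: h.
apply: bigcap_measurableType => i _; rewrite -[X in measurable X]setTI.
by apply: measurable_fun_pair; rewrite ?measurableT//; exact: mB.
Qed.

(** Before the coin [xi_n] is known, the probability of a cylinder event from
    time [n] on depends on the past through [X_n] only.  The induction treats
    the two values of the coin apart; the value [0] is obtained by difference,
    which keeps the residual kernel out of the computation. *)
Lemma cylinder_law m B : (forall i, measurable (B i)) ->
  exists K : S -> \bar R, [/\ measurable_fun setT K, forall x, 0 <= K x <= 1 &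
    forall n H (mH : measurable H), sh n.+1 n H ->
      Pr (H `&` cylinder_from n m B) = \int[law mH n]_x K x].
Proof.
elim: m B => [|m IH] B mB.
  exists (cst 1); split => // [x|n H mH _]; first by rewrite lexx lee01.
  rewrite integral_cst// mul1e lawE preimage_setT setIT; congr (Pr _).
  by apply/seteqP; split => // w [].
have [K' [mK' K'01 hK']] := IH (fun i => B i.+1) (fun i => mB i.+1).
have K'0 x : 0 <= K' x by have /andP[] := K'01 x.
have K'1 x : K' x <= 1 by have /andP[] := K'01 x.
pose kap := \int[nu]_x K' x.
pose A b : set S := [set x | B 0%N (x, b)].
have mA b : measurable (A b).
  rewrite /A -[X in measurable X]setTI.
  exact: (measurable_fun_pair (@measurable_id _ _ _) (measurable_cst b) measurableT (mB 0%N)).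
pose PK x := \int[P x]_y K' y.
have kap0 : 0 <= kap by apply: integral_ge0.
have kapfin : kap \is a fin_num.
  rewrite ge0_fin_numE//; apply: (@le_lt_trans _ _ (\int[nu]_x cst 1 x)).
    by apply: ge0_le_integral.
  by rewrite integral_cst1 ltry.
have mPK : measurable_fun setT PK.
  by apply: measurable_fun_integral_kernel => // U mU; exact: measurable_kernel.
have PK1 x : PK x <= 1.
  have <- : \int[P x]_y cst 1 y = 1 by rewrite integral_cst// mul1e; exact: prob_kernel.
  by apply: ge0_le_integral.
have PK0 x : 0 <= PK x by apply: integral_ge0.
have PKfin x : PK x \is a fin_num by rewrite ge0_fin_numE// (le_lt_trans (PK1 x))// ltry.
have sk0 x : 0 <= (s x)%:E * kap by rewrite mule_ge0// lee_fin.
have skPK x : (s x)%:E * kap <= PK x.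
  rewrite /kap -(@ge0_integral_mscale _ _ _ nu _ measurableT (NngNum (s0 x)))//.
  by apply: ge0_le_measure_integral => // U mU; exact: (minorant_le hmin).
have skfin x : (s x)%:E * kap \is a fin_num by rewrite fin_numM.
have msk : measurable_fun setT (fun x => (s x)%:E * kap).
  by apply: emeasurable_funM => //; exact: measurable_cst.
pose D x := PK x - (s x)%:E * kap.
have D0 x : 0 <= D x by rewrite sube_ge0 ?skPK// skfin.
have mD : measurable_fun setT D by exact: emeasurable_funB.
exists (fun x => ((fun x => (s x)%:E * kap) \_ (A true)) x + (D \_ (A false)) x).
have mr (f : S -> \bar R) b : measurable_fun setT f -> measurable_fun setT (f \_ (A b)).
  by move=> mf; apply/(measurable_restrictT _ (mA b)); exact: measurable_funTS.
have r0 (f : S -> \bar R) b x : (forall x, 0 <= f x) -> 0 <= (f \_ (A b)) x.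
  by move=> f0; rewrite patchE; case: ifP.
split.
- by apply: emeasurable_funD; exact: mr.
- move=> x; apply/andP; split; first by rewrite adde_ge0// r0.
  apply: (@le_trans _ _ ((s x)%:E * kap + D x)).
    by apply: leeD; rewrite patchE; case: ifP.
  by rewrite addeC subeK.
move=> n H mH shH.
pose HA b := H `&` X n @^-1` A b.
have shHA b : sh n.+1 n (HA b).
  by apply: split_historyI => //; exact: split_history_X.
have mHA b : measurable (HA b) by exact: split_history_measurable (shHA b).
have mR : measurable (regen n).
  exact: (split_history_measurable (@sh_regen _ _ _ _ X xi 0 _ _ (ltnSn n))).
have mN : measurable (~` regen n) by exact: measurableC.
have mHR b : measurable (HA b `&` regen n) by exact: measurableI.
have mHN b : measurable (HA b `&` ~` regen n) by exact: measurableI.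
pose cyl' := cylinder_from n.+1 m (fun i => B i.+1).
have mcyl' : measurable cyl' by apply: measurable_cylinder_from.
have shR b : sh n.+2 n.+1 (HA b `&` regen n).
  apply: split_historyI; last exact: sh_regen.
  by apply: split_history_sub (shHA b).
have shHA' b : sh n.+2 n.+1 (HA b) by apply: split_history_sub (shHA b).
have PR b : Pr (HA b `&` regen n `&` cyl') = \int[law mH n]_(x in A b) ((s x)%:E * kap).
  rewrite (hK' _ _ (mHR b) (shR b)) -(integral_law_restrict mH (mHA b))//.
  rewrite (integral_mixture (rho := law (mHA b) n) (k := fun x => mscale (NngNum (s0 x)) nu)) //.
  - by apply: eq_integral => x _; rewrite ge0_integral_mscale.
  - move=> U mU; apply: emeasurable_funM => //; exact: measurable_cst.
  - move=> U mU; rewrite (law_next_regen hsplit (shHA b))//.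
    rewrite [RHS](_ : _ = \int[law (mHA b) n]_x ((s x)%:E * nu U)) //.
    rewrite ge0_integralZr//; last by move=> x _; rewrite lee_fin.
    by congr (_ * _); rewrite -(law_regen hmin hsplit (shHA b))// lawE preimage_setT setIT.
have PHA : Pr (HA false `&` cyl') = \int[law mH n]_(x in A false) PK x.
  rewrite (hK' _ _ (mHA false) (shHA' false)) -(integral_law_restrict mH (mHA false))//.
  apply: (integral_mixture (k := P)) => //.
  - by move=> U mU; exact: measurable_kernel.
  - by move=> U mU; rewrite (law_next hmin hsplit (shHA false)).
have cylE : H `&` cylinder_from n m.+1 B =
    (HA true `&` regen n `&` cyl') `|` (HA false `&` ~` regen n `&` cyl').
  have next w : cylinder_from n m.+1 B w <-> B 0%N (X n w, xi n w) /\ cyl' w.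
    split=> [h|[h0 h] [|i] im]; rewrite ?addn0//; last by rewrite addnS -addSn; exact: h.
    split; first by have := h 0%N isT; rewrite addn0.
    by move=> i im; rewrite addSn -addnS; exact: h.
  apply/seteqP; split => [w [Hw /next[Bw cw]]|w].
    rewrite /HA /A /regen /=; case: (xi n w) Bw => Bw; first by left.
    by right.
  rewrite /HA /A /regen /= => -[[[[Hw Aw] xw] cw]|[[[Hw Aw] xw] cw]].
    by split => //; apply/next; rewrite xw.
  by split => //; apply/next; move/negP/negbTE : xw => ->.
have PHAs : Pr (HA false `&` cyl') =
    Pr (HA false `&` regen n `&` cyl') + Pr (HA false `&` ~` regen n `&` cyl').
  rewrite -measureU//.
  - by congr (Pr _); rewrite -setIUl -setIUr setUv setIT.
  - exact: measurableI.
  - exact: measurableI.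
  - by apply/seteqP; split => // w [[[_ rw] _] [[_ nrw] _]].
rewrite cylE measureU//; last 3 first.
- exact: measurableI.
- exact: measurableI.
- by apply/seteqP; split => // w [[[_ rw] _] [[_ nrw] _]].
rewrite ge0_integralD//; last 4 first.
- by move=> x _; exact: r0.
- exact: mr.
- by move=> x _; exact: r0.
- exact: mr.
rewrite -!integral_mkcond; congr (_ + _); first exact: PR.
have PRfin : Pr (HA false `&` regen n `&` cyl') \is a fin_num.
  by rewrite fin_num_measure//; exact: measurableI.
rewrite -[LHS](addeK _ PRfin) -[RHS](addeK _ PRfin); congr (_ - _); rewrite addeC.
apply: (etrans (esym PHAs)); rewrite PHA PR addeC -ge0_integralD//.
- by apply: eq_integral => x _; rewrite [RHS]addeC subeK.
- exact: measurable_funTS.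
- exact: measurable_funTS.
Qed.

(** After a regeneration the next state is drawn from [nu] whatever the past, so
    the constant [kap] depends neither on the time nor on the event. *)
Lemma regeneration_cylinder m B : (forall i, measurable (B i)) ->
  exists2 kap : R, (0 <= kap)%R & forall n H, sh n.+1 n.+1 H -> H `<=` regen n ->
    Pr (H `&` cylinder_from n.+1 m B) = Pr H * kap%:E.
Proof.
move=> mB; have [K [mK K01 hK]] := cylinder_law m mB.
have K0 x : 0 <= K x by have /andP[] := K01 x.
have int0 : 0 <= \int[nu]_x K x by apply: integral_ge0.
have intfin : \int[nu]_x K x \is a fin_num.
  rewrite ge0_fin_numE//; apply: (@le_lt_trans _ _ (\int[nu]_x cst 1 x)).
    by apply: ge0_le_integral => // x _; have /andP[] := K01 x.
  by rewrite integral_cst1 ltry.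
exists (fine (\int[nu]_x K x)) => [|n H shH Hn]; first exact: fine_ge0.
rewrite fineK//.
have mH : measurable H by exact: split_history_measurable shH.
have shH' : sh n.+2 n.+1 H by apply: split_history_sub shH.
have HE : H `&` regen n = H by apply/setIidPl.
rewrite (hK _ _ mH shH').
have PrH0 : (0 <= fine (Pr H))%R by rewrite fine_ge0.
rewrite (eq_measure_integral (mscale (NngNum PrH0) nu)); last first.
  move=> U mU _; have [_ h _] := hsplit; have := h n H U shH mU; rewrite HE => hU.
  by rewrite lawE hU -[in LHS](fineK (fin_num_measure Pr _ mH)).
by rewrite ge0_integral_mscale// -[in RHS](fineK (fin_num_measure Pr _ mH)).
Qed.
End cylinders.

(** * Measurable operations on paths *)

Section measurable_nat.
Context (d : measure_display) (T : measurableType d) (N : T -> nat).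
Hypothesis mN : forall n, measurable [set t | N t = n].

Lemma measurable_fun_nat : measurable_fun setT N.
Proof.
move=> _ B _; rewrite setTI (_ : _ @^-1` _ = \bigcup_(n in B) [set t | N t = n]).
  exact: bigcup_measurable.
apply/seteqP; split => [t /= Bt|t [n Bn /= tn]]; [by exists (N t)|by rewrite /= tn].
Qed.

(** A countable family of measurable maps, one of which is selected by a measurable
    index. *)
Lemma measurable_select d' (Y : measurableType d') (f : nat -> T -> Y) :
  (forall n, measurable_fun setT (f n)) -> measurable_fun setT (fun t => f (N t) t).
Proof.
move=> mf _ B mB.
rewrite setTI (_ : _ @^-1` _ = \bigcup_n ([set t | N t = n] `&` f n @^-1` B)).
  apply: bigcup_measurable => n _; apply: measurableI => //.
  by rewrite -[X in measurable X]setTI; exact: mf.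
apply/seteqP; split => [t /= Bt|t [n _ [/= tn Bt]]]; [by exists (N t)|by rewrite /= tn].
Qed.
End measurable_nat.

Section path_space.
Context (d : measure_display) (S : measurableType d).

Definition cylinders : set (set (nat -> S * bool)) :=
  [set U | exists (m : nat) (B : nat -> set (S * bool)), (forall i, measurable (B i)) /\
    U = [set u | forall i, (i < m)%N -> B i (u i)]].

(** Infinite sequences of states and coins with the product sigma-algebra. *)
Definition paths := g_sigma_algebraType cylinders.

HB.instance Definition _ := Measurable.on paths.

Lemma cylinders_setI : setI_closed cylinders.
Proof.
move=> _ _ [m [B [mB ->]]] [m' [B' [mB' ->]]].
exists (maxn m m'), (fun i => (if (i < m)%N then B i else setT) `&`
  (if (i < m')%N then B' i else setT)); split.
  by move=> i; apply: measurableI; case: ifP.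
apply/seteqP; split => u /=.
  by move=> [h h'] i _; split; case: ifP => // im; [exact: h|exact: h'].
move=> h; split => i im; have := h i; rewrite leq_max im ?orbT; move=> /(_ isT)[]//.
Qed.

Lemma measurable_coord i : measurable_fun setT (fun u : paths => (u i : S * bool)).
Proof.
move=> _ B mB; rewrite setTI; apply: sub_gen_smallest.
exists i.+1, (fun j => if j == i then B else setT); split => [j|]; first by case: ifP.
apply/seteqP; split => [u /= Bu j _|u /= /(_ i (ltnSn i))]; last by rewrite eqxx.
by case: eqP => [->|].
Qed.

Lemma measurable_to_paths d' (T : measurableType d') (f : T -> paths) :
  (forall i, measurable_fun setT (fun t => f t i)) -> measurable_fun setT f.
Proof.
move=> mf; apply: (@measurability _ _ _ _ setT f cylinders) => // _ [_ [m [B [mB ->]]] <-].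
rewrite setTI (_ : _ @^-1` _ = \bigcap_(i in `I_m) (fun t => f t i) @^-1` B i) //.
by apply: bigcap_measurableType => i _; rewrite -[X in measurable X]setTI; exact: mf.
Qed.

Definition first_hit (u : nat -> S * bool) n : bool :=
  (u n).2 && [forall j : 'I_n, ~~ (u j).2].

Lemma first_hitP (u : nat -> S * bool) n :
  reflect ((u n).2 /\ forall j, (j < n)%N -> ~~ (u j).2) (first_hit u n).
Proof.
apply: (iffP andP) => -[h1 h2]; split => //.
  by move=> j jn; have /forallP/(_ (Ordinal jn)) := h2.
by apply/forallP => j; exact: h2.
Qed.

Lemma first_hit_inj (u : nat -> S * bool) n m : first_hit u n -> first_hit u m -> n = m.
Proof.
move=> /first_hitP[n1 n2] /first_hitP[m1 m2].
by case: (ltngtP n m) => // [/m2|/n2]; rewrite ?n1 ?m1.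
Qed.

Lemma first_hit_ex (u : nat -> S * bool) n : (u n).2 -> exists m, first_hit u m.
Proof.
move=> un; have ex : exists n, (u n).2 by exists n.
case: (ex_minnP ex) => m um hm; exists m; apply/first_hitP; split => // j jm.
by apply/negP => /hm; rewrite leqNgt jm.
Qed.

(** The position of the first coin equal to one; the value [0] on the null set
    where there is none makes the operations below total. *)
Definition hit (u : nat -> S * bool) : nat := xget 0%N [set n | first_hit u n].

Lemma hitE (u : nat -> S * bool) n : first_hit u n -> hit u = n.
Proof.
move=> h; rewrite /hit; case: xgetP => [m _ /= hm|/(_ n)]; last by [].
exact: first_hit_inj hm h.
Qed.

Lemma hit_eq (u : nat -> S * bool) n :
  hit u = n <-> first_hit u n \/ n = 0%N /\ forall i, ~~ (u i).2.
Proof.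
split=> [<-|[/hitE//|[-> h]]].
  rewrite /hit; case: xgetP => [m _ /= hm|h]; first by left.
  by right; split => // i; apply/negP => /first_hit_ex[m /h].
rewrite /hit; case: xgetP => // m _ /= /first_hitP[um _].
by have := h m; rewrite um.
Qed.

Definition duration u := (hit u).+1.
Definition next_excursion (u : paths) : paths := fun i => u (duration u + i)%N.
(** The path frozen at its first regeneration: it retains exactly the information
    of its first excursion. *)
Definition stopped (u : paths) : paths := fun i => u (minn i (hit u)).

Lemma measurable_coord_hit i : measurable [set u : paths | (u i).2].
Proof.
rewrite -[X in measurable X]setTI.
exact: (measurableT_comp (@measurable_snd _ _ S bool) (measurable_coord i) measurableT
  (Y := [set true])).
Qed.

Lemma measurable_first_hit n : measurable [set u : paths | first_hit u n].
Proof.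
rewrite (_ : [set _ | _] = [set u : paths | (u n).2] `&`
   \bigcap_(j in `I_n) ~` [set u : paths | (u j).2]).
  apply: measurableI; first exact: measurable_coord_hit.
  by apply: bigcap_measurableType => j _; apply: measurableC; exact: measurable_coord_hit.
apply/seteqP; split => [u /= /first_hitP[h1 h2]|u /= [h1 h2]].
  by split => // j /= /h2/negP.
by apply/first_hitP; split => // j /h2 /negP.
Qed.

Lemma measurable_hit n : measurable [set u : paths | hit u = n].
Proof.
rewrite (_ : [set _ | _] = [set u : paths | first_hit u n] `|`
  ([set u | n = 0%N] `&` \bigcap_i ~` [set u : paths | (u i).2])).
  apply: measurableU; first exact: measurable_first_hit.
  apply: measurableI; last first.
    by apply: bigcap_measurableType => j _; apply: measurableC; exact: measurable_coord_hit.
  by have [->|n0] := eqVneq n 0%N;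
    [rewrite (_ : [set _ | _] = setT)//; apply/seteqP
    |rewrite (_ : [set _ | _] = set0)//; apply/seteqP; split => // u /= /eqP; rewrite (negbTE n0)].
apply/seteqP; split => [u /= /hit_eq[h|[n0 h]]|u /=]; first by left.
  by right; split => // i _ /=; apply/negP.
by move=> [h|[n0 h]]; apply/hit_eq; [left|right; split => // i; apply/negP; exact: h].
Qed.

Lemma measurable_next_excursion : measurable_fun setT next_excursion.
Proof.
apply: measurable_to_paths => i.
apply: (measurable_select measurable_hit (f := fun n u => (u (n.+1 + i)%N : S * bool))).
by move=> n; exact: measurable_coord.
Qed.

Lemma measurable_stopped : measurable_fun setT stopped.
Proof.
apply: measurable_to_paths => i.
apply: (measurable_select measurable_hit (f := fun n u => (u (minn i n) : S * bool))).
by move=> n; exact: measurable_coord.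
Qed.

End path_space.

Lemma measure_setI_conull (R : realType) d (T : measurableType d)
    (mu : {measure set T -> \bar R}) (A U : set T) : measurable A -> measurable U ->
  mu (~` U) = 0%E -> mu A = mu (A `&` U).
Proof.
move=> mA mU U0; have mUC := measurableC mU.
rewrite -[in LHS](setIT A) -(setUv U) setIUr measureU.
- rewrite [X in (_ + X)%E](_ : _ = 0%E) ?adde0//.
  apply: (subset_measure0 _ _ _ U0) => //; first exact: measurableI.
- exact: measurableI.
- exact: measurableI.
- by rewrite setIACA setICr setI0.
Qed.

(** A product rule can be checked on the pieces of a countable partition of almost
    all of the space. *)
Lemma measure_partition (R : realType) d (T : measurableType d)
    (mu : {measure set T -> \bar R}) (E : nat -> set T) (A B : set T) (q : R) :
  0 <= q -> (forall i, measurable (E i)) -> trivIset setT E ->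
  mu (~` \bigcup_i E i) = 0%E -> measurable A -> measurable B ->
  (forall i, mu (A `&` E i) = mu (B `&` E i) * q%:E)%E -> (mu A = mu B * q%:E)%E.
Proof.
move=> q0 mE tE E0 mA mB h.
have mU : measurable (\bigcup_i E i) by exact: bigcup_measurable.
have sumE C : measurable C -> mu C = (\sum_(0 <= i <oo) mu (C `&` E i))%E.
  move=> mC; rewrite -measure_semi_bigcup.
  - by rewrite -setI_bigcupr -(measure_setI_conull mC mU E0).
  - by move=> i; exact: measurableI.
  - exact: trivIset_setIl.
  - by apply: bigcup_measurable => i _; exact: measurableI.
rewrite (sumE A)// (sumE B)// muleC.
under eq_eseriesr do rewrite h muleC.
by rewrite nneseriesZl.
Qed.

(** * Independence of the excursions *)

Section excursion_law.
Context (R : realType) (d d' : measure_display) (S : measurableType d)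
  (Omega : measurableType d').
Variables (X : nat -> {mfun Omega >-> S}) (xi : nat -> {mfun Omega >-> bool}).

Local Notation sh := (split_history X xi).
Local Notation shT n m := (g_sigma_algebraType (history X n `|` history xi m)).
Local Notation regen := (regen xi).

Definition future n (w : Omega) : paths S := fun i => (X (n.+1 + i)%N w, xi (n.+1 + i)%N w).

(** The path after the first regeneration at a positive time. *)
Definition excursion (w : Omega) : paths S := next_excursion (future 0 w).

Lemma measurable_future n : measurable_fun setT (future n).
Proof. by apply: measurable_to_paths => i; exact: measurable_fun_pair. Qed.

Lemma measurable_excursion : measurable_fun setT excursion.
Proof. exact: (measurableT_comp (@measurable_next_excursion _ S) (measurable_future 0)). Qed.

Lemma next_excursion_future n w k :
  first_hit (future n w) k -> next_excursion (future n w) = future (n + k.+1)%N w.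
Proof.
move=> h; apply/funext => i; rewrite /next_excursion /duration (hitE h) /future.
by have -> : (n.+1 + (k.+1 + i) = (n + k.+1).+1 + i)%N by lia.
Qed.

Lemma stopped_future n w k : first_hit (future n w) k ->
  stopped (future n w) = (fun i => future n w (minn i k)).
Proof. by move=> h; apply/funext => i; rewrite /stopped (hitE h). Qed.

Lemma future_first_hit_sh n k p q : (n.+1 + k < q)%N ->
  sh p q [set w | first_hit (future n w) k].
Proof.
move=> nkq; rewrite (_ : [set _ | _] = regen (n.+1 + k)%N `&`
   \bigcap_(j in `I_k) ~` regen (n.+1 + j)%N).
  apply: split_historyI; first exact: sh_regen.
  by apply: split_history_bigcap => j jk; apply: sh_nregen; lia.
apply/seteqP; split => [w /= /first_hitP[h1 h2]|w /= [h1 h2]].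
  by split => // j /= /h2/negP.
by apply/first_hitP; split => // j /h2 /negP.
Qed.

Lemma future_first_hit_regen n k :
  [set w | first_hit (future n w) k] `<=` regen (n.+1 + k)%N.
Proof. by move=> w /= /first_hitP[]. Qed.

Lemma future_sh n k p q (V : set (paths S)) : (n.+1 + k < p)%N -> (n.+1 + k < q)%N -> measurable V ->
  sh p q [set w | V (fun i => future n w (minn i k))].
Proof.
move=> np nq mV.
have mf : measurable_fun setT (fun w : shT p q => (fun i => future n w (minn i k)) : paths S).
  apply: measurable_to_paths => i.
  have [h1 h2] : (n.+1 + minn i k < p)%N /\ (n.+1 + minn i k < q)%N by split; lia.
  apply: measurable_fun_pair => _ B mB; rewrite setTI.
    exact: split_history_X.
  exact: split_history_xi.
by have := mf measurableT V mV; rewrite setTI.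
Qed.

Variable Pr : probability Omega R.
Variables (P : R.-pker S ~> S) (s : S -> R) (nu : probability S R).
Hypotheses (hmin : minorized P s nu) (hsplit : split_chain X xi P s nu Pr).
Hypothesis rec : Pr [set w | (exists i, first_hit (future 0 w) i) /\
                             exists j, first_hit (excursion w) j] = 1%E.
Local Open Scope ereal_scope.

Definition excursion_law : probability (paths S) R :=
  distribution Pr (mfun_Sub (mem_set measurable_excursion)).
Local Notation Q := excursion_law.

Lemma excursion_lawE U : Q U = Pr (excursion @^-1` U).
Proof. by []. Qed.

Let E1 i : set Omega := [set w | first_hit (future 0 w) i].

Let mE1 i : measurable (E1 i).
Proof. exact: (split_history_measurable (@future_first_hit_sh 0 i 0 i.+2 (ltnSn _))). Qed.

Let tE1 : trivIset setT E1.
Proof. by apply/trivIsetP => i j _ _ ij; apply/seteqP; split => // w [/= h1 h2];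
  move/eqP : ij; apply; exact: first_hit_inj h1 h2. Qed.

Let m_ex_hit : measurable [set u : paths S | exists j, first_hit u j].
Proof.
rewrite (_ : [set _ | _] = \bigcup_j [set u : paths S | first_hit u j]).
  by apply: bigcup_measurable => j _; exact: measurable_first_hit.
by apply/seteqP; split => [u [j uj]|u [j _ uj]]; exists j.
Qed.

Let recE : [set w | (exists i, first_hit (future 0 w) i) /\
    exists j, first_hit (excursion w) j] =
  \bigcup_i E1 i `&` excursion @^-1` [set u | exists j, first_hit u j].
Proof.
by apply/seteqP; split => [w [[i wi] wj]|w [[i _ wi] wj]]; split => //; exists i.
Qed.

Let m_exc U : measurable U -> measurable (excursion @^-1` U).
Proof. by move=> mU; rewrite -[X in measurable X]setTI; exact: measurable_excursion. Qed.

Lemma first_regeneration : Pr (\bigcup_i E1 i) = 1.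
Proof.
apply/eqP; rewrite eq_le probability_le1/=; last by apply: bigcup_measurable.
rewrite -rec recE; apply: le_measure; rewrite ?inE//.
- by apply: measurableI; [exact: bigcup_measurable|exact: m_exc].
- exact: bigcup_measurable.
Qed.

Let E1_null : Pr (~` \bigcup_i E1 i) = 0.
Proof.
by rewrite probability_setC; [rewrite first_regeneration subee|exact: bigcup_measurable].
Qed.

Lemma excursion_law_recurrent : Q [set u | exists j, first_hit u j] = 1.
Proof.
apply/eqP; rewrite eq_le probability_le1//= excursion_lawE.
rewrite -rec recE; apply: le_measure; rewrite ?inE//.
- by apply: measurableI; [exact: bigcup_measurable|exact: m_exc].
- exact: m_exc.
Qed.

Let excursion_E1 i w : E1 i w -> excursion w = future i.+1 w.
Proof. by move=> h; rewrite /excursion (next_excursion_future h) add0n. Qed.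

Let E1_sh i : sh i.+2 i.+2 (E1 i).
Proof. exact: future_first_hit_sh. Qed.

Let E1_regen i : E1 i `<=` regen i.+1.
Proof. exact: future_first_hit_regen. Qed.

Let regeneration_cyl n H m B : sh n.+1 n.+1 H -> H `<=` regen n ->
  (forall i, measurable (B i)) ->
  Pr (H `&` future n @^-1` [set u | forall i, (i < m)%N -> B i (u i)]) =
  Pr H * Q [set u | forall i, (i < m)%N -> B i (u i)].
Proof.
move=> shH Hn mB; set U := [set u | _].
have [kap kap0 hk] := regeneration_cylinder hmin hsplit m mB.
have mU : measurable (U : set (paths S)) by apply: sub_gen_smallest; exists m, B.
have fU k : future k @^-1` U = cylinder_from X xi k.+1 m B by [].
rewrite fU hk//; congr (_ * _); rewrite excursion_lawE -[LHS]mul1e -(probability_setT Pr).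
apply/esym/(measure_partition kap0 mE1 tE1 E1_null) => // [|i].
  exact: m_exc.
rewrite setTI -(hk i.+1 _ (@E1_sh i) (@E1_regen i)); congr (Pr _).
by apply/seteqP; split => w [h1 h2]; split => //; move: h1 h2;
  rewrite /= => h1 h2; [move: h1|]; rewrite ?(excursion_E1 h2) ?(excursion_E1 h1).
Qed.

(** A regeneration at a fixed time [n] restarts the path with the law [Q],
    independently of the past.  The constant of [regeneration_cylinder] is
    identified as the value of [Q] by splitting according to the time of the
    first regeneration; cylinders determine the measure. *)
Lemma regeneration n H U : sh n.+1 n.+1 H -> H `<=` regen n -> measurable U ->
  Pr (H `&` future n @^-1` U) = Pr H * Q U.
Proof.
move=> shH Hn mU.
have mH : measurable H by exact: split_history_measurable shH.
have PrH0 : (0 <= fine (Pr H))%R by rewrite fine_ge0.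
pose m1 := image_measure (mrestr Pr mH) (measurable_future n).
pose m2 : {measure set (paths S) -> \bar R} := mscale (NngNum PrH0) Q.
suff : m1 U = m2 U.
  rewrite /m1 image_measureE /= /mrestr setIC => ->.
  by rewrite -[in RHS](fineK (fin_num_measure Pr _ mH)).
apply: (@measure_unique _ R (paths S) (@cylinders _ S) (fun=> setT)) => //.
- exact: cylinders_setI.
- by move=> _; exists 0%N, (fun=> setT); split => //; apply/seteqP; split.
- by rewrite bigcup_const//; exists 0%N.
- move=> _ [m [B [mB ->]]]; rewrite /m1 image_measureE /= /mrestr setIC regeneration_cyl//.
  by rewrite -[in LHS](fineK (fin_num_measure Pr _ mH)).
- by move=> _; rewrite /m1 image_measureE /= /mrestr preimage_setT setTI -ge0_fin_numE// fin_num_measure.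
Qed.

Let E2 i j : set Omega := E1 i `&` [set w | first_hit (future i.+1 w) j].

Let E2_sh i j : sh (i.+1 + j.+1).+1 (i.+1 + j.+1).+1 (E2 i j).
Proof.
apply: split_historyI; last by apply: future_first_hit_sh; lia.
by apply: split_history_sub (@E1_sh i); lia.
Qed.

(** The strong Markov property at the second regeneration: on the event that the
    first two regenerations occur at given times the claim is [regeneration]. *)
Lemma stopped_next_independent (U V : set (paths S)) : measurable U -> measurable V ->
  Q (@stopped _ S @^-1` V `&` @next_excursion _ S @^-1` U) = Q (@stopped _ S @^-1` V) * Q U.
Proof.
move=> mU mV.
have mstop (Z : set (paths S)) : measurable Z -> measurable (@stopped _ S @^-1` Z).
  by move=> mZ; rewrite -[X in measurable X]setTI; exact: measurable_stopped.
have mnext (Z : set (paths S)) : measurable Z -> measurable (@next_excursion _ S @^-1` Z).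
  by move=> mZ; rewrite -[X in measurable X]setTI; exact: measurable_next_excursion.
have QU0 : (0 <= fine (Q U))%R by rewrite fine_ge0.
rewrite !excursion_lawE -[X in _ * X](fineK (fin_num_measure Q _ mU)).
apply: (measure_partition QU0 mE1 tE1 E1_null) => [||i].
- by apply: m_exc; apply: measurableI; [exact: mstop|exact: mnext].
- by apply: m_exc; exact: mstop.
pose F j : set Omega := [set w | first_hit (future i.+1 w) j].
have mF j : measurable (F j).
  exact: (split_history_measurable (@future_first_hit_sh i.+1 j 0 (i.+2 + j).+1 (ltnSn _))).
pose nofuture : set Omega := E1 i `&` ~` \bigcup_j F j.
have nofuture0 : Pr nofuture = 0.
  have mS : measurable ([set w | (exists i, first_hit (future 0 w) i) /\
                             exists j, first_hit (excursion w) j]).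
    by rewrite recE; apply: measurableI; [exact: bigcup_measurable|exact: m_exc].
  apply: (subset_measure0 (B := ~` [set w | (exists i, first_hit (future 0 w) i) /\
                             exists j, first_hit (excursion w) j])).
  - by apply: measurableI => //; apply: measurableC; exact: bigcup_measurable.
  - exact: measurableC.
  - move=> w [wi nwj] [_ [j wj]]; apply: nwj; exists j => //.
    by rewrite /F /= -(excursion_E1 wi).
  - by apply: (etrans (probability_setC Pr mS)); rewrite rec subee.
have mexcV : measurable (excursion @^-1` (@stopped _ S @^-1` V)).
  by apply: m_exc; exact: mstop.
have mexcU : measurable (excursion @^-1` (@next_excursion _ S @^-1` U)).
  by apply: m_exc; exact: mnext.
pose mu := mrestr Pr (mE1 i).
have muE A : mu A = Pr (A `&` E1 i) by [].
suff : mu (excursion @^-1` (@stopped _ S @^-1` V `&` @next_excursion _ S @^-1` U)) =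
    mu (excursion @^-1` (@stopped _ S @^-1` V)) * (fine (Q U))%:E by [].
apply: (measure_partition QU0 mF) => //.
- by apply/trivIsetP => j k _ _ jk; apply/seteqP; split => // w [/= h1 h2];
    move/eqP : jk; apply; exact: first_hit_inj h1 h2.
- by rewrite /mu /= /mrestr setIC.
- exact: measurableI.
move=> j; rewrite /mu /= /mrestr; set H := excursion @^-1` (@stopped _ S @^-1` V) `&` F j `&` E1 i.
have HE : H = E2 i j `&` [set w | V (fun k => future i.+1 w (minn k j))].
  apply/seteqP; split => w.
    by move=> [[Vw wj] wi]; split => //; move: Vw; rewrite /= (excursion_E1 wi) (stopped_future wj).
  by move=> [[wi wj] Vw]; split => //; split => //=; rewrite (excursion_E1 wi) (stopped_future wj).
have shH : sh (i.+1 + j.+1).+1 (i.+1 + j.+1).+1 H.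
  by rewrite HE; apply: split_historyI => //; apply: future_sh => //; lia.
have Hreg : H `<=` regen (i.+1 + j.+1)%N.
  move=> w [[_ wj] _]; rewrite (_ : (i.+1 + j.+1 = i.+2 + j)%N); last by lia.
  exact: future_first_hit_regen wj.
rewrite fineK ?fin_num_measure// -(regeneration shH Hreg mU); congr (Pr _).
apply/seteqP; split => w.
  move=> [[[Vw Uw] wj] wi]; split; first by split.
  by move: Uw; rewrite /= (excursion_E1 wi) (next_excursion_future wj).
move=> [[[Vw wj] wi] Uw]; split => //; split => //; split => //.
by rewrite /= (excursion_E1 wi) (next_excursion_future wj).
Qed.

Lemma regenerative_excursion_law :
  regenerative Q (@stopped _ S) (@next_excursion _ S).
Proof.
have mst := @measurable_stopped _ S; have mnx := @measurable_next_excursion _ S.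
split => // F mF F0.
pose D : probability (paths S) R := distribution Q (mfun_Sub (mem_set mst)).
have mpair := measurable_fun_pair mst mnx.
have lawE (A : set (paths S * paths S)) : measurable A ->
    (D \x Q) A = image_measure Q mpair A.
  move=> mA; apply: (@product_measure_unique _ _ _ _ _ D Q) => // V U mV mU.
  exact: stopped_next_independent.
rewrite -[LHS]/(\int[Q]_u (F \o (fun u : paths S => (stopped u, next_excursion u))) u).
rewrite -(ge0_integral_pushforward mpair Q measurableT mF)//.
rewrite (eq_measure_integral (D \x Q)); last first.
  by move=> A mA _; apply: esym; exact: lawE.
rewrite fubini_tonelli1// /fubini_F.
rewrite ge0_integral_distribution//.
  by apply: measurable_fun_fubini_tonelli_F.
by move=> u; apply: integral_ge0.
Qed.

End excursion_law.

(** * Occupation times of one excursion *)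

Lemma mule_cancel (R : realType) (x a b : \bar R) : x \is a fin_num -> (0 < x)%E ->
  (x * a = x * b)%E -> a = b.
Proof.
by move=> xf x0 h; apply/eqP; rewrite eq_le; apply/andP; split;
  rewrite -(lee_pmul2l xf x0) h lexx.
Qed.

Section occupation_of_excursions.
Context (R : realType) (d d' : measure_display) (S : measurableType d)
  (Omega : measurableType d').
Variables (X : nat -> {mfun Omega >-> S}) (xi : nat -> {mfun Omega >-> bool}).
Variable Pr : probability Omega R.
Variables (P : R.-pker S ~> S) (s : S -> R) (nu : probability S R).
Hypotheses (hmin : minorized P s nu) (hsplit : split_chain X xi P s nu Pr).
Hypothesis rec : Pr [set w | (exists i, first_hit (future X xi 0 w) i) /\
                             exists j, first_hit (excursion X xi w) j] = 1%E.
Local Open Scope ereal_scope.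
Local Notation Q := (excursion_law X xi Pr).
Local Notation sh := (split_history X xi).

Definition avoid i : set (paths S) := [set u | forall j, (j < i)%N -> ~~ (u j).2].

Lemma measurable_avoid i : measurable (avoid i).
Proof.
rewrite (_ : avoid i = \bigcap_(j in `I_i) ~` [set u : paths S | (u j).2]).
  by apply: bigcap_measurableType => j _; apply: measurableC; exact: measurable_coord_hit.
by apply/seteqP; split => u h j /h /negP.
Qed.

Lemma measurable_coord_fst i : measurable_fun setT (fun u : paths S => (u i).1 : S).
Proof. exact: (measurableT_comp measurable_fst (@measurable_coord _ S i)). Qed.

(** The law of the state at the time [i] of an excursion that is not yet over. *)
Definition killed_law i : {measure set S -> \bar R} :=
  image_measure (mrestr Q (measurable_avoid i)) (measurable_coord_fst i).

Lemma killed_lawE i B : killed_law i B = Q ([set u | B (u i).1] `&` avoid i).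
Proof. by []. Qed.

Let measurable_cs i B : measurable B -> measurable [set u : paths S | B (u i).1].
Proof. by move=> mB; rewrite -[X in measurable X]setTI; exact: measurable_coord_fst. Qed.

Let first_regeneration_charged : exists i0, Pr [set w | first_hit (future X xi 0 w) i0] != 0.
Proof.
apply/not_existsP => h.
have : Pr (\bigcup_i [set w | first_hit (future X xi 0 w) i]) <= 0.
  have mE i : measurable [set w | first_hit (future X xi 0 w) i].
    exact: (split_history_measurable (@future_first_hit_sh _ _ _ _ X xi 0 i 0 i.+2 (ltnSn _))).
  apply: le_trans (generalized_Boole_inequality Pr _ _) _ => //.
    exact: bigcup_measurable.
  by rewrite eseries0// => i _ _; apply/eqP; have := h i => /negP; rewrite negbK.
by rewrite (first_regeneration rec) lee_fin ler10.
Qed.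

Let killed_step : exists (n : nat) (H : set Omega),
  [/\ sh n.+1 n.+1 H, H `<=` regen xi n & Pr H != 0].
Proof.
have [i0 h] := first_regeneration_charged.
exists i0.+1, [set w | first_hit (future X xi 0 w) i0]; split => //.
  exact: future_first_hit_sh.
exact: future_first_hit_regen.
Qed.

Lemma killed_law0 B : measurable B -> killed_law 0 B = nu B.
Proof.
move=> mB; have [n [H [shH Hn H0]]] := killed_step.
have mH : measurable H := split_history_measurable shH.
have h := regeneration hmin hsplit rec shH Hn
  (measurableI _ _ (measurable_cs 0 mB) (measurable_avoid 0)).
have [_ h' _] := hsplit; have := h' n H B shH mB.
rewrite -[H `&` _]/(H `&` regen xi n) (setIidl Hn) => {}h'.
apply: (mule_cancel (fin_num_measure Pr _ mH)); first by rewrite lt0e H0/=.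
rewrite killed_lawE -h -h'; congr (Pr _).
apply/seteqP; split => w; first by move=> [Hw [/= Bw _]]; split => //; rewrite addn0 in Bw.
by move=> [Hw Bw]; split => //; split => //=; rewrite addn0.
Qed.

(** While the excursion lasts the chain moves by the excess kernel, so these laws
    satisfy the recursion of the occupation measure.  Under [Q] this is read off
    the original chain after any regeneration of positive probability. *)
Lemma killed_lawS i B : measurable B ->
  killed_law i.+1 B = \int[killed_law i]_x excess P s nu B x.
Proof.
move=> mB; have [n [H [shH Hn H0]]] := killed_step.
have mH : measurable H := split_history_measurable shH.
pose N := (n.+1 + i)%N.
pose Hi := H `&` future X xi n @^-1` avoid i.
have shHi : sh N.+1 N Hi.
  apply: split_historyI; first by apply: split_history_sub shH; rewrite /N; lia.
  rewrite (_ : _ @^-1` _ = \bigcap_(j in `I_i) ~` regen xi (n.+1 + j)%N).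
    by apply: split_history_bigcap => j ji; apply: sh_nregen; rewrite /N; lia.
  by apply/seteqP; split => w h j /h /negP.
have mHi : measurable Hi := split_history_measurable shHi.
have Hfin := fin_num_measure Pr _ mH.
have PrH0 : (0 <= fine (Pr H))%R by rewrite fine_ge0.
apply: (mule_cancel Hfin); first by rewrite lt0e H0/=.
transitivity (Pr (Hi `&` ~` regen xi N `&` X N.+1 @^-1` B)).
  rewrite killed_lawE -(regeneration hmin hsplit rec shH Hn
    (measurableI _ _ (measurable_cs _ mB) (measurable_avoid _))); congr (Pr _).
  rewrite /N -addnS; apply/seteqP; split => w.
    move=> [Hw [Bw aw]]; split; last exact: Bw.
    split; first by split => // j ji; apply: aw; exact: ltnW.
    by apply/negP; exact: aw.
  move=> [[[Hw aw] rw] Bw]; split => //; split => // j.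
  by rewrite ltnS leq_eqVlt => /predU1P[->|]; [exact/negP|exact: aw].
have := law_next_nregen hmin hsplit shHi mB; rewrite lawE => ->.
rewrite -[in RHS](fineK Hfin) -[fine _]/((NngNum PrH0)%:num)%R -ge0_integral_mscale//.
- apply: eq_measure_integral => A mA _; rewrite lawE.
  rewrite (_ : _ `&` _ = H `&` future X xi n @^-1` ([set u | A (u i).1] `&` avoid i)).
    rewrite (regeneration hmin hsplit rec shH Hn)//.
      by rewrite -[in LHS](fineK Hfin).
    exact: (measurableI _ _ (measurable_cs _ mA) (measurable_avoid _)).
  by apply/seteqP; split => [w [[Hw aw] Aw]|w [Hw [Aw aw]]]; split.
- exact: (measurable_excess hmin).
- by move=> x _; exact: (excess_ge0 hmin).
Qed.

Lemma killed_law_vanishes : (fun i => killed_law i setT) @ \oo --> 0.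
Proof.
rewrite (_ : (fun i => _) = Q \o avoid); last first.
  by apply/funext => i; rewrite killed_lawE /= setTI.
have -> : 0 = Q (\bigcap_i avoid i).
  apply/esym; rewrite (_ : \bigcap_i _ = ~` [set u : paths S | exists j, first_hit u j]).
    rewrite probability_setC ?(excursion_law_recurrent rec) ?subee//.
    rewrite (_ : [set _ | _] = \bigcup_j [set u : paths S | first_hit u j]).
      by apply: bigcup_measurable => j _; exact: measurable_first_hit.
    by apply/seteqP; split => [u [j uj]|u [j _ uj]]; exists j.
  apply/seteqP; split => [u au [j /first_hitP[uj _]]|u nu' i _ j _].
    by have := au j.+1 I j (ltnSn j); rewrite uj.
  by apply/negP => /first_hit_ex[m hm]; apply: nu'; exists m.
apply: nonincreasing_cvg_mu.
- by rewrite (le_lt_trans (probability_le1 _ (measurable_avoid 0)))// ltry.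
- exact: measurable_avoid.
- by apply: bigcap_measurableType => i _; exact: measurable_avoid.
- by move=> m n mn; apply/subsetPset => u h j jm; apply: h; exact: leq_trans mn.
Qed.

Definition excursion_sum (f : S -> R) (u : paths S) : R :=
  (\sum_(i < duration u) f (u i).1)%R.

Lemma measurable_excursion_sum f : measurable_fun setT f ->
  measurable_fun setT (excursion_sum f).
Proof.
move=> mf; apply: (measurable_select (@measurable_hit _ S)
  (f := fun n u => (\sum_(i < n.+1) f (u i).1)%R)) => n.
apply: measurable_sum => i; exact: (measurableT_comp mf (measurable_coord_fst i)).
Qed.

(** The visit at the time [i] counts when the excursion is still running, that is
    when no coin before [i] has been one. *)
Lemma integral_excursion_visits A : measurable A ->
  \int[Q]_u (excursion_sum \1_A u)%:E = \sum_(0 <= i <oo) killed_law i A.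
Proof.
move=> mA; pose D i : set (paths S) := [set u | A (u i).1] `&` [set u | (i <= hit u)%N].
have mhit i : measurable [set u : paths S | (i <= hit u)%N].
  have := measurable_fun_nat (@measurable_hit _ S) measurableT (Y := [set k | (i <= k)%N]).
  by rewrite setTI; apply.
have mD i : measurable (D i) by apply: measurableI => //; exact: measurable_cs.
transitivity (\int[Q]_u \sum_(0 <= i <oo) (\1_(D i) u)%:E).
  apply: eq_integral => u _; rewrite (nneseries_split 0 (duration u)); last first.
    by move=> k _; rewrite lee_fin.
  rewrite add0n [X in _ + X]eseries0 ?adde0; last first.
    move=> i du _; rewrite indicE memNset// => -[_ /=]; rewrite leqNgt.
    by rewrite -ltnS ltnS; move: du; rewrite /duration => ->.
  rewrite big_mkord /excursion_sum -sumEFin; apply: eq_bigr => i _.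
  rewrite !indicE; congr ((nat_of_bool _)%:R%:E).
  apply/idP/idP; rewrite !inE; first by move=> h; split => //=; rewrite -ltnS.
  by move=> [].
rewrite integral_nneseries//; last first.
  by move=> i; apply/measurable_EFinP; exact: measurable_indic.
apply: eq_eseriesr => i _; rewrite integral_indic// setIT killed_lawE.
pose U : set (paths S) := [set u | exists j, first_hit u j].
have mU : measurable U.
  rewrite (_ : U = \bigcup_j [set u : paths S | first_hit u j]).
    by apply: bigcup_measurable => j _; exact: measurable_first_hit.
  by apply/seteqP; split => [u [j uj]|u [j _ uj]]; exists j.
have QU : Q (~` U) = 0.
  by rewrite probability_setC// (excursion_law_recurrent rec) subee.
rewrite (measure_setI_conull (mD i) mU QU).
rewrite [RHS](measure_setI_conull _ mU QU); last first.
  exact: (measurableI _ _ (measurable_cs _ mA) (measurable_avoid _)).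
congr (Q _); apply/seteqP; split => u [[Au hu] [j uj]]; split; try by exists j.
  split => // k ki; have /first_hitP[_] := uj; apply.
  by rewrite -(hitE uj); exact: leq_trans ki hu.
split => //=; rewrite (hitE uj) leqNgt; apply/negP => ji.
by have := hu j ji; have /first_hitP[-> _] := uj.
Qed.

End occupation_of_excursions.

(** * Cutting time sums at the renewals *)

Section excursion_decomposition.
Context (R : realType) (d : measure_display) (S : measurableType d).
Local Notation next := (@next_excursion _ S).
Local Notation stop := (@stopped _ S).
Implicit Types (u : paths S) (f : S -> R).

Lemma hit_stopped u : hit (stop u) = hit u.
Proof.
have [h|[h0 h]] := (hit_eq u (hit u)).1 erefl.
  have /first_hitP[h1 h2] := h; apply: hitE; apply/first_hitP; split.
    by rewrite /stopped minnn.
  by move=> j jh; rewrite /stopped (minn_idPl (ltnW jh)); exact: h2.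
by rewrite h0; apply/hit_eq; right; split => // i; exact: h.
Qed.

Lemma excursion_sum_stopped f u : excursion_sum f (stop u) = excursion_sum f u.
Proof.
rewrite /excursion_sum /duration hit_stopped; apply: eq_bigr => i _.
by rewrite /stopped (minn_idPl (_ : (i <= hit u)%N))// -ltnS.
Qed.

Lemma duration_stopped u : duration (stop u) = duration u.
Proof. by rewrite /duration hit_stopped. Qed.

Definition renewal_time k u : nat := (\sum_(x <- traject next u k) duration x)%N.

Lemma renewal_timeS k u : renewal_time k.+1 u = (duration u + renewal_time k (next u))%N.
Proof. by rewrite /renewal_time trajectS big_cons. Qed.

Lemma renewal_timeSr k u :
  renewal_time k.+1 u = (renewal_time k u + duration (iter k next u))%N.
Proof. by rewrite /renewal_time trajectSr -cats1 big_cat/= big_seq1. Qed.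

Lemma renewal_time_lt k u : (renewal_time k u < renewal_time k.+1 u)%N.
Proof. by rewrite renewal_timeSr /duration addnS ltnS leq_addr. Qed.

Lemma renewal_time_homo k l u : (k <= l)%N -> (renewal_time k u <= renewal_time l u)%N.
Proof.
move=> kl; rewrite -(subnK kl); elim: (l - k)%N => [//|j IH].
by rewrite addSn (leq_trans IH)// ltnW// renewal_time_lt.
Qed.

Definition time_sum f n u : R := \sum_(i < n) f (u i).1.

Lemma time_sumD f n m u :
  time_sum f (n + m) u = time_sum f n u + time_sum f m (fun i => u (n + i)%N).
Proof. by rewrite /time_sum big_split_ord. Qed.

Lemma time_sum_renewal f k u :
  time_sum f (renewal_time k u) u = block_sum stop next (excursion_sum f) k u.
Proof.
elim: k u => [|k IH] u; first by rewrite /renewal_time /block_sum /time_sum !big_nil big_ord0.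
by rewrite renewal_timeS time_sumD block_sumS excursion_sum_stopped -IH.
Qed.

Lemma iter_next_renewal k u : iter k next u = (fun i => u (renewal_time k u + i)%N).
Proof.
elim: k => [|k IH]; first by apply/funext => i; rewrite /renewal_time big_nil.
apply/funext => i; transitivity (iter k next u (duration (iter k next u) + i)%N) => //.
by rewrite {1}IH renewal_timeSr addnA.
Qed.

Lemma time_sum_excursions f n u k : (renewal_time k u <= n)%N ->
  time_sum f n u = block_sum stop next (excursion_sum f) k u +
    time_sum f (n - renewal_time k u) (iter k next u).
Proof.
by move=> kn; rewrite -{1}(subnKC kn) time_sumD time_sum_renewal iter_next_renewal.
Qed.

(** Every time lies in exactly one excursion because durations are positive. *)
Lemma excursion_index n u : exists k, (renewal_time k u <= n < renewal_time k.+1 u)%N.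
Proof.
have lb k : (k <= renewal_time k u)%N.
  by elim: k => [//|k IH]; exact: leq_ltn_trans IH (renewal_time_lt _ _).
have ex : exists k, (n < renewal_time k.+1 u)%N by exists n; exact: lb.
case: (ex_minnP ex) => k nk km; exists k; rewrite nk andbT.
case: k km {nk} => [|k] km; first by rewrite /renewal_time big_nil.
by rewrite leqNgt; apply/negP => /km; rewrite ltnn.
Qed.

Lemma time_sum_le_excursion f (g : S -> R) n u : (forall x, `|f x| <= g x) ->
  (n <= duration u)%N -> `|time_sum f n u| <= excursion_sum g u.
Proof.
move=> fg nu; apply: (le_trans (ler_norm_sum _ _ _)).
rewrite /excursion_sum -(subnKC nu) big_split_ord/=.
rewrite -[leLHS]addr0 lerD//; first by apply: ler_sum => i _; exact: fg.
by apply: sumr_ge0 => i _; exact: le_trans (normr_ge0 _) (fg _).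
Qed.

Lemma excursion_sum_ge0 f u : (forall x, 0 <= f x) -> 0 <= excursion_sum f u.
Proof. by move=> f0; apply: sumr_ge0. Qed.

Lemma le_excursion_sum f g u : (forall x, f x <= g x) ->
  excursion_sum f u <= excursion_sum g u.
Proof. by move=> fg; apply: ler_sum. Qed.

Lemma time_sum_ge0 f n u : (forall x, 0 <= f x) -> 0 <= time_sum f n u.
Proof. by move=> f0; apply: sumr_ge0. Qed.

Definition truncated_duration (n : nat) u : R := (minn (duration u) n)%:R.

Lemma truncated_duration_stopped n u :
  truncated_duration n (stop u) = truncated_duration n u.
Proof. by congr (minn _ _)%:R; exact: duration_stopped. Qed.

(** Durations truncated at a level above [m] whose sum is at most [m] were not
    truncated. *)
Lemma truncated_renewal_le n m k u : (m < n)%N ->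
  block_sum stop next (truncated_duration n) k u <= m%:R -> (renewal_time k u <= m)%N.
Proof.
move=> mn; rewrite /block_sum /renewal_time.
rewrite (eq_bigr (truncated_duration n)) => [|x _]; last exact: truncated_duration_stopped.
rewrite -natr_sum ler_nat; elim: (traject _ _ _) m mn => [|x t IH] m mn; first by rewrite !big_nil.
rewrite !big_cons => h.
have xn : (duration x < n)%N.
  by rewrite ltnNge; apply/negP => nx; move: h; rewrite (minn_idPr nx); lia.
move: h; rewrite (minn_idPl (ltnW xn)) => h.
have xm : (duration x <= m)%N by apply: leq_trans h; exact: leq_addr.
by rewrite -leq_subRL// IH ?leq_subRL//; exact: leq_ltn_trans (leq_subr _ _) mn.
Qed.

Lemma lt_truncated_renewal n k u :
  n%:R < block_sum stop next (truncated_duration n) k u -> (n < renewal_time k u)%N.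
Proof.
rewrite /block_sum (eq_bigr (truncated_duration n)) => [|x _]; last exact: truncated_duration_stopped.
rewrite -natr_sum ltr_nat => /leq_trans; apply; apply: leq_sum => x _; exact: geq_minl.
Qed.

End excursion_decomposition.

(** * Deviations of the empirical counts along a path *)

Section excursion_empirical.
Context (R : realType) (d : measure_display) (S : measurableType d).
Variable Q : probability (paths S) R.
Local Notation next := (@next_excursion _ S).
Local Notation stop := (@stopped _ S).
Hypothesis reg : regenerative Q stop next.
Variables (C : set S) (mC : measurable C).
Local Notation visits := (excursion_sum (\1_C : S -> R)).

Section grid.
Variables (m : nat) (A : nat -> set S) (p : nat -> R).
Hypotheses (mA : forall i, measurable (A i)) (A0 : A 0%N = set0)
  (AA : forall i j, (i <= j)%N -> A i `<=` A j) (Am : A m = C)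
  (AC : forall i, A i `<=` C) (p01 : forall i, 0 <= p i <= 1).

Definition excursion_count (b : paths S) i : R := excursion_sum \1_(A i) b.
Local Notation G := excursion_count.
Local Notation g := (centered m G p).

Definition deviation i (x : S) : R := \1_(A i) x - p i * \1_C x.

Lemma excursion_count0 b : G b 0%N = 0.
Proof. by rewrite /G A0 /excursion_sum big1// => i _; rewrite indic0. Qed.

Lemma indic_le (B B' : set S) x : B `<=` B' -> (\1_B x : R) <= \1_B' x.
Proof.
move=> BB; rewrite !indicE; have [|_] := boolP (x \in B); last by rewrite ler0n.
by rewrite inE => /BB Bx; rewrite mem_set.
Qed.

Lemma excursion_count_homo b i j : (i <= j)%N -> G b i <= G b j.
Proof. by move=> ij; apply: le_excursion_sum => x; apply: indic_le; exact: AA. Qed.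

Lemma excursion_count_max b i : G b i <= G b m.
Proof. by apply: le_excursion_sum => x; apply: indic_le; rewrite Am. Qed.

Lemma excursion_count_top b : G b m = visits b.
Proof. by rewrite /G Am. Qed.

Lemma deviation_sum i b : excursion_sum (deviation i) b = g b i.
Proof.
rewrite /centered excursion_count_top /G /excursion_sum mulr_sumr -sumrB.
by apply: eq_bigr.
Qed.

Lemma deviation_le i x : `|deviation i x| <= \1_C x.
Proof.
have /andP[p0 p1] := p01 i; rewrite /deviation !indicE.
have [|xA] := boolP (x \in A i).
  by rewrite inE => /AC xC; rewrite mem_set//= mulr1 ger0_norm ?subr_ge0// lerBlDr lerDl.
by case: (x \in C); rewrite ?mulr1 ?mulr0 ?subrr ?normr0// sub0r normrN ger0_norm.
Qed.

Variables (lam mu : R) (K0 K1 t : nat) (u : paths S).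
Hypotheses (h1 : (renewal_time K0 u <= t)%N) (h2 : (t < renewal_time K1 u)%N)
  (h3 : ~~ crosses stop next m g lam K1 (fun=> 0) u)
  (h4 : block_sum stop next (fun b => visits b ^+ 2) K1.+1 u < lam)
  (h5 : K0%:R * mu / 2 < block_sum stop next visits K0 u).

(** Up to the last renewal the sum is a position of the walk, controlled by [h3];
    the unfinished excursion contributes at most its number of visits, which
    [h4] controls for all excursions at once. *)
Lemma deviation_time_sum i : (i <= m)%N -> time_sum (deviation i) t u ^+ 2 <= 4 * lam.
Proof.
clear h1 h5; move=> im; have [k /andP[kt tk]] := excursion_index t u.
have kK1 : (k < K1)%N.
  by rewrite ltnNge; apply/negP => /(renewal_time_homo u); lia.
rewrite (time_sum_excursions _ kt).
set a := block_sum _ _ _ _ _; set b := time_sum _ _ _.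
have a2 : a ^+ 2 <= lam.
  have -> : a = walk stop next g (fun=> 0) k u i.
    by rewrite /walk add0r /a; apply: eq_bigr => x _; exact: deviation_sum.
  apply: le_trans (le_supnorm2 _ im) _; rewrite leNgt; apply/negP => /ltW h.
  by move/negP: h3; apply; exact: (crossesP (ltnW kK1) h).
have b2 : b ^+ 2 <= lam.
  have bv : `|b| <= visits (iter k next u).
    apply: time_sum_le_excursion; first exact: deviation_le.
    by move: tk; rewrite renewal_timeSr; lia.
  apply: (@le_trans _ _ (visits (iter k next u) ^+ 2)).
    by rewrite -(real_normK (num_real b)) ler_sqr ?nnegrE// (le_trans _ bv).
  apply: le_trans (ltW h4).
  have := @block_sum_ge_term _ _ _ _ _ stop next (fun b => visits b ^+ 2) k K1.+1 u.
  rewrite excursion_sum_stopped; apply; last by rewrite ltnS ltnW.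
  by move=> x; exact: sqr_ge0.
by have := sqr_ge0 (a - b); nra.
Qed.

Lemma visits_time_sum : K0%:R * mu / 2 < time_sum \1_C t u.
Proof.
apply: (lt_le_trans h5); rewrite -(subnKC h1) time_sumD.
by rewrite time_sum_renewal lerDl time_sum_ge0.
Qed.

End grid.
End excursion_empirical.

(** * How many excursions and visits a time interval contains *)

Lemma le_div_of_mul (R : realType) (a b : R) (x : \bar R) : 0 < a ->
  (a%:E * x <= b%:E)%E -> (x <= (b / a)%:E)%E.
Proof. by move=> a0 h; rewrite EFinM muleC lee_pdivlMl. Qed.

Lemma nat_variable_tail (R : realType) d (T : measurableType d) (Q : probability T R)
    (N : T -> nat) (e : R) : (forall n, measurable [set t | N t = n]) -> 0 < e ->
  exists L : nat, (Q [set t | (L < N t)%N] <= e%:E)%E.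
Proof.
move=> mN e0; have mS L : measurable [set t | (L < N t)%N].
  have := measurable_fun_nat mN measurableT (Y := [set k | (L < k)%N]).
  by rewrite setTI; apply.
have cv : (Q \o (fun L => [set t | (L < N t)%N])) @ \oo --> Q (\bigcap_L [set t | (L < N t)%N]).
  apply: nonincreasing_cvg_mu => //.
  - by rewrite (le_lt_trans (probability_le1 _ (mS 0%N)))// ltry.
  - exact: bigcap_measurableType.
  - by move=> i j ij; apply/subsetPset => t /= ; exact: leq_ltn_trans.
rewrite (_ : \bigcap_L _ = set0) in cv; last first.
  by apply/seteqP; split => // t /(_ (N t) I) /=; rewrite ltnn.
rewrite measure0 in cv.
apply: contrapT => /forallNP h; have : (e%:E <= 0)%E.
  rewrite -(cvg_lim _ cv)//; apply: lime_ge; first by apply/cvg_ex; exists 0%E.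
  by apply: nearW => L; rewrite ltW// ltNge; apply/negP; exact: h.
by rewrite lee_fin leNgt e0.
Qed.

Section excursion_bounds.
Context (R : realType) (d : measure_display) (S : measurableType d).
Variable Q : probability (paths S) R.
Local Notation next := (@next_excursion _ S).
Local Notation stop := (@stopped _ S).
Hypothesis reg : regenerative Q stop next.
Variables (C : set S) (mC : measurable C).
Local Notation visits := (excursion_sum (\1_C : S -> R)).
Variables (mu M2 : R).
Hypotheses (mu0 : 0 < mu) (visitsE : (\int[Q]_u (visits u)%:E = mu%:E)%E)
  (visits2E : (\int[Q]_u (visits u ^+ 2)%:E = M2%:E)%E).
Local Notation trunc n := (@truncated_duration R _ S n).

Let mvisits : measurable_fun setT visits.
Proof. by apply: measurable_excursion_sum; exact: measurable_indic. Qed.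

Lemma measurable_truncated_duration n : measurable_fun setT (trunc n).
Proof.
exact: (measurable_select (@measurable_hit _ S) (f := fun k _ => (minn k.+1 n)%:R : R)
  (fun k => measurable_cst _)).
Qed.

Let trunc0 n u : 0 <= trunc n u. Proof. by rewrite ler0n. Qed.

Let trunc_le n u : trunc n u <= n%:R. Proof. by rewrite ler_nat geq_minr. Qed.

Definition mean_duration n : R := fine (\int[Q]_u (trunc n u)%:E)%E.

Lemma mean_durationE n : (\int[Q]_u (trunc n u)%:E = (mean_duration n)%:E)%E.
Proof.
rewrite /mean_duration fineK// ge0_fin_numE; last first.
  by apply: integral_ge0 => u _; rewrite lee_fin.
apply: (@le_lt_trans _ _ (\int[Q]_u n%:R%:E)%E); last by rewrite integral_cst1 ltry.
by apply: le_integral_EFin => //; exact: measurable_truncated_duration.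
Qed.

Lemma mean_duration_ge1 n : (0 < n)%N -> 1 <= mean_duration n.
Proof.
move=> n0; rewrite -lee_fin -mean_durationE -[leLHS](integral_cst1 Q).
apply: le_integral_EFin => //; first exact: measurable_truncated_duration.
by move=> u; rewrite ler1n leq_min n0.
Qed.

(** Durations are finite, so truncation at [n] makes their mean negligible with
    respect to [n], even when the duration has infinite mean. *)
Lemma mean_duration_small (L : R) : 0 < L ->
  exists n0, forall n, (n0 <= n)%N -> L * mean_duration n <= n%:R.
Proof.
move=> L0; have L20 : 0 < (2 * L)^-1 by rewrite invr_gt0 mulr_gt0.
have mdur n : measurable [set u : paths S | duration u = n].
  case: n => [|n]; first by rewrite (_ : [set _ | _] = set0)//; apply/seteqP; split.
  rewrite (_ : [set _ | _] = [set u : paths S | hit u = n]); first exact: measurable_hit.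
  by apply/seteqP; split => u /=; [move=> []|rewrite /duration => ->].
have [l hl] := nat_variable_tail Q mdur L20.
pose D : set (paths S) := [set u | (l < duration u)%N].
have mD : measurable D.
  have := measurable_fun_nat mdur measurableT (Y := [set k | (l < k)%N]).
  by rewrite setTI; apply.
have [n0 hn0] : exists n0 : nat, 2 * L * l%:R <= n0%:R.
  exists (Num.trunc (2 * L * l%:R)).+1; apply: ltW; exact: truncnS_gt.
exists n0 => n nn0; have Ln : 2 * L * l%:R <= n%:R by rewrite (le_trans hn0)// ler_nat.
have : ((mean_duration n)%:E <= (l%:R + n%:R * (2 * L)^-1)%:E)%E.
  rewrite -mean_durationE.
  apply: (@le_trans _ _ (\int[Q]_u (l%:R + n%:R * \1_D u)%:E)%E).
    apply: le_integral_EFin => //; first exact: measurable_truncated_duration.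
      by apply: measurable_funD => //; apply: measurable_funM => //; exact: measurable_indic.
    move=> u; rewrite indicE; case: (boolP (u \in D)) => uD.
      by rewrite mulr1 (le_trans (trunc_le n u))// lerDr.
    rewrite mulr0 addr0 ler_nat geq_min; apply/orP; left.
    by rewrite leqNgt; apply/negP => h; move/negP: uD; rewrite inE; apply.
  rewrite ge0_integral_EFinD//.
  rewrite ge0_integral_EFinZ//.
  rewrite integral_cst1 integral_indic// setIT EFinD leeD2l// EFinM lee_wpmul2l//.
  by apply: measurable_funM => //; exact: measurable_indic.
rewrite lee_fin => h.
apply: (@le_trans _ _ (L * (l%:R + n%:R * (2 * L)^-1))); first by rewrite ler_pM2l.
rewrite mulrDr (_ : L * (n%:R * _) = n%:R / 2); first lra.
by field; rewrite gt_eqF.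
Qed.

Lemma late_renewal k n r : 0 < r ->
  (Q [set u | (r <= block_sum stop next (trunc n) k u)%R] <= (k%:R * mean_duration n / r)%:E)%E.
Proof.
move=> r0; apply: le_div_of_mul => //.
apply: le_trans (markov_block_sum reg k (measurable_truncated_duration n) (trunc0 n) (ltW r0)) _.
by under eq_integral do rewrite truncated_duration_stopped; rewrite mean_durationE EFinM.
Qed.

(** Chebyshev's inequality suffices although durations may have no moment:
    truncated durations have second moment at most [n] times their mean. *)
Lemma early_renewal k n : (0 < n)%N -> 2 * n%:R <= k%:R * mean_duration n ->
  (Q [set u | (block_sum stop next (trunc n) k u <= n%:R)%R] <=
   (4 * n%:R / (k%:R * mean_duration n))%:E)%E.
Proof.
move=> n0 nk; have md0 : 0 < mean_duration n by rewrite (lt_le_trans _ (mean_duration_ge1 n0)).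
have mt := measurable_truncated_duration n.
have kmd : 0 < k%:R * mean_duration n.
  by rewrite (lt_le_trans _ nk)// mulr_gt0// ltr0n.
have sq : (\int[Q]_u (trunc n u ^+ 2)%:E <= (n%:R * mean_duration n)%:E)%E.
  rewrite EFinM -mean_durationE -ge0_integral_EFinZ//.
  apply: le_integral_EFin => //.
  - exact: measurable_funX.
  - exact: measurable_funM.
  - by move=> u; exact: sqr_ge0.
  - by move=> u; rewrite expr2 ler_wpM2r.
have e1 : (\int[Q]_u (trunc n (stop u))%:E = (mean_duration n)%:E)%E.
  by under eq_integral do rewrite truncated_duration_stopped; exact: mean_durationE.
have e2 : (\int[Q]_u (trunc n (stop u) ^+ 2)%:E = \int[Q]_u (trunc n u ^+ 2)%:E)%E.
  by under eq_integral do rewrite truncated_duration_stopped.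
have := block_sum_lower_tail reg k mt _ e1 (ltW md0); rewrite e2.
move=> /(_ (le_lt_trans sq (ltry _))) h.
have mset x : measurable [set u | block_sum stop next (trunc n) k u <= x].
  by apply: measurable_le_fun => //; exact: (measurable_block_sum reg).
apply: (@le_trans _ _ (Q [set u | (block_sum stop next (trunc n) k u <= k%:R * mean_duration n / 2)%R])).
  by apply: le_measure; rewrite ?inE// => u /= /le_trans; apply; lra.
have -> : 4 * n%:R / (k%:R * mean_duration n) =
   (k%:R * (n%:R * mean_duration n)) / (k%:R * mean_duration n / 2) ^+ 2.
  by field; rewrite !gt_eqF// ltr0n lt0n; apply/eqP => k0; move: kmd; rewrite k0 mul0r ltxx.
apply: le_div_of_mul; first by rewrite exprn_gt0// divr_gt0.
by apply: (le_trans h); rewrite EFinM lee_wpmul2l// lee_fin.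
Qed.

Lemma few_visits k : (0 < k)%N ->
  (Q [set u | (block_sum stop next visits k u <= k%:R * mu / 2)%R] <=
   (4 * M2 / (k%:R * mu ^+ 2))%:E)%E.
Proof.
have e1 : (\int[Q]_u (visits (stop u))%:E = mu%:E)%E.
  by under eq_integral do rewrite excursion_sum_stopped.
have e2 : (\int[Q]_u (visits (stop u) ^+ 2)%:E = M2%:E)%E.
  by under eq_integral do rewrite excursion_sum_stopped.
move=> k0; have := block_sum_lower_tail reg k mvisits _ e1 (ltW mu0); rewrite e2.
move=> /(_ (ltry _)) h.
have kr0 : 0 < k%:R :> R by rewrite ltr0n.
have -> : 4 * M2 / (k%:R * mu ^+ 2) = (k%:R * M2) / (k%:R * mu / 2) ^+ 2.
  by field; rewrite !gt_eqF.
apply: le_div_of_mul; first by rewrite exprn_gt0// divr_gt0// mulr_gt0.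
by apply: (le_trans h); rewrite EFinM.
Qed.

Lemma large_visits k lam : 0 < lam ->
  (Q [set u | (lam <= block_sum stop next (fun b => visits b ^+ 2) k u)%R] <= (k%:R * M2 / lam)%:E)%E.
Proof.
move=> l0; apply: le_div_of_mul => //.
have mv2 : measurable_fun setT (fun b => visits b ^+ 2) by exact: measurable_funX.
apply: le_trans (markov_block_sum reg k mv2 (fun b => sqr_ge0 _) (ltW l0)) _.
by under eq_integral do rewrite excursion_sum_stopped; rewrite visits2E EFinM.
Qed.

End excursion_bounds.

(** * A high-probability event for the excursions *)

Lemma le_of_divr (R : realFieldType) (a b e : R) : 0 < b -> a <= e * b -> a / b <= e.
Proof. by move=> b0; rewrite ler_pdivrMr. Qed.

Lemma half_le_natrB (R : realFieldType) (a n : nat) : (2 * a <= n)%N ->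
  n%:R / 2 <= (n - a)%:R :> R.
Proof.
move=> an; have an' : (a <= n)%N by lia.
rewrite natrB//; have : 2 * a%:R <= n%:R :> R by rewrite -natrM ler_nat.
lra.
Qed.

Lemma probability_union5 (R : realType) d (T : measurableType d) (Q : probability T R)
    (B1 B2 B3 B4 B5 : set T) (e : R) :
  [/\ measurable B1, measurable B2, measurable B3, measurable B4 & measurable B5] ->
  [/\ (Q B1 <= e%:E)%E, (Q B2 <= e%:E)%E, (Q B3 <= e%:E)%E, (Q B4 <= e%:E)%E
    & (Q B5 <= e%:E)%E] ->
  (Q (B1 `|` B2 `|` B3 `|` B4 `|` B5) <= (5 * e)%:E)%E.
Proof.
move=> [m1 m2 m3 m4 m5] [h1 h2 h3 h4 h5].
have U (A B : set T) (a b : R) : measurable A -> measurable B -> (Q A <= a%:E)%E ->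
    (Q B <= b%:E)%E -> (Q (A `|` B) <= (a + b)%:E)%E.
  by move=> mA mB hA hB; rewrite (le_trans (measureU2 _ _ _))// EFinD leeD.
have -> : 5 * e = e + e + e + e + e by ring.
have m12 := measurableU _ _ m1 m2; have m123 := measurableU _ _ m12 m3.
have m1234 := measurableU _ _ m123 m4.
have h12 := U _ _ _ _ m1 m2 h1 h2; have h123 := U _ _ _ _ m12 m3 h12 h3.
exact: U _ _ _ _ m1234 m5 (U _ _ _ _ m123 m4 h123 h4) h5.
Qed.

Section good_excursions.
Context (R : realType) (d : measure_display) (S : measurableType d).
Variable Q : probability (paths S) R.
Local Notation next := (@next_excursion _ S).
Local Notation stop := (@stopped _ S).
Hypothesis reg : regenerative Q stop next.
Variables (C : set S) (mC : measurable C).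
Local Notation visits := (excursion_sum (\1_C : S -> R)).
Variables (mu M2 : R).
Hypotheses (mu0 : 0 < mu) (visitsE : (\int[Q]_u (visits u)%:E = mu%:E)%E)
  (visits2E : (\int[Q]_u (visits u ^+ 2)%:E = M2%:E)%E).

(** Increasing measurable sets that exhaust [C], with the shares [p] that center
    the counts. *)
Definition grid m (A : nat -> set S) (p : nat -> R) : Prop :=
  [/\ forall i, measurable (A i), A 0%N = set0,
      forall i j, (i <= j)%N -> A i `<=` A j & A m = C] /\
  [/\ forall i, A i `<=` C, forall i, 0 <= p i <= 1 &
      forall i, (\int[Q]_u (excursion_sum (\1_(A i)) u - p i * visits u)%:E = 0)%E].

(** The constant is kept abstract for its users, who only need that it does not
    depend on the grid or on the number of excursions; the lower bound [2] lets
    the same constant serve for [large_visits]. *)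
Lemma large_deviation_excursions : exists2 c : R, 2 <= c &
  forall m A p k lam, grid m A p -> 0 < lam ->
  (Q [set u | crosses stop next m (centered m (excursion_count R A) p) lam k (fun=> 0%R) u] <=
    (c * k%:R * M2 / lam)%:E)%E /\
  measurable [set u | crosses stop next m (centered m (excursion_count R A) p) lam k (fun=> 0%R) u].
Proof.
exists 1600; first by rewrite (ler_nat R 2 1600).
move=> m A p k lam [[mA A0 AA Am] [AC p01 Ap]] lam0.
pose G := excursion_count R A.
have mG i : measurable_fun setT (G^~ i).
  by apply: measurable_excursion_sum; exact: measurable_indic.
have G0 b : G b 0%N = 0 by exact: excursion_count0.
have Gh b i j : (i <= j)%N -> G b i <= G b j by move=> ij; exact: excursion_count_homo.
have Gm b i : G b i <= G b m by exact: excursion_count_max Am AC b i.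
have Gv b : G b m = visits b by exact: excursion_count_top Am b.
have p1 i : `|p i| <= 1 by have /andP[p0 p1] := p01 i; rewrite ger0_norm.
have GS (u : paths S) i : G (stop u) i = G u i by exact: excursion_sum_stopped.
have G2 : (\int[Q]_u (G (stop u) m ^+ 2)%:E = M2%:E)%E.
  by under eq_integral do rewrite GS Gv.
have G2y : (\int[Q]_u (G (stop u) m ^+ 2)%:E < +oo)%E by rewrite G2 ltry.
have Gp i : (\int[Q]_u (G (stop u) i - p i * G (stop u) m)%:E = 0)%E.
  by rewrite -[RHS](Ap i); apply: eq_integral => u _; rewrite !GS Gv.
have mg i := measurable_centered m p mG i.
have g2 := centered_sqr_lty reg mG G0 Gh Gm p1 G2y.
split; last exact: (measurable_crosses_set reg).
apply: le_div_of_mul => //.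
apply: le_trans (walk_maximal_inequality reg m mg g2 Gp k (fun=> 0) (ltW lam0)) _.
apply: le_trans (centered_sum_second_moment reg mG G0 Gh Gm p1 G2y Gp k) _.
by rewrite G2 -EFinM.
Qed.

(** With [b = n / md], the number of excursions up to time [n] lies between
    [K0], about [eps * b], and [K1], about [kap * b], so it is known up to a
    constant factor.  The sets [B1] and [B2] are the failures of these bounds,
    [B3] and [B4] those of the bounds on the deviations over [K1] excursions,
    [B5] a lack of visits in [K0] excursions.  The squared deviations are of
    order [K1] and the visits of order [K0].  The slack [Md] leaves room for
    the time before the first regeneration. *)
Lemma good_excursions (e : R) (Md : nat) : 0 < e -> (0 < Md)%N ->
  exists Kc : R, exists n0 : nat, forall n, (n0 <= n)%N -> forall m A p, grid m A p ->
  exists Bad : set (paths S), [/\ measurable Bad, (Q Bad <= (5 * e)%:E)%E &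
    forall u, ~ Bad u -> forall t, (n - Md <= t <= n)%N -> 0 < time_sum (\1_C : S -> R) t u /\
      forall i, (i <= m)%N ->
        2 * (Md.+1%:R) ^+ 2 + 2 * time_sum (deviation C A p i) t u ^+ 2 <=
        Kc * time_sum (\1_C : S -> R) t u].
Proof.
move=> e0 Md0.
have M20 : 0 <= M2.
  by rewrite -lee_fin -visits2E; apply: integral_ge0 => u _; rewrite lee_fin sqr_ge0.
have [c c2 large_deviation] := large_deviation_excursions.
have c0 : 0 <= c by exact: le_trans c2.
pose eps := e / 2; pose kap := 2 + 4 / e; pose Lam := c * M2 / e + 1.
pose kstar := 4 * M2 / (e * mu ^+ 2) + 1.
have eps0 : 0 < eps by rewrite divr_gt0.
have kap2 : 2 <= kap by rewrite lerDl divr_ge0// ltW.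
have Lam0 : 0 < Lam by rewrite ltr_wpDl// divr_ge0 ?(ltW e0)// mulr_ge0.
have kstar1 : 1 <= kstar by rewrite lerDr divr_ge0// mulr_ge0 ?sqr_ge0// ltW.
pose Kn := 2 * (Md.+1%:R) ^+ 2 + 8 * Lam * (2 * kap / eps + 1).
exists (2 / mu * Kn).
have L0 : 0 < (kstar + 1) / eps by rewrite divr_gt0// addr_gt0// (lt_le_trans _ kstar1).
have [n2 hn2] := mean_duration_small Q L0.
exists (maxn n2 (2 * Md)%N) => n; rewrite geq_max => /andP[/hn2 nmd nMd] m A p gr.
have n_gt0 : (0 < n)%N by apply: leq_trans nMd; rewrite muln_gt0.
pose md := mean_duration Q n.
have md1 : 1 <= md by exact: mean_duration_ge1.
have md0 : 0 < md by exact: lt_le_trans md1.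
pose b := n%:R / md.
have bmd : b * md = n%:R by rewrite /b divfK// gt_eqF.
have b0 : 0 <= b by rewrite divr_ge0// ltW.
have epsb : kstar + 1 <= eps * b.
  by rewrite -(ler_pM2r md0) -mulrA bmd -ler_pdivrMl// mulrA (mulrC _^-1).
pose K0 := Num.trunc (eps * b); pose K1 := (Num.trunc (kap * b)).+1.
have eb0 : 0 <= eps * b by rewrite mulr_ge0// ltW.
have kb0 : 0 <= kap * b by rewrite mulr_ge0// (le_trans _ kap2).
have /andP[K0le K0lt] := truncn_itv eb0.
have /andP[K1le K1lt] := truncn_itv kb0.
rewrite -/K0 in K0le K0lt; rewrite -/K1 in K1lt.
have K0S : K0.+1%:R = K0%:R + 1 :> R by rewrite -natr1.
have K1S : K1%:R = (Num.trunc (kap * b))%:R + 1 :> R by rewrite -natr1.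
have K0k : kstar <= K0%:R by lra.
have K0r : 1 <= K0%:R :> R by lra.
have K0_gt0 : (0 < K0)%N by rewrite -(ltr_nat R) (lt_le_trans _ K0r).
have K1r : 0 < K1%:R :> R by rewrite ltr0n.
have mdn : mean_duration Q n = md by [].
have K0md : K0%:R * md <= eps * n%:R by rewrite -bmd mulrA ler_pM2r.
have K1md : kap * n%:R <= K1%:R * md by rewrite -bmd mulrA ler_pM2r// ltW.
pose lam := Lam * K1%:R.
have lam0 : 0 < lam by rewrite mulr_gt0.
have nMdr : n%:R / 2 <= (n - Md)%:R :> R.
  by exact: half_le_natrB.
have nr0 : 0 < n%:R :> R by rewrite ltr0n.
have nMd0 : 0 < (n - Md)%:R :> R by apply: lt_le_trans nMdr; rewrite divr_gt0.
have [q3 m3] := large_deviation _ _ _ K1 _ gr lam0.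
have md_trunc := @measurable_truncated_duration R _ S n.
have mbt k := measurable_block_sum reg k md_trunc.
have mv : measurable_fun setT visits.
  by apply: measurable_excursion_sum; exact: measurable_indic.
have mbv k := measurable_block_sum reg k mv.
have mv2 : measurable_fun setT (fun u => visits u ^+ 2) by exact: measurable_funX.
have mbv2 k := measurable_block_sum reg k mv2.
pose B1 := [set u : paths S | (n - Md)%:R <= block_sum stop next (truncated_duration R n) K0 u].
pose B2 := [set u : paths S | block_sum stop next (truncated_duration R n) K1 u <= n%:R].
pose B3 := [set u : paths S |
  crosses stop next m (centered m (excursion_count R A) p) lam K1 (fun=> 0%R) u].
pose B4 := [set u : paths S | lam <= block_sum stop next (fun b => visits b ^+ 2) K1.+1 u].
pose B5 := [set u : paths S | block_sum stop next visits K0 u <= K0%:R * mu / 2].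
have mB : [/\ measurable B1, measurable B2, measurable B3, measurable B4 & measurable B5].
  by split => //; exact: measurable_le_fun.
have qB : [/\ (Q B1 <= e%:E)%E, (Q B2 <= e%:E)%E, (Q B3 <= e%:E)%E, (Q B4 <= e%:E)%E
    & (Q B5 <= e%:E)%E].
  split.
  - apply: (le_trans (late_renewal reg K0 n nMd0)); rewrite lee_fin mdn.
    apply: le_of_divr => //; apply: (le_trans K0md).
    have -> : eps * n%:R = e * (n%:R / 2) by rewrite /eps; ring.
    by rewrite ler_pM2l.
  - have h2 : 2 * n%:R <= K1%:R * md.
      by apply: le_trans K1md; rewrite ler_pM2r.
    apply: (le_trans (early_renewal reg n_gt0 h2)); rewrite lee_fin mdn.
    apply: le_of_divr; first exact: mulr_gt0.
    apply: (@le_trans _ _ (e * (kap * n%:R))); last by rewrite ler_pM2l.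
    rewrite mulrA ler_pM2r// /kap mulrDr (mulrC _ (4 / e)) divfK ?gt_eqF//.
    by rewrite lerDr mulr_ge0// ltW.
  - apply: (le_trans q3); rewrite lee_fin; apply: le_of_divr => //.
    rewrite /lam mulrA mulrAC ler_pM2r// /Lam mulrDr (mulrC _ (c * M2 / e)) divfK ?gt_eqF//.
    by rewrite mulr1 lerDl ltW.
  - apply: (le_trans (large_visits reg mC visits2E K1.+1 lam0)); rewrite lee_fin.
    apply: le_of_divr => //; apply: (@le_trans _ _ (2 * M2 * K1%:R)).
      rewrite mulrC (mulrC 2 M2) -mulrA ler_wpM2l// -natr1.
      have : 1 <= K1%:R :> R by rewrite ler1n.
      lra.
    rewrite /lam mulrA ler_pM2r// /Lam mulrDr (mulrC _ (c * M2 / e)) divfK ?gt_eqF//.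
    rewrite mulr1 -[leLHS]addr0 lerD ?(ltW e0)// ler_wpM2r//.
  - have fv := few_visits reg mC mu0 visitsE visits2E K0_gt0.
    apply: (@le_trans _ _ _ _ _ fv); rewrite lee_fin.
    apply: le_of_divr; first by rewrite mulr_gt0 ?exprn_gt0// ltr0n.
    have -> : e * (K0%:R * mu ^+ 2) = K0%:R * (e * mu ^+ 2) by ring.
    rewrite -ler_pdivrMr; last by rewrite mulr_gt0// exprn_gt0.
    by apply: le_trans K0k; rewrite lerDl.
exists (B1 `|` B2 `|` B3 `|` B4 `|` B5); split.
- by move: mB => [? ? ? ? ?]; repeat apply: measurableU.
- exact: probability_union5.
move=> u /not_orP[/not_orP[/not_orP[/not_orP[b1 b2] b3] b4] b5] t /andP[t1 t2].
move/negP: b1; rewrite -ltNge => b1; move/negP: b2; rewrite -ltNge => b2.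
move/negP: b3 => b3; move/negP: b4; rewrite -ltNge => b4; move/negP: b5; rewrite -ltNge => b5.
have r0 : (renewal_time K0 u <= t)%N.
  have mn : (n - Md < n)%N by rewrite ltn_subrL Md0 n_gt0.
  exact: leq_trans (truncated_renewal_le mn (ltW b1)) t1.
have r1 : (t < renewal_time K1 u)%N by apply: leq_ltn_trans t2 (lt_truncated_renewal b2).
have vt : K0%:R * mu / 2 < time_sum \1_C t u by exact: visits_time_sum b5.
have vt0 : 0 < time_sum (\1_C : S -> R) t u.
  by apply: le_lt_trans vt; rewrite divr_ge0// mulr_ge0// ltW.
split=> // i im; move: gr => [[mA A0 AA Am] [AC p01 Ap]].
have dv := deviation_time_sum Am AC p01 r1 b3 b4 im.
have bK0 : eps * b <= 2 * K0%:R by lra.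
have kbK0 : kap * b <= 2 * kap / eps * K0%:R.
  have -> : kap * b = kap / eps * (eps * b) by field; rewrite gt_eqF.
  have -> : 2 * kap / eps * K0%:R = kap / eps * (2 * K0%:R) by ring.
  by rewrite ler_wpM2l// divr_ge0 ?(ltW eps0)// (le_trans _ kap2).
have K1K0 : K1%:R <= (2 * kap / eps + 1) * K0%:R by rewrite mulrDl mul1r; lra.
apply: (@le_trans _ _ (Kn * K0%:R)); last first.
  have -> : Kn * K0%:R = 2 / mu * Kn * (K0%:R * mu / 2) by field; rewrite gt_eqF.
  rewrite ler_wpM2l ?(ltW vt)// mulr_ge0// ?divr_ge0 ?(ltW mu0)//.
  rewrite addr_ge0 ?mulr_ge0 ?sqr_ge0 ?(ltW Lam0)// addr_ge0// divr_ge0 ?(ltW eps0)//.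
  by rewrite mulr_ge0// (le_trans _ kap2).
have -> : Kn * K0%:R = 2 * Md.+1%:R ^+ 2 * K0%:R + 8 * Lam * ((2 * kap / eps + 1) * K0%:R).
  by rewrite /Kn; ring.
apply: lerD.
  by rewrite ler_peMr// mulr_ge0// sqr_ge0.
apply: (@le_trans _ _ (8 * lam)).
  by rewrite (_ : 8 * lam = 2 * (4 * lam)) ?ler_pM2l//; ring.
by rewrite /lam mulrA; apply: ler_wpM2l K1K0; exact: mulr_ge0 (ltW Lam0).
Qed.

End good_excursions.

(** * The first block of the chain *)

Section first_blocks.
Context (R : realType) (d d' : measure_display) (S : measurableType d)
  (Omega : measurableType d').
Variables (X : nat -> {mfun Omega >-> S}) (xi : nat -> {mfun Omega >-> bool}).
Local Notation future := (future X xi).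
Local Notation excursion := (excursion X xi).

Lemma first_hit_sum (u : nat -> S * bool) n :
  first_hit u n <-> (u n).2 /\ (\sum_(j < n) (u j).2 = 0)%N.
Proof.
split=> [/first_hitP[un h]|[un h]].
  by split => //; apply: big1 => j _; rewrite (negbTE (h j (ltn_ord j))).
apply/first_hitP; split => // j jn; move/eqP: h; rewrite sum_nat_eq0.
by move=> /forallP/(_ (Ordinal jn))/=; rewrite eqb0.
Qed.

Lemma hits_recr (u : nat -> S * bool) n :
  (\sum_(j < n.+1) (u j).2 = \sum_(j < n) (u j).2 + (u n).2)%N.
Proof. by rewrite big_ord_recr. Qed.

Lemma regeneration_timeE w k n : regeneration_time xi w k n.+1 <->
  (future 0 w n).2 /\ (\sum_(j < n.+1) (future 0 w j).2)%N = k.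
Proof.
rewrite /regeneration_time big_add1/= big_mkord.
by split => [[_ h1 h2]|[h1 h2]]; split.
Qed.

Lemma regeneration_time_first w n : regeneration_time xi w 1 n <->
  exists2 i, first_hit (future 0 w) i & n = i.+1.
Proof.
case: n => [|n]; first by split => [[]|[]].
rewrite regeneration_timeE hits_recr; split.
  move=> [h1 h2]; exists n => //; apply/first_hit_sum; split => //.
  by move: h2; rewrite h1 addn1 => -[].
move=> [i /first_hit_sum[h1 h2] [->]]; split; first exact: h1.
by rewrite h1 h2.
Qed.

Lemma excursionE w k : excursion w k = future 0 w ((hit (future 0 w)).+1 + k)%N.
Proof. by []. Qed.

(** After the first regeneration at the time [i + 1], the second one is the first
    one of the shifted path. *)
Lemma regeneration_time_second w i n : first_hit (future 0 w) i ->
  regeneration_time xi w 2 n <->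
  exists2 j, first_hit (excursion w) j & n = (i.+1 + j).+1.
Proof.
move=> hi; have /first_hit_sum[h1 h2] := hi.
have N1 : (\sum_(k < i.+1) (future 0 w k).2 = 1)%N.
  by apply: ((regeneration_timeE w 1 i).1 _).2; apply/regeneration_time_first; exists i.
have sumS j : (\sum_(k < i.+1 + j) (future 0 w k).2 = 1 + \sum_(k < j) (excursion w k).2)%N.
  rewrite big_split_ord; congr (_ + _)%N; first exact: N1.
  by apply: eq_bigr => k _; rewrite excursionE (hitE hi).
case: n => [|n]; first by split => [[]|[]].
rewrite regeneration_timeE; split.
  move=> [un]; rewrite hits_recr un addn1 => -[] Nn.
  have [ni|ni|ni] := ltngtP n i.
  - by have /first_hitP[_ /(_ _ ni)] := hi; rewrite un.
  - exists (n - i.+1)%N; last by rewrite subnKC.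
    apply/first_hit_sum; rewrite excursionE (hitE hi) subnKC//; split => //.
    by move: Nn; rewrite -[in LHS](subnKC ni) sumS => -[].
  - by move: Nn; rewrite ni h2.
move=> [j /first_hit_sum[]]; rewrite excursionE (hitE hi) => h3 h4 [->].
by split => //; rewrite hits_recr sumS h4 h3.
Qed.

Definition two_regenerations : set Omega :=
  [set w | (exists i, first_hit (future 0 w) i) /\ exists j, first_hit (excursion w) j].

Lemma two_regenerationsP w : (exists b, regeneration_time xi w 2 b) <-> two_regenerations w.
Proof.
split=> [[b hb]|[[i hi] [j hj]]]; last first.
  by exists (i.+1 + j).+1; apply/(regeneration_time_second _ hi); exists j.
have [i hi] : exists i, first_hit (future 0 w) i.
  by case: b hb => [[]//|b /regeneration_timeE[/first_hit_ex]].
by split; [exists i|have /(regeneration_time_second _ hi)[j hj _] := hb; exists j].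
Qed.

Lemma blockE w i j : first_hit (future 0 w) i -> first_hit (excursion w) j ->
  block xi w 1 = [set t | (i.+1 < t <= (i.+1 + j).+1)%N].
Proof.
move=> hi hj; apply/seteqP; split => t /=.
  move=> [a [b [/regeneration_time_first[i' hi' ->]]]].
  move=> /(regeneration_time_second _ hi)[j' hj' ->].
  by rewrite (first_hit_inj hi' hi) (first_hit_inj hj' hj).
move=> h; exists i.+1, (i.+1 + j).+1; split => //.
  by apply/regeneration_time_first; exists i.
by apply/(regeneration_time_second _ hi); exists j.
Qed.

Local Notation visits C := (excursion_sum (\1_C : S -> R)).

(** The first block is the first excursion, whenever two regenerations occur. *)
Lemma block_visitsE (C : set S) w : block_visits X xi C 1 w =
  if `[< two_regenerations w >] then (visits C (excursion w))%:E else +oo%E.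
Proof.
rewrite /block_visits (propext (two_regenerationsP w)).
case: asboolP => // -[[i hi] [j hj]]; rewrite (blockE hi hj).
have bij : set_bij `I_j.+1 [set t | (i.+1 < t <= (i.+1 + j).+1)%N] (fun k => i.+2 + k)%N.
  split.
  - by move=> k /=; lia.
  - by move=> k l _ _; lia.
  - by move=> t /= ht; exists (t - i.+2)%N; [rewrite /=; lia|rewrite subnKC; lia].
rewrite esum_fset; last by move=> t _; rewrite lee_fin.
  rewrite (reindex_fsbig _ _ _ _ bij) -fsbig_ord.
  rewrite /excursion_sum /duration (hitE hj) -sumEFin; apply: eq_bigr => k _.
  by rewrite excursionE (hitE hi).
have -> : [set t | (i.+1 < t <= (i.+1 + j).+1)%N] = (fun k => i.+2 + k)%N @` `I_j.+1.
  by have [_ _ h] := bij; apply/seteqP; split => // _ [k kj <-]; have [h' _ _] := bij; exact: h'.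
exact: finite_image.
Qed.

End first_blocks.

(** * Moments of the visits of an excursion *)

Section deviation_bound.
Context (R : realType) (d d' : measure_display) (S : measurableType d)
  (Omega : measurableType d').
Variables (X : nat -> {mfun Omega >-> S}) (xi : nat -> {mfun Omega >-> bool}).
Variable Pr : probability Omega R.
Variables (P : R.-pker S ~> S) (s : S -> R) (nu : probability S R).
Hypotheses (hmin : minorized P s nu) (hsplit : split_chain X xi P s nu Pr).
Variables (C : set S) (mC : measurable C).
Hypothesis hblock : (\int[Pr]_w (@block_visits R _ _ _ _ X xi C 1 w) ^+ 2 < +oo)%E.
Local Notation visits := (excursion_sum (\1_C : S -> R)).
Local Notation future := (future X xi).
Local Notation excursion := (excursion X xi).
Local Notation two_regenerations := (two_regenerations X xi).
Local Notation Q := (excursion_law X xi Pr).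

Let measurable_hits d1 (T : measurableType d1) (f : T -> paths S) :
  measurable_fun setT f -> measurable [set w | exists i, first_hit (f w) i].
Proof.
move=> mf; rewrite (_ : [set _ | _] = \bigcup_i f @^-1` [set u : paths S | first_hit u i]).
  apply: bigcup_measurable => i _; rewrite -[X in measurable X]setTI.
  by apply: mf => //; exact: measurable_first_hit.
by apply/seteqP; split => [w [i wi]|w [i _ wi]]; exists i.
Qed.

Lemma measurable_two_regenerations : measurable two_regenerations.
Proof.
rewrite (_ : two_regenerations = [set w | exists i, first_hit (future 0 w) i] `&`
  [set w | exists j, first_hit (excursion w) j])//.
by apply: measurableI; apply: measurable_hits; [exact: measurable_future|exact: measurable_excursion].
Qed.

Let measurable_visits : measurable_fun setT visits.
Proof. by apply: measurable_excursion_sum; exact: measurable_indic. Qed.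

Lemma measurable_block_visits : measurable_fun setT (fun w => @block_visits R _ _ _ _ X xi C 1 w ^+ 2)%E.
Proof.
rewrite (_ : (fun w => _) = fun w => if `[< two_regenerations w >] then
    (visits (excursion w) ^+ 2)%:E else +oo%E); last first.
  apply/funext => w; rewrite block_visitsE.
  by case: ifP => _; rewrite ?EFin_expe//= expe2 mulyy.
apply: measurable_fun_ifT => //.
  apply: (measurable_fun_bool true); rewrite setTI.
  rewrite (_ : _ @^-1` _ = two_regenerations); first exact: measurable_two_regenerations.
  by apply/seteqP; split => w /= /asboolP.
apply/measurable_EFinP; apply: measurable_funX.
by apply: measurableT_comp => //; exact: measurable_excursion.
Qed.

Let block_visits2_ge0 w : (0 <= @block_visits R _ _ _ _ X xi C 1 w ^+ 2)%E.
Proof.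
by rewrite block_visitsE; case: ifP => _; [rewrite -EFin_expe lee_fin sqr_ge0|rewrite expe2 mulyy].
Qed.

(** The visits of the first block are infinite where the block does not exist, and
    their square is integrable. *)
Lemma two_regenerations_as : Pr two_regenerations = 1%E.
Proof.
have mR := measurable_two_regenerations; have mRC := measurableC mR.
suff h : Pr (~` two_regenerations) = 0%E.
  have := probability_setC Pr mRC; rewrite setCK h => ->.
  by rewrite sube0.
apply/eqP/negPn/negP => h; move: hblock; apply/negP; rewrite -leNgt.
have <- : (\int[Pr]_(w in ~` two_regenerations) (cst +oo w) = +oo)%E.
  by rewrite integral_cst// gt0_mulye// lt0e h/=.
rewrite (eq_integral (fun w => @block_visits R _ _ _ _ X xi C 1 w ^+ 2)%E); last first.
  by move=> w; rewrite inE => /= wR; rewrite block_visitsE asboolF// expe2 mulyy.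
by apply: ge0_subset_integral => //; exact: measurable_block_visits.
Qed.

Lemma excursion_visits_sqr_lty : (\int[Q]_u (visits u ^+ 2)%:E < +oo)%E.
Proof.
apply: le_lt_trans hblock.
rewrite ge0_integral_distribution//; last 2 first.
- by apply/measurable_EFinP; exact: measurable_funX.
- by move=> u; rewrite lee_fin sqr_ge0.
apply: ge0_le_integral => //.
- by move=> w _; rewrite lee_fin sqr_ge0.
- apply/measurable_EFinP; apply: measurable_funX.
  by apply: measurableT_comp => //; exact: measurable_excursion.
- exact: measurable_block_visits.
move=> w _; rewrite block_visitsE; case: ifP => _; first by rewrite /= EFin_expe.
by rewrite expe2 mulyy leey.
Qed.

Variables (psi : {measure set S -> \bar R}) (pi : {sigma_finite_measure set S -> \bar R}).
Hypotheses (hpsi : irreducibility_measure P psi) (hpi : invariant_measure P pi).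
Hypothesis piC : (0 < pi C)%E.

Let rec := two_regenerations_as.

(** The occupation measure of an excursion, computed under [Q], satisfies the
    recursion that characterizes the invariant measure. *)
Lemma invariant_excursion_visits : exists2 c : R, 0 < c &
  forall A, measurable A -> (pi A = c%:E * \int[Q]_u (excursion_sum \1_A u)%:E)%E.
Proof.
have [c c0 h] := @invariant_measure_occupation _ _ _ _ _ _ hmin _ _ hpi hpsi
  (killed_law X xi Pr) (killed_law0 hmin hsplit rec) (killed_lawS hmin hsplit rec)
  (killed_law_vanishes rec).
by exists c => // A mA; rewrite h// (integral_excursion_visits rec mA).
Qed.

Let integrable_visits : Q.-integrable setT (EFin \o visits).
Proof. by apply: square_integrable_integrable => //; exact: excursion_visits_sqr_lty. Qed.

Lemma excursion_visits_moments : exists mu M2 : R, [/\ 0 < mu,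
  (\int[Q]_u (visits u)%:E = mu%:E)%E & (\int[Q]_u (visits u ^+ 2)%:E = M2%:E)%E].
Proof.
exists (fine (\int[Q]_u (visits u)%:E)%E), (fine (\int[Q]_u (visits u ^+ 2)%:E)%E).
have f1 : (\int[Q]_u (visits u)%:E)%E \is a fin_num.
  exact: integrable_fin_num integrable_visits.
have f2 : (\int[Q]_u (visits u ^+ 2)%:E)%E \is a fin_num.
  rewrite ge0_fin_numE ?excursion_visits_sqr_lty//.
  by apply: integral_ge0 => u _; rewrite lee_fin sqr_ge0.
rewrite !fineK//; split => //; rewrite -lte_fin fineK// lt0e.
rewrite integral_ge0 ?andbT; last by move=> u _; rewrite lee_fin excursion_sum_ge0.
have [c c0 h] := invariant_excursion_visits.
by apply/eqP => h0; move: piC; rewrite h// h0 mule0 ltxx.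
Qed.

Lemma measure_small_fin : pi C \is a fin_num.
Proof.
have [c c0 h] := invariant_excursion_visits; rewrite h// fin_numM//.
exact: integrable_fin_num integrable_visits.
Qed.

Lemma excursion_mean_zero A : measurable A -> A `<=` C ->
  (\int[Q]_u (excursion_sum \1_A u - fine (pi A) / fine (pi C) * visits u)%:E = 0)%E.
Proof.
move=> mA AC; have [c c0 h] := invariant_excursion_visits.
have mv : measurable_fun setT (excursion_sum (\1_A : S -> R)).
  by apply: measurable_excursion_sum; exact: measurable_indic.
have iA : Q.-integrable setT (EFin \o excursion_sum (\1_A : S -> R)).
  apply: le_integrable integrable_visits => //; first exact/measurable_EFinP.
  move=> u _; rewrite lee_fin !ger0_norm ?excursion_sum_ge0//.
  by apply: le_excursion_sum => x; exact: indic_le.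
pose p := fine (pi A) / fine (pi C).
have iC : Q.-integrable setT (EFin \o (fun u => p * visits u)).
  exact: (integrableZl measurableT p integrable_visits).
under eq_integral do rewrite EFinB.
rewrite integralB//.
under [X in (_ - X)%E]eq_integral do rewrite EFinM.
rewrite integralZl//.
have fA := integrable_fin_num measurableT iA; have fC := integrable_fin_num measurableT integrable_visits.
have piC0 : fine (pi C) != 0.
  by rewrite gt_eqF// fine_gt0// piC ltey_eq measure_small_fin.
move: piC0; rewrite /p (h _ mA) (h _ mC) -(fineK fA) -(fineK fC) -!EFinM /=.
rewrite mulf_eq0 negb_or => /andP[c0' v0]; rewrite -EFinB -[RHS]/(0%:E); congr EFin.
by field; rewrite c0' v0.
Qed.

End deviation_bound.

(** * Deviations of the empirical counts of the chain *)

Section empirical_deviation.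
Context (R : realType) (d d' : measure_display) (S : measurableType d)
  (Omega : measurableType d').
Variables (X : nat -> {mfun Omega >-> S}) (xi : nat -> {mfun Omega >-> bool}).
Variable Pr : probability Omega R.
Variables (P : R.-pker S ~> S) (s : S -> R) (nu : probability S R).
Hypotheses (hmin : minorized P s nu) (hsplit : split_chain X xi P s nu Pr).
Variables (C : set S) (mC : measurable C).
Hypothesis hblock : (\int[Pr]_w (@block_visits R _ _ _ _ X xi C 1 w) ^+ 2 < +oo)%E.
Variables (psi : {measure set S -> \bar R}) (pi : {sigma_finite_measure set S -> \bar R}).
Hypotheses (hpsi : irreducibility_measure P psi) (hpi : invariant_measure P pi).
Hypothesis piC : (0 < pi C)%E.
Local Notation Q := (excursion_law X xi Pr).
Local Notation future := (future X xi).
Local Notation excursion := (excursion X xi).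

(** The first regeneration is at the time [hit + 1], hence the [hit + 2] terms that
    precede the excursion. *)
Lemma time_sum_excursion (f : S -> R) n w : (hit (future 0 w) < n)%N ->
  \sum_(t < n.+1) f (X t w) =
  \sum_(t < (hit (future 0 w)).+2) f (X t w) +
  time_sum f (n - (hit (future 0 w)).+1) (excursion w).
Proof.
move=> hn; have -> : n.+1 = ((hit (future 0 w)).+2 + (n - (hit (future 0 w)).+1))%N.
  by rewrite addSn subnKC.
by rewrite big_split_ord.
Qed.

Lemma probability_union2 (B1 B2 : set Omega) (a b : R) : measurable B1 -> measurable B2 ->
  (Pr B1 <= a%:E)%E -> (Pr B2 <= b%:E)%E -> (Pr (B1 `|` B2) <= (a + b)%:E)%E.
Proof. by move=> m1 m2 h1 h2; rewrite (le_trans (measureU2 _ _ _))// EFinD leeD. Qed.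

(** The estimates for excursions are transferred to the chain: with high
    probability the first regeneration occurs by a fixed time [L + 1], and the
    terms up to it change the deviations by at most [L + 2]. *)
Lemma empirical_deviation (eta : R) : 0 < eta ->
  exists (Kc : R) (n0 : nat), forall n, (n0 <= n)%N -> forall m (A : nat -> set S),
  [/\ forall i, measurable (A i), A 0%N = set0,
      forall i j, (i <= j)%N -> A i `<=` A j & A m = C] -> (forall i, A i `<=` C) ->
  exists Bad : set Omega, [/\ measurable Bad, (Pr Bad <= eta%:E)%E &
    forall w, ~ Bad w -> 0 < \sum_(t < n.+1) (\1_C (X t w) : R) /\
      forall i, (i <= m)%N ->
        (\sum_(t < n.+1) deviation C A (fun i => fine (pi (A i)) / fine (pi C)) i (X t w)) ^+ 2 <=
        Kc * \sum_(t < n.+1) \1_C (X t w)].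
Proof.
move=> eta0; pose e := eta / 6; have e0 : 0 < e by rewrite divr_gt0.
have rec := two_regenerations_as mC hblock.
have reg := regenerative_excursion_law hmin hsplit rec.
have [mu [M2 [mu0 visitsE visits2E]]] :=
  excursion_visits_moments hmin hsplit mC hblock hpsi hpi piC.
have piCf : fine (pi C) > 0.
  by rewrite fine_gt0// piC ltey_eq (measure_small_fin hmin hsplit mC hblock hpsi hpi).
pose N w := hit (future 0 w).
have mfuture Y : measurable Y -> measurable (future 0 @^-1` Y).
  by move=> mY; rewrite -[X in measurable X]setTI; exact: measurable_future.
have mN k : measurable [set w | N w = k] by exact: mfuture (@measurable_hit _ S k).
have [L hL] := nat_variable_tail Pr mN e0.
have mL : measurable [set w | (L < N w)%N].
  have := measurable_fun_nat mN measurableT (Y := [set k | (L < k)%N]).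
  by rewrite setTI; apply.
have [Kc [n0 hKc]] := good_excursions reg mC mu0 visitsE visits2E e0 (ltn0Sn L).
exists Kc, (maxn n0 L.+2) => n; rewrite geq_max => /andP[/hKc{}hKc Ln] m A [mA A0 AA Am] AC.
pose p i := fine (pi (A i)) / fine (pi C).
have p01 i : 0 <= p i <= 1.
  rewrite divr_ge0 ?fine_ge0//= ler_pdivrMr// mul1r fine_le//.
  - rewrite ge0_fin_numE//; apply: (@le_lt_trans _ _ (pi C)).
      by apply: le_measure; rewrite ?inE//; exact: AC.
    by rewrite -ge0_fin_numE// (measure_small_fin hmin hsplit mC hblock hpsi hpi).
  - exact: (measure_small_fin hmin hsplit mC hblock hpsi hpi).
  - by apply: le_measure; rewrite ?inE//; exact: AC.
have gr : grid Q C m A p.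
  split => //; split => // i.
  exact: (excursion_mean_zero hmin hsplit mC hblock hpsi hpi piC (mA i) (@AC i)).
have [Bad [mBad QBad good]] := hKc m A p gr.
exists ([set w | (L < N w)%N] `|` excursion @^-1` Bad).
have mEB : measurable (excursion @^-1` Bad).
  by rewrite -[X in measurable X]setTI; exact: measurable_excursion.
split; first exact: measurableU.
  have -> : eta = e + 5 * e by rewrite /e; field.
  exact: probability_union2.
move=> w /not_orP[/negP]; rewrite -leqNgt => NL /good{}good.
have tn : (n - L.+1 <= n - (N w).+1 <= n)%N by rewrite leq_sub2l//= leq_subr.
have [T0 dev] := good _ tn.
have Nn : (N w < n)%N by exact: leq_ltn_trans NL (ltnW Ln).
have Tle : time_sum (\1_C : S -> R) (n - (N w).+1) (excursion w) <=
    \sum_(t < n.+1) \1_C (X t w).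
  by rewrite (time_sum_excursion (\1_C) Nn) lerDr sumr_ge0.
split; first exact: lt_le_trans Tle.
move=> i im; rewrite (time_sum_excursion _ Nn); have {}dev := dev i im.
set T := time_sum (\1_C) _ _ in T0 dev Tle; set V := \sum_(t < n.+1) _ in Tle *.
set a := \sum_(t < _) _; set b := time_sum _ _ _ in dev *.
have a2 : a ^+ 2 <= (L.+2)%:R ^+ 2.
  have : `|a| <= (L.+2)%:R.
    apply: le_trans (ler_norm_sum _ _ _) _.
    apply: (@le_trans _ _ (\sum_(t < (N w).+2) 1)).
      apply: ler_sum => t _; apply: (le_trans (deviation_le AC p01 i _)).
      by rewrite indicE; case: (_ \in _).
    by rewrite sumr_const card_ord ler_nat !ltnS.
  by move=> h; rewrite -(real_normK (num_real a)) ler_sqr ?nnegrE.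
have Kc0 : 0 <= Kc.
  rewrite -(pmulr_lge0 _ T0); apply: le_trans dev.
  by rewrite addr_ge0// mulr_ge0// sqr_ge0.
have : Kc * T <= Kc * V by exact: ler_wpM2l.
have := sqr_ge0 (a - b); nra.
Qed.

End empirical_deviation.

(** * Empirical quantiles *)

Lemma seq_has_min (R : realDomainType) (v : seq R) : v != [::] ->
  exists2 y, y \in v & forall z, z \in v -> y <= z.
Proof.
elim: v => // x v IH _; have [->|v0] := eqVneq v [::].
  by exists x; [rewrite inE|move=> z; rewrite inE => /eqP->].
have [y yv hy] := IH v0; exists (Num.min x y).
  by rewrite inE; case: leP => _; rewrite ?eqxx ?yv ?orbT.
by move=> z; rewrite inE ge_min => /orP[/eqP->|/hy->]; rewrite ?lexx ?orbT.
Qed.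

Lemma seq_has_max (R : realDomainType) (v : seq R) : v != [::] ->
  exists2 y, y \in v & forall z, z \in v -> z <= y.
Proof.
move=> v0; have [|y] := @seq_has_min _ (map -%R v); first by case: v v0.
move=> /mapP[x xv ->] h; exists x => // z zv.
by rewrite -lerN2 h// map_f.
Qed.

Section empirical_quantile.
Context (R : realType).
Variables (C : set R) (x : nat -> R) (n : nat).
Local Notation T := (nvisits C x n).
Local Notation V := (visited C x n).
Local Notation G := (emp_cdf C x n).

Definition visits_below (y : R) : nat := (\sum_(t < n.+1) ((x t \in C) && (x t <= y)%R))%N.

Lemma emp_cdfE y : G y = (visits_below y)%:R / T%:R. Proof. by []. Qed.

Lemma visits_below_homo y z : y <= z -> (visits_below y <= visits_below z)%N.
Proof.
move=> yz; apply: leq_sum => t _; case: (x t \in C) => //=.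
by have [xy|//] := leP (x t) y; rewrite (le_trans xy yz).
Qed.

Lemma emp_cdf_homo y z : y <= z -> G y <= G z.
Proof. by move=> yz; rewrite !emp_cdfE ler_wpM2r ?invr_ge0// ler_nat visits_below_homo. Qed.

Lemma mem_visited y : (y \in V) = [exists t : 'I_n.+1, (x t == y) && (y \in C)].
Proof.
rewrite mem_sort mem_undup mem_filter; apply/idP/existsP.
  move=> /andP[yC /mapP[t]]; rewrite mem_iota/= add0n => tn yt.
  by exists (Ordinal tn); rewrite yC yt eqxx.
move=> [t /andP[/eqP<- ->]]; apply: map_f; rewrite mem_iota/= add0n.
exact: ltn_ord.
Qed.

Lemma visits_below_gt0 y : (0 < visits_below y)%N -> exists2 v, v \in V & v <= y.
Proof.
rewrite lt0n sum_nat_eq0 negb_forall => /existsP[t /=].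
rewrite eqb0 negbK => /andP[xC xy]; exists (x t) => //.
by rewrite mem_visited; apply/existsP; exists t; rewrite eqxx.
Qed.

Hypothesis T0 : (0 < T)%N.

Lemma visited_neq0 : V != [::].
Proof.
move: T0; rewrite lt0n sum_nat_eq0 negb_forall => /existsP[t /=].
rewrite eqb0 negbK => xC; have : x t \in V.
  by rewrite mem_visited; apply/existsP; exists t; rewrite eqxx.
by case: V.
Qed.

(** The empirical distribution function is constant between visited values. *)
Lemma emp_cdf_visited y : 0 < G y -> exists2 v, v \in V & v <= y /\ G v = G y.
Proof.
move=> Gy; have /visits_below_gt0[v0 v0V v0y] : (0 < visits_below y)%N.
  by rewrite lt0n; apply/eqP => h; move: Gy; rewrite emp_cdfE h mul0r ltxx.
have [|v] := @seq_has_max _ [seq v <- V | v <= y].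
  apply/eqP => h; have : v0 \in [seq v <- V | v <= y] by rewrite mem_filter v0y.
  by rewrite h.
rewrite mem_filter => /andP[vy vV] vm; exists v => //; split => //.
rewrite !emp_cdfE; congr (_%:R / _); apply: eq_bigr => t _; congr nat_of_bool.
case: (boolP (x t \in C)) => //= xC; apply/idP/idP => [/le_trans->//|xy].
apply: vm; rewrite mem_filter xy mem_visited; apply/existsP; exists t.
by rewrite eqxx.
Qed.

Lemma emp_cdf_max : exists2 v, v \in V & G v = 1.
Proof.
have [v vV vm] := seq_has_max visited_neq0; exists v => //.
rewrite emp_cdfE (_ : visits_below v = T) ?divff// ?pnatr_eq0 -?lt0n//.
apply: eq_bigr => t _; congr nat_of_bool; case: (boolP (x t \in C)) => //= xC.
by apply: vm; rewrite mem_visited; apply/existsP; exists t; rewrite eqxx.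
Qed.

Lemma visited_bounds v z : v \in V -> head z V <= v <= last z V.
Proof.
have : sorted <=%R V by apply: sort_sorted; exact: le_total.
elim: V z => //= u s IH z; rewrite inE => pus /predU1P[->|vs].
  rewrite lexx/=; elim: s u {IH} pus => //= w s IH u /andP[uw ws].
  exact: le_trans uw (IH _ ws).
have /allP h := order_path_min le_trans pus; rewrite h//=.
by have /andP[_] := IH u (path_sorted pus) vs.
Qed.

Variables (y0 p : R).
Hypotheses (p01 : 0 < p <= 1) (hy0 : V != [::] -> y0 < head 0 V).

Let y0_le v : v \in V -> y0 <= v.
Proof.
move=> vV; have /ltW y0h := hy0 visited_neq0; apply: le_trans y0h _.
by have /andP[] := visited_bounds 0 vV.
Qed.

Let emp_inv_smallest :
  Defs.smallest [set y | y0 <= y <= last y0 V /\ p <= G y] (emp_inv C x n y0 p).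
Proof.
have /andP[p0 p1] := p01; apply: xgetPex.
have [vm vmV Gvm] := emp_cdf_max.
have [|v] := @seq_has_min _ [seq v <- V | p <= G v].
  apply/eqP => h; have : vm \in [seq v <- V | p <= G v] by rewrite mem_filter Gvm p1.
  by rewrite h.
rewrite mem_filter => /andP[pv vV] hv; exists v; split.
  by split => //; rewrite y0_le//=; have /andP[] := visited_bounds y0 vV.
move=> y [_ py]; have [u uV [uy Gu]] := emp_cdf_visited (lt_le_trans p0 py).
by apply: le_trans uy; apply: hv; rewrite mem_filter Gu py.
Qed.

(** The Galois connection between a distribution function and its left-continuous
    inverse; all later arguments about the inverse use this equivalence only. *)
Lemma emp_inv_le z : (emp_inv C x n y0 p <= z) = (p <= G z).
Proof.
have [[/andP[_ yl] py] lb] := emp_inv_smallest; have /andP[p0 _] := p01.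
apply/idP/idP => [yz|pz]; first by rewrite (le_trans py)// emp_cdf_homo.
have [zl|/ltW] := leP z (last y0 V); last exact: le_trans.
apply: lb; split => //; rewrite zl andbT.
have [u uV [uz _]] := emp_cdf_visited (lt_le_trans p0 pz).
exact: le_trans (y0_le uV) uz.
Qed.

End empirical_quantile.

(** * From a grid to the interval, and from the distribution function to its inverse *)

Lemma sqr_sandwich (R : realFieldType) (T K e u v1 v2 : R) : 0 <= T ->
  v1 - e <= u -> u <= v2 + e -> T * v1 ^+ 2 <= K -> T * v2 ^+ 2 <= K -> T * e ^+ 2 <= 1 ->
  T * u ^+ 2 <= 2 * K + 2.
Proof.
move=> T0 h1 h2 k1 k2 ke.
have key w : u ^+ 2 <= w ^+ 2 -> w ^+ 2 <= 2 * v1 ^+ 2 + 2 * e ^+ 2 \/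
    w ^+ 2 <= 2 * v2 ^+ 2 + 2 * e ^+ 2 -> T * u ^+ 2 <= 2 * K + 2.
  move=> uw hw; have : T * u ^+ 2 <= T * w ^+ 2 by exact: ler_wpM2l.
  case: hw => hw; have : T * w ^+ 2 <= T * (2 * _ ^+ 2 + 2 * e ^+ 2) := ler_wpM2l T0 hw.
    by move: (v1 ^+ 2) (e ^+ 2) (w ^+ 2) (u ^+ 2) k1 ke => *; lra.
  by move: (v2 ^+ 2) (e ^+ 2) (w ^+ 2) (u ^+ 2) k2 ke => *; lra.
have [u0|u0] := leP 0 u.
  apply: (key (v2 + e)); first by rewrite ler_sqr ?nnegrE// (le_trans u0).
  by right; have := sqr_ge0 (v2 - e); nra.
apply: (key (v1 - e)); last by left; have := sqr_ge0 (v1 + e); nra.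
have n1 : 0 <= - u by lra.
have n2 : - u <= - (v1 - e) by lra.
by rewrite -(sqrrN u) -(sqrrN (v1 - e)) ler_sqr ?nnegrE// (le_trans n1).
Qed.

Lemma sub_le_sub (R : realDomainType) (x y u v e : R) : x <= y -> v - u <= e ->
  x - u - e <= y - v.
Proof. lra. Qed.

Lemma sub_le_add (R : realDomainType) (x y u v e : R) : x <= y -> v - u <= e ->
  x - u <= y - v + e.
Proof. lra. Qed.

Section steep_cdf.
Context (R : realType).
Variables (a b l L : R) (F G : R -> R).
Hypotheses (ab : a < b) (l0 : 0 < l)
  (steep : forall y z, a <= y -> y <= z -> z <= b -> l * (z - y) <= F z - F y <= L * (z - y)).

(** If [Z] exceeded [q + D / l], a point [z] strictly between them would have
    [G z >= F z - D > F q], which the Galois connection forbids below [Z]; the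
    other side is symmetric. *)
Lemma quantile_deviation (D q Z : R) : a <= q <= b ->
  (forall y, a <= y <= b -> `|G y - F y| <= D) ->
  (forall z, (Z <= z) = (F q <= G z)) -> F q <= G b -> (forall z, z < a -> G z < F q) ->
  `|Z - q| <= D / l.
Proof.
move=> /andP[aq qb] hD hZ Gb Ga.
have Zb : Z <= b by rewrite hZ.
have aZ : a <= Z by rewrite leNgt; apply/negP => /Ga; rewrite ltNge -hZ lexx.
have Dl : D = l * (D / l) by rewrite mulrC divfK ?gt_eqF.
have D0 : 0 <= D / l.
  by rewrite divr_ge0 ?(ltW l0)// (le_trans (normr_ge0 _) (hD q _))// aq.
rewrite ler_norml; apply/andP; split; rewrite leNgt; apply/negP => h.
  have Zq : Z <= q by lra.
  have /andP[h1 _] := steep aZ Zq qb.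
  have := hD Z; rewrite aZ Zb ler_norml => /(_ isT)/andP[_ h2].
  have : F q <= G Z by rewrite -hZ.
  have : l * (D / l) < l * (q - Z) by rewrite ltr_pM2l//; lra.
  lra.
pose z := (q + D / l + Z) / 2.
have zZ : z < Z by rewrite /z; lra.
have qz : q <= z by rewrite /z; lra.
have zb : z <= b by lra.
have /andP[h1 _] := steep aq qz zb.
have := hD z; rewrite zb (le_trans aq qz) ler_norml => /(_ isT)/andP[h2 _].
have : G z < F q by rewrite ltNge -hZ -ltNge.
have : l * (D / l) < l * (z - q) by rewrite ltr_pM2l// /z; lra.
lra.
Qed.

Variable (k : nat).
Hypothesis k0 : (0 < k)%N.
Let h := (b - a) / k%:R.

(** The point below [a] makes the first set of the grid empty, as the chaining
    requires. *)
Definition grid_point i : R := if i is j.+1 then a + j%:R * h else a - 1.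

Let h0 : 0 < h. Proof. by rewrite divr_gt0 ?subr_gt0// ltr0n. Qed.

Lemma grid_point_top : grid_point k.+1 = b.
Proof. by rewrite /= /h mulrC divfK ?subrKC// pnatr_eq0 -lt0n. Qed.

Lemma grid_point_homo i j : (i <= j)%N -> grid_point i <= grid_point j.
Proof.
case: i j => [|i] [|j]//=.
  by move=> _; rewrite -[leRHS]addr0 lerD//; have := mulr_ge0 (ler0n R j) (ltW h0); lra.
by rewrite ltnS => ij; rewrite lerD2l ler_pM2r// ler_nat.
Qed.

Lemma grid_point_cell y : a <= y <= b ->
  exists2 j, (j < k)%N & grid_point j.+1 <= y <= grid_point j.+2.
Proof.
move=> /andP[ay yb]; have q0 : 0 <= (y - a) / h by rewrite divr_ge0 ?subr_ge0// ltW.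
have /andP[j1 j2] := truncn_itv q0; set j := Num.trunc _ in j1 j2.
have jk : (j <= k)%N.
  rewrite -(ler_nat R) (le_trans j1)// ler_pdivrMr//.
  by rewrite mulrC /h divfK ?lerD2r// pnatr_eq0 -lt0n.
have [{}jk|kj] := ltnP j k.
  exists j => //=; move: j1 j2; rewrite ler_pdivlMr// ltr_pdivrMr// => j1 j2.
  by apply/andP; split; lra.
have {jk kj}jE : j = k by apply/eqP; rewrite eqn_leq jk.
have yE : y = b.
  apply/eqP; rewrite eq_le yb/= -grid_point_top /=.
  by move: j1; rewrite jE ler_pdivlMr//; lra.
exists k.-1; first by rewrite prednK.
rewrite prednK// yE grid_point_top lexx andbT.
by apply: (le_trans (grid_point_homo (leqnSn k))); rewrite grid_point_top.
Qed.

Hypothesis Ghomo : forall y z, y <= z -> G y <= G z.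

(** Between two grid points [G] is monotone and [F] moves by at most [e], so the
    deviation at [y] is sandwiched between those at its two neighbours. *)
Lemma grid_deviation (T K e : R) : 0 <= T -> L * h <= e -> T * e ^+ 2 <= 1 ->
  (forall i, (i <= k.+1)%N -> T * (G (grid_point i) - F (grid_point i)) ^+ 2 <= K) ->
  forall y, a <= y <= b -> T * (G y - F y) ^+ 2 <= 2 * K + 2.
Proof.
move=> T0 Lh Te hK y yab; have [j jk /andP[y1 y2]] := grid_point_cell yab.
have /andP[ay yb] := yab.
have g1 : a <= grid_point j.+1 by rewrite /= lerDl mulr_ge0// ltW.
have g2 : grid_point j.+2 <= b by rewrite -grid_point_top; apply: grid_point_homo.
have gg : grid_point j.+2 - grid_point j.+1 = h by rewrite /= -natr1; ring.
have /andP[_ s1] := steep g1 y1 yb.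
have /andP[_ s2] := steep ay y2 g2.
have LL : 0 <= L.
  have /andP[u v] := steep (lexx a) (ltW ab) (lexx b).
  have := le_trans u v; rewrite ler_pM2r ?subr_gt0//; exact/le_trans/ltW.
have L1 : L * (y - grid_point j.+1) <= L * h by rewrite ler_wpM2l// -gg lerD2r.
have L2 : L * (grid_point j.+2 - y) <= L * h by rewrite ler_wpM2l// -gg lerD2l lerN2.
have G1 := Ghomo y1; have G2 := Ghomo y2.
apply: (@sqr_sandwich _ T K e _ (G (grid_point j.+1) - F (grid_point j.+1))
  (G (grid_point j.+2) - F (grid_point j.+2))) => //.
- apply: (sub_le_sub G1); exact: le_trans s1 (le_trans L1 Lh).
- apply: (sub_le_add G2); exact: le_trans s2 (le_trans L2 Lh).
- by apply: hK; exact: leqW.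
- exact: hK.
Qed.

End steep_cdf.

(** * Slopes of a differentiable distribution function *)

Lemma derivative_withinP (R : realType) (C : set R) (f : R -> R) (y l : R) :
  derivative_within C f y l -> forall e, 0 < e -> exists2 r : R, 0 < r &
  forall w, C w -> w != y -> `|w - y| < r -> `|(f w - f y) / (w - y) - l| < e.
Proof.
move=> /cvgrPdist_lt h e e0; have := h e e0.
rewrite near_withinE => /nbhs_ballP[r /= r0 hr]; exists r => // w Cw wy wr.
by rewrite distrC; apply: hr => //; rewrite /ball/= distrC.
Qed.

Section bounded_slope.
Context (R : realType) (a b : R) (f : R -> R).
Hypothesis ab : a < b.
Local Notation C := (`[a, b]%classic : set R).

Lemma approach y r : a <= y <= b -> 0 < r -> exists2 w, C w & w != y /\ `|w - y| < r.
Proof.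
move=> /andP[ay yb] r0; have [yb'|by_] := ltP y b.
  pose e := Num.min (b - y) (r / 2); have e0 : 0 < e by rewrite lt_min subr_gt0 yb' divr_gt0.
  exists (y + e).
    rewrite /= in_itv/= (le_trans ay) ?lerDl ?(ltW e0)//=.
    by rewrite -lerBrDl /e ge_min lexx.
  split; first by rewrite -subr_eq0 addrAC subrr add0r gt_eqF.
  rewrite addrAC subrr add0r gtr0_norm// (@le_lt_trans _ _ (r / 2))//; first by rewrite /e ge_min lexx orbT.
  by lra.
have {by_}yb : y = b by apply/eqP; rewrite eq_le yb.
pose e := Num.min (b - a) (r / 2); have e0 : 0 < e by rewrite lt_min subr_gt0 ab divr_gt0.
have ea : e <= b - a by rewrite /e ge_min lexx.
exists (y - e); first by rewrite /= in_itv/= yb; apply/andP; split; lra.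
split; first by rewrite -subr_eq0 addrAC subrr add0r oppr_eq0 gt_eqF.
rewrite addrAC subrr add0r normrN gtr0_norm// (@le_lt_trans _ _ (r / 2))//.
  by rewrite /e ge_min lexx orbT.
by lra.
Qed.

(** The sign comes from monotonicity; it turns the bound on the absolute value of
    the derivative into a bound on the slope. *)
Lemma derivative_within_ge0 y l : (forall u v, u <= v -> f u <= f v) -> a <= y <= b ->
  derivative_within C f y l -> 0 <= l.
Proof.
move=> fh yab fl; rewrite leNgt; apply/negP => l0.
have [|r r0 hr] := derivative_withinP fl (e := - l); first by rewrite oppr_gt0.
have [w Cw [wy wr]] := approach yab r0; have := hr w Cw wy wr.
have q0 : 0 <= (f w - f y) / (w - y).
  have [lt|gt|eq] := ltgtP w y; last by rewrite eq subrr mul0r.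
    by rewrite -mulrNN -invrN !opprB mulr_ge0 ?invr_ge0 ?subr_ge0 ?fh// ltW.
  by rewrite mulr_ge0 ?invr_ge0 ?subr_ge0 ?fh// ltW.
by rewrite gtr0_norm; lra.
Qed.

Lemma derivative_within_is_derive y l : a < y < b -> derivative_within C f y l ->
  is_derive y 1 f l.
Proof.
move=> /andP[ay yb] fl.
have cv : h^-1 *: ((f \o shift y) (h *: 1) - f y) @[h --> 0^'] --> l.
  apply/cvgrPdist_lt => e e0; have [r r0 hr] := derivative_withinP fl e0.
  have m0 : 0 < Num.min r (Num.min (y - a) (b - y)) by rewrite !lt_min r0 !subr_gt0 ay.
  near=> h.
  have hlt : `|h| < Num.min r (Num.min (y - a) (b - y)).
    by near: h; apply: dnbhs0_lt.
  have h0 : h != 0 by near: h; exact: nbhs_dnbhs_neq.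
  move: hlt; rewrite !lt_min => /andP[hr' /andP[ha hb]].
  have Ch : C (h + y).
    move: ha hb; rewrite !ltr_norml => /andP[h1 h2] /andP[h3 h4].
    by rewrite /= in_itv/=; apply/andP; split; lra.
  have hy : h + y != y by rewrite -subr_eq0 addrK.
  have hrr : `|h + y - y| < r by rewrite addrK.
  have := hr _ Ch hy hrr; rewrite addrK distrC /= /shift /=.
  by rewrite /GRing.scale/= mulr1 [in X in X -> _]mulrC.
apply: DeriveDef; first by apply/cvg_ex; exists l.
exact: cvg_lim cv.
Unshelve. all: by end_near.
Qed.

Lemma derivative_within_continuous (df : R -> R) :
  (forall y, C y -> derivative_within C f y (df y)) -> {within C, continuous f}.
Proof.
move=> hf; apply/subspace_continuousP => y Cy; apply/cvgrPdist_lt => e e0.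
have [r r0 hr] := derivative_withinP (hf y Cy) ltr01.
pose B := `|df y| + 1; have B0 : 0 < B by rewrite ltr_wpDl.
rewrite near_withinE; near=> w => Cw.
have [->|wy] := eqVneq w y; first by rewrite subrr normr0.
have wr : `|w - y| < r.
  by rewrite distrC; near: w; apply: nbhsx_ballx.
have we : `|w - y| < e / B.
  by rewrite distrC; near: w; apply: nbhsx_ballx; rewrite divr_gt0.
have := hr w Cw wy wr; set q := _ / _ => hq.
have qB : `|q| <= B.
  rewrite /B -(subrK (df y) q) (le_trans (ler_normD _ _))// addrC lerD2l.
  exact: ltW.
have -> : f y - f w = - (q * (w - y)) by rewrite /q divfK ?opprB// subr_eq0.
rewrite normrN normrM (@le_lt_trans _ _ (B * `|w - y|))//; first by rewrite ler_wpM2r.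
by rewrite mulrC -ltr_pdivlMr.
Unshelve. all: by end_near.
Qed.

(** The mean value theorem, for which the one-sided derivatives at the end points
    provide the continuity on the closed interval. *)
Lemma bounded_slope : (forall u v, u <= v -> f u <= f v) -> bounded_derivative_on C f ->
  exists l L : R, 0 < l /\
    forall y z, a <= y -> y <= z -> z <= b -> l * (z - y) <= f z - f y <= L * (z - y).
Proof.
move=> fh [df [l [L [l0 hf]]]]; exists l, L; split => // y z ay.
rewrite le_eqVlt => /predU1P[->|yz] zb; first by rewrite !subrr !mulr0 lexx.
have Csub x : x \in `]y, z[ -> a < x < b.
  rewrite in_itv/= => /andP[h1 h2].
  by rewrite (le_lt_trans ay h1) (lt_le_trans h2 zb).
have fc : {within `[y, z], continuous f}.
  apply: (@continuous_subspaceW _ _ _ C).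
    by move=> x /=; rewrite !in_itv/= => /andP[h1 h2]; rewrite (le_trans ay h1) (le_trans h2 zb).
  by apply: (@derivative_within_continuous df) => x /hf[].
have fd x : x \in `]y, z[ -> is_derive x 1 f (df x).
  move=> /Csub xab; apply: derivative_within_is_derive => //.
  have Cx : C x by move: xab => /andP[h1 h2]; rewrite /= in_itv/= !ltW.
  by have [] := hf x Cx.
have [c cyz ->] := MVT yz fd fc.
have /andP[ac cb] := Csub c cyz.
have cab : a <= c <= b by rewrite !ltW.
have [fdc /andP[dl dL]] := hf c cab.
have dc := derivative_within_ge0 fh cab fdc.
by rewrite ger0_norm// in dl dL; rewrite !ler_pM2r ?subr_gt0// dl.
Qed.

(** Used to exclude a null set [C]: the localized distribution function would
    then vanish identically. *)
Lemma bounded_derivative_nonconstant : bounded_derivative_on C f -> ~ (forall y, f y = 0).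
Proof.
move=> [df [l [L [l0 hf]]]] f0; have Ca : C a by rewrite /= in_itv/= lexx ltW.
have [fd /andP[ld _]] := hf a Ca.
have [r r0 hr] := derivative_withinP fd l0.
have aab : a <= a <= b by rewrite lexx ltW.
have [w Cw [wa wr]] := approach aab r0; have := hr w Cw wa wr.
by rewrite !f0 subrr mul0r sub0r normrN ltNge ld.
Qed.

End bounded_slope.

(** * Rational witnesses *)

(** The product with [T = 0] is zero even if the supremum is infinite, so the event
    forces a visit. *)
Lemma scaled_sup_gt (R : realType) (K : R) (T : nat) (I : Type) (A : set I) (f : I -> R) :
  0 <= K -> A !=set0 ->
  (K%:E < `|T%:R%:E * ereal_sup [set (`|f y|%R ^+ 2)%R%:E | y in A]|)%E <->
  (0 < T)%N /\ exists2 y, A y & K < T%:R * f y ^+ 2.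
Proof.
move=> K0 [y0 Ay0]; set B := [set _ | _ in A].
have B0 : (0 <= ereal_sup B)%E.
  apply: (@le_trans _ _ (`|f y0| ^+ 2)%:E); first by rewrite lee_fin sqr_ge0.
  by apply: ereal_sup_ubound; exists y0.
have [->|T0] := posnP T.
  by rewrite mul0e abse0 lte_fin ltNge K0; split => // -[].
have Tr : 0 < T%:R :> R by rewrite ltr0n.
rewrite gee0_abs; last by rewrite mule_ge0// lee_fin.
rewrite muleC -lte_pdivrMr//; split=> [h|[_ [y Ay Ky]]].
  split => //; have [_ [y Ay <-]] := ereal_sup_gt h.
  by rewrite lte_fin ltr_pdivrMr// mulrC real_normK ?num_real//; exists y.
apply: (@lt_le_trans _ _ (`|f y| ^+ 2)%:E).
  by rewrite lte_fin ltr_pdivrMr// mulrC real_normK ?num_real.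
by apply: ereal_sup_ubound; exists y.
Qed.

Lemma sqr_lt_open (R : realFieldType) (A c : R) : A < c ^+ 2 ->
  exists2 r, 0 < r & forall d, `|d| < r -> A < (c - d) ^+ 2.
Proof.
move=> Ac; have c0 : 0 < 2 * `|c| + 1 by rewrite ltr_wpDl// mulr_ge0.
exists ((c ^+ 2 - A) / (2 * `|c| + 1)); first by rewrite divr_gt0 ?subr_gt0.
move=> d; rewrite ltr_pdivlMr// => h.
have h1 : c * d <= `|c| * `|d| by rewrite -normrM ler_norm.
have h2 := normr_ge0 d; have h3 := sqr_ge0 d.
have -> : (c - d) ^+ 2 = c ^+ 2 - 2 * (c * d) + d ^+ 2 by ring.
move: (c * d) (d ^+ 2) (c ^+ 2) h1 h3 h => u v w h1 h3.
by rewrite mulrDr mulr1 => h; lra.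
Qed.

Section rational_witnesses.
Context (R : realType).
Variables (a b l L : R) (F : R -> R).
Hypotheses (l0 : 0 < l)
  (steep : forall y z, a <= y -> y <= z -> z <= b -> l * (z - y) <= F z - F y <= L * (z - y)).
Variables (C : set R) (x : nat -> R) (n : nat).
Local Notation T := (nvisits C x n).
Local Notation G := (emp_cdf C x n).
Hypothesis T0 : (0 < T)%N.

(** Rationals of an open interval with one of its end points adjoined, as a family
    indexed by all rationals: a countable set of witnesses. *)
Definition rational_or (u v e : R) (q : rat) : R := if u < ratr q < v then ratr q else e.

Lemma rational_or_mem u v q : u <= v -> u <= rational_or u v u q <= v /\ u <= rational_or u v v q <= v.
Proof.
move=> uv; rewrite /rational_or; case: ifP => [/andP[h1 h2]|_]; rewrite ?lexx ?uv//.
by rewrite !ltW.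
Qed.

Lemma rational_or_end u v e : exists q, rational_or u v e q = e.
Proof.
have [q] := rat_in_itvoo (ltr_pwDr ltr01 (lexx v)).
rewrite in_itv/= => /andP[vq _]; exists q; rewrite /rational_or.
by rewrite [X in _ && X]ltNge (ltW vq) andbF.
Qed.

Lemma rational_or_between u v e y z : u <= y -> y < z -> z <= v ->
  exists2 q, rational_or u v e q = ratr q & y < ratr q < z.
Proof.
move=> uy yz zv; have [q] := rat_in_itvoo yz; rewrite in_itv/= => /andP[h1 h2].
by exists q; rewrite ?h1// /rational_or (le_lt_trans uy h1) (lt_le_trans h2 zv).
Qed.

Lemma emp_cdf_right_constant y : exists2 z, y < z & forall u, y <= u < z -> G u = G y.
Proof.
pose s := [seq u <- [seq x t | t <- iota 0 n.+1] | y < u].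
have [s0|sn] := eqVneq s [::].
  exists (y + 1) => [|u /andP[yu _]]; first by rewrite ltrDl.
  rewrite !emp_cdfE; congr (_%:R / _); apply: eq_bigr => t _; congr nat_of_bool.
  case: (_ \in C) => //=; apply/idP/idP => [_|/le_trans->//]; rewrite leNgt; apply/negP => yx.
  have : x t \in s by rewrite mem_filter yx map_f// mem_iota add0n /=.
  by rewrite s0.
have [z] := seq_has_min sn; rewrite mem_filter => /andP[yz _] zm.
exists z => // u /andP[yu uz]; rewrite !emp_cdfE; congr (_%:R / _).
apply: eq_bigr => t _; congr nat_of_bool.
case: (_ \in C) => //=; apply/idP/idP => [xu|/le_trans->//]; rewrite leNgt; apply/negP => yx.
have : x t \in s by rewrite mem_filter yx map_f// mem_iota add0n /=.
by move=> /zm; rewrite leNgt (le_lt_trans xu uz).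
Qed.

Lemma steep_close y e : 0 < e -> a <= y <= b ->
  exists2 r, 0 < r & forall z, a <= z <= b -> `|z - y| < r -> `|F z - F y| < e.
Proof.
move=> e0 /andP[ay yb]; have B0 : 0 < `|L| + 1 by rewrite ltr_wpDl.
exists (e / (`|L| + 1)); first by rewrite divr_gt0.
have key u v : a <= u -> u <= v -> v <= b -> `|v - u| < e / (`|L| + 1) -> `|F v - F u| < e.
  move=> au uv vb; rewrite ltr_pdivlMr// => h.
  have /andP[s1 s2] := steep au uv vb.
  have vu : 0 <= v - u by rewrite subr_ge0.
  rewrite ger0_norm ?(le_trans _ s1) ?mulr_ge0 ?(ltW l0)//.
  apply: le_lt_trans s2 _; apply: le_lt_trans h; rewrite ger0_norm// mulrC ler_wpM2l//.
  by rewrite (le_trans (ler_norm _))// lerDl.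
move=> z /andP[az zb]; have [yz|/ltW zy] := leP y z; first exact: key.
by rewrite distrC [X in _ -> X < _]distrC; exact: key.
Qed.

(** The empirical distribution function is constant on a right neighbourhood of a
    point and [F] is continuous, so a strict inequality persists at rationals to
    the right; only the right end point needs to be adjoined. *)
Lemma deviation_rational (u v K : R) : a <= u -> u <= v -> v <= b ->
  (exists2 y, u <= y <= v & K < T%:R * (G y - F y) ^+ 2) <->
  exists q, K < T%:R * (G (rational_or u v v q) - F (rational_or u v v q)) ^+ 2.
Proof.
move=> au uv vb; have Tr : 0 < T%:R :> R by rewrite ltr0n.
split=> [[y /andP[uy yv]]|[q h]]; last first.
  by exists (rational_or u v v q) => //; have [] := rational_or_mem q uv.
have [{}yv|vy] := ltP y v; last first.
  have -> : y = v by apply/eqP; rewrite eq_le yv.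
  by have [q qE] := rational_or_end u v v => h; exists q; rewrite qE.
rewrite mulrC -ltr_pdivrMr// => /sqr_lt_open[e e0 he].
have ayb : a <= y <= b by rewrite (le_trans au uy) (le_trans (ltW yv) vb).
have [r r0 hr] := steep_close e0 ayb; have [z yz hz] := emp_cdf_right_constant y.
have m : y < Num.min v (Num.min z (y + r)) by rewrite !lt_min yv yz ltrDl.
have mv : Num.min v (Num.min z (y + r)) <= v by rewrite ge_min lexx.
have [q qE] := rational_or_between v uy m mv.
rewrite !lt_min => /andP[yq /andP[qv /andP[qz qr]]].
exists q; rewrite qE mulrC -ltr_pdivrMr// hz ?(ltW yq)//.
have := he (F (ratr q) - F y); rewrite (_ : G y - F y - _ = G y - F (ratr q)); last by ring.
apply; apply: hr; first by rewrite (le_trans au (le_trans uy (ltW yq))) (le_trans (ltW qv) vb).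
by rewrite gtr0_norm ?subr_gt0// ltrBlDl.
Qed.

Variable Z : R -> R.

(** A large deviation of the empirical quantile at the level [F y] is witnessed by a
    rational [z] between [y] and the quantile, on which side of the quantile [z]
    lies being decided by comparing [G z] with [F y].  By continuity the point [y]
    can then be moved slightly to the left, to a rational. *)
Lemma quantile_rational (u v K : R) : 0 <= K ->
  a <= u -> u <= v -> v <= b ->
  (forall y, u <= y <= v -> forall z, (Z (F y) <= z) = (F y <= G z)) ->
  (exists2 y, u <= y <= v & K < T%:R * (Z (F y) - y) ^+ 2) <->
  exists q z : rat, let y := rational_or u v u q in
    K < T%:R * (ratr z - y) ^+ 2 /\
    (y < ratr z /\ G (ratr z) < F y \/ ratr z < y /\ F y <= G (ratr z)).
Proof.
move=> K0 au uv vb hZ; have Tr : 0 < T%:R :> R by rewrite ltr0n.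
split; last first.
  move=> [q [z]]; set y := rational_or u v u q => -[Kz h].
  have yuv : u <= y <= v by have [] := rational_or_mem q uv.
  exists y => //; apply: (lt_le_trans Kz); rewrite ler_pM2l//.
  case: h => -[yz]; [rewrite ltNge -hZ// -ltNge => zZ|rewrite -hZ// => Zz].
    by rewrite ler_sqr ?nnegrE ?subr_ge0 ?lerD2r ?(ltW yz) ?(ltW zZ)// ltW// (lt_trans yz).
  rewrite -(sqrrN (ratr z - y)) -(sqrrN (Z _ - y)) !opprB.
  by rewrite ler_sqr ?nnegrE ?subr_ge0 ?lerD2l ?lerN2 ?(ltW yz)// (le_trans Zz)// ltW.
move=> [y /andP[uy yv]] KZ; have yuv : u <= y <= v by rewrite uy.
have ayb : a <= y <= b by rewrite (le_trans au uy) (le_trans yv vb).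
have KT : K / T%:R < (Z (F y) - y) ^+ 2 by rewrite ltr_pdivrMr// mulrC.
have [e e0 he] := sqr_lt_open KT.
have hK t : K < T%:R * t ^+ 2 = (K / T%:R < t ^+ 2) by rewrite ltr_pdivrMr// mulrC.
have near_y (z : R) : K / T%:R < (z - y) ^+ 2 -> exists2 r, 0 < r &
    forall t, `|t - y| < r -> K < T%:R * (z - t) ^+ 2.
  move=> /sqr_lt_open[r r0 hr]; exists r => // t ty; rewrite hK.
  by have := hr _ ty; rewrite (_ : z - y - (t - y) = z - t)//; ring.
have left_witness r : 0 < r -> exists q, let t := rational_or u v u q in
    [/\ u <= t, t <= y & `|t - y| < r].
  move=> r0; have [yu|uy'] := leP y u.
    have [q qE] := rational_or_end u v u; exists q; rewrite /= qE.
    by rewrite uy lexx (_ : y = u) ?subrr ?normr0//; apply/eqP; rewrite eq_le yu.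
  have m : Num.max u (y - r) < y by rewrite gt_max uy' ltrBlDr ltrDl.
  have um : u <= Num.max u (y - r) by rewrite le_max lexx.
  have [q qE /andP[q1 q2]] := rational_or_between u um m yv.
  move: q1; rewrite gt_max => /andP[uq qr]; exists q; rewrite /= qE (ltW uq) (ltW q2).
  by rewrite ltr0_norm ?subr_lt0// opprB ltrBlDr -ltrBlDl.
have [Zy|yZ|Zy] := ltgtP (Z (F y)) y; last first.
- by move: KZ; rewrite Zy subrr expr0n mulr0 ltNge K0.
- have m : Num.max y (Z (F y) - e) < Z (F y) by rewrite gt_max yZ ltrBlDr ltrDl.
  have [z] := rat_in_itvoo m; rewrite in_itv/= gt_max => /andP[/andP[yz ez] zZ].
  have Gz : G (ratr z) < F y by rewrite ltNge -hZ// -ltNge.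
  have : K / T%:R < (ratr z - y) ^+ 2.
    have := he (Z (F y) - ratr z); rewrite gtr0_norm ?subr_gt0// ltrBlDl -ltrBlDr ez.
    by move=> /(_ isT); rewrite (_ : _ - _ - _ = ratr z - y)//; ring.
  move=> /near_y[r r0 hr]; have FG : 0 < F y - G (ratr z) by rewrite subr_gt0.
  have [r' r'0 hr'] := steep_close FG ayb.
  have m0 : 0 < Num.min r r' by rewrite lt_min r0.
  have [q /= [uq qy]] := left_witness _ m0; rewrite lt_min => /andP[qr qr'].
  exists q, z => /=; split; first exact: hr.
  left; split; first exact: le_lt_trans yz.
  have qab : a <= rational_or u v u q <= b by rewrite (le_trans au uq) (le_trans qy)//; case/andP: ayb.
  by have := hr' _ qab qr'; rewrite ltr_norml => /andP[h _]; lra.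
have m : Z (F y) < Num.min y (Z (F y) + e) by rewrite lt_min Zy ltrDl.
have [z] := rat_in_itvoo m; rewrite in_itv/= lt_min => /andP[Zz /andP[zy ze]].
have Gz : F y <= G (ratr z) by rewrite -hZ// ltW.
have : K / T%:R < (ratr z - y) ^+ 2.
  have := he (Z (F y) - ratr z); rewrite ltr0_norm ?subr_lt0// opprB ltrBlDl ze.
  by move=> /(_ isT); rewrite (_ : _ + _ = ratr z - y)//; ring.
move=> /near_y[r r0 hr]; have yz0 : 0 < y - ratr z by rewrite subr_gt0.
have m0 : 0 < Num.min r (y - ratr z) by rewrite lt_min r0.
have [q /= [uq qy]] := left_witness _ m0; rewrite lt_min => /andP[qr qz].
exists q, z => /=; split; first exact: hr.
right; split; first by move: qz; rewrite ltr_norml => /andP[h _]; lra.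
have /andP[h _] := steep (le_trans au uq) qy (le_trans yv vb).
apply: le_trans Gz; rewrite -subr_ge0; apply: le_trans h.
by rewrite mulr_ge0 ?(ltW l0)// subr_ge0.
Qed.

End rational_witnesses.

(** * Measurability of the two events *)

Section local_law.
Context (R : realType) (d : measure_display) (S : measurableType d) (val : S -> R).
Hypothesis hval : borel_embedding val.
Variable pi : {sigma_finite_measure set S -> \bar R}.
Variables a b : R.
Local Notation C := (`[a, b]%classic : set R).
Local Notation CS := (val @^-1` C).
Local Notation F := (local_cdf val pi C).

Lemma measurable_preimage_val B : measurable B -> measurable (val @^-1` B).
Proof. by move=> mB; rewrite hval.2; exists B => //; rewrite setTI. Qed.

Lemma measurable_below y : measurable (val @^-1` (C `&` `]-oo, y])).
Proof. by apply: measurable_preimage_val; apply: measurableI. Qed.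

(** A null set [C] would make the quotient that defines [F] equal to [0 / 0 = 0]. *)
Lemma local_cdf_nonzero : ~ (forall y, F y = 0) -> (0 < pi CS)%E.
Proof.
move=> F0; rewrite lt0e measure_ge0 andbT; apply/eqP => C0; apply: F0 => y.
by rewrite /local_cdf [X in _ / X](_ : _ = 0) ?invr0 ?mulr0//; exact: (congr1 fine C0).
Qed.

Hypothesis Cfin : pi CS \is a fin_num.

Let below_fin y : pi (val @^-1` (C `&` `]-oo, y])) \is a fin_num.
Proof.
rewrite ge0_fin_numE//; apply: (@le_lt_trans _ _ (pi CS)); last by rewrite -ge0_fin_numE.
apply: le_measure; rewrite ?inE; [exact: measurable_below|exact: measurable_preimage_val|].
by move=> x [].
Qed.

Lemma local_cdf_homo y z : y <= z -> F y <= F z.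
Proof.
move=> yz; rewrite /local_cdf ler_wpM2r ?invr_ge0 ?fine_ge0//; apply: (fine_le (below_fin y) (below_fin z)).
apply: le_measure; rewrite ?inE; [exact: measurable_below|exact: measurable_below|].
by move=> x [Cx xy]; split => //; move: xy; rewrite /= !in_itv/= => /le_trans; apply.
Qed.

Lemma local_cdf_ge0 y : 0 <= F y.
Proof. by rewrite divr_ge0 ?fine_ge0. Qed.

Lemma local_cdf_top : (0 < pi CS)%E -> F b = 1.
Proof.
move=> C0; rewrite /local_cdf (_ : C `&` `]-oo, b] = C).
  by rewrite divff// gt_eqF// fine_gt0// C0 -ge0_fin_numE.
by apply: setIidl => x; rewrite /= !in_itv/= => /andP[].
Qed.

End local_law.

Section empirical_statistics.
Context (R : realType) (d d' : measure_display) (S : measurableType d)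
  (Omega : measurableType d') (val : S -> R).
Hypothesis hval : borel_embedding val.
Variables (X : nat -> {mfun Omega >-> S}) (a b : R) (n : nat).
Local Notation C := (`[a, b]%classic : set R).
Local Notation CS := (val @^-1` C).
Local Notation Y := (fun (w : Omega) (t : nat) => val (X t w)).
Local Notation below y := (val @^-1` (C `&` `]-oo, y])).

Lemma nvisits_sum w : (nvisits C (Y w) n)%:R = \sum_(t < n.+1) \1_CS (X t w) :> R.
Proof.
by rewrite natr_sum; apply: eq_bigr => t _; rewrite indicE; congr (nat_of_bool _)%:R.
Qed.

Lemma visits_below_sum w y : (visits_below C (Y w) n y)%:R =
  \sum_(t < n.+1) \1_(below y) (X t w) :> R.
Proof.
rewrite natr_sum; apply: eq_bigr => t _; rewrite indicE; congr (nat_of_bool _)%:R.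
apply/idP/idP; rewrite !inE /=; first by move=> /andP[]; rewrite inE => h1 h2; split.
by move=> [h1]; rewrite in_itv/= => h2; rewrite h2 andbT inE.
Qed.

Lemma measurable_indic_sum (A : set S) : measurable A ->
  measurable_fun setT (fun w => \sum_(t < n.+1) \1_A (X t w) : R).
Proof.
move=> mA; apply: measurable_sum => t.
by apply: measurableT_comp => //; exact: measurable_indic.
Qed.

Lemma measurable_nvisits k : measurable [set w | nvisits C (Y w) n = k].
Proof.
have mT := measurable_indic_sum (measurable_preimage_val hval (measurable_itv `[a, b])).
rewrite (_ : [set _ | _] = (fun w => \sum_(t < n.+1) \1_CS (X t w) : R) @^-1` [set k%:R]).
  by rewrite -[X in measurable X]setTI; exact: mT.
apply/seteqP; split => w /=; rewrite -nvisits_sum; first by move=> ->.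
by move/eqP; rewrite eqr_nat => /eqP.
Qed.

Lemma measurable_nvisits_fun : measurable_fun setT (fun w => (nvisits C (Y w) n)%:R : R).
Proof.
rewrite (_ : (fun w => _) = fun w => \sum_(t < n.+1) \1_CS (X t w)); last first.
  by apply/funext => w; exact: nvisits_sum.
exact: measurable_indic_sum (measurable_preimage_val hval (measurable_itv `[a, b])).
Qed.

Lemma measurable_emp_cdf y : measurable_fun setT (fun w => emp_cdf C (Y w) n y).
Proof.
rewrite (_ : (fun w => _) = fun w =>
    (\sum_(t < n.+1) \1_(below y) (X t w)) / (nvisits C (Y w) n)%:R); last first.
  by apply/funext => w; rewrite emp_cdfE visits_below_sum.
pose f k (w : Omega) : R := (\sum_(t < n.+1) \1_(below y) (X t w)) / k%:R.
have mf k : measurable_fun setT (f k).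
  by apply: measurable_funM => //; exact: measurable_indic_sum (measurable_below hval a b y).
have h := measurable_select measurable_nvisits mf.
exact: h.
Qed.

Lemma measurable_visited : measurable [set w | (0 < nvisits C (Y w) n)%N].
Proof.
have := measurable_fun_nat measurable_nvisits measurableT (Y := [set k | (0 < k)%N]).
by rewrite setTI; apply.
Qed.

Lemma measurable_lt_set (f g : Omega -> R) : measurable_fun setT f -> measurable_fun setT g ->
  measurable [set w | f w < g w].
Proof.
move=> mf mg; rewrite (_ : [set _ | _] = ~` [set w | g w <= f w]).
  by apply: measurableC; exact: measurable_le_fun.
by apply/seteqP; split => w /=; rewrite ltNge => /negP.
Qed.

Variables (l L : R) (F : R -> R).
Hypotheses (l0 : 0 < l)
  (steep : forall y z, a <= y -> y <= z -> z <= b -> l * (z - y) <= F z - F y <= L * (z - y)).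
Variables (u v K : R).
Hypotheses (au : a <= u) (uv : u <= v) (vb : v <= b) (K0 : 0 <= K).

Let mstat (f : Omega -> R) : measurable_fun setT f ->
  measurable_fun setT (fun w => (nvisits C (Y w) n)%:R * f w ^+ 2 : R).
Proof.
move=> mf; apply: measurable_funM; first exact: measurable_nvisits_fun.
exact: measurable_funX.
Qed.

(** The supremum is over uncountably many points, but [deviation_rational] turns the
    event into a countable union. *)
Lemma measurable_deviation_event : measurable [set w | (0 < nvisits C (Y w) n)%N /\
  exists2 y, u <= y <= v &
    K < (nvisits C (Y w) n)%:R * (emp_cdf C (Y w) n y - F y) ^+ 2].
Proof.
rewrite (_ : [set _ | _] = [set w | (0 < nvisits C (Y w) n)%N] `&`
  \bigcup_(q : rat) [set w | K < (nvisits C (Y w) n)%:R *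
    (emp_cdf C (Y w) n (rational_or u v v q) - F (rational_or u v v q)) ^+ 2]).
  apply: measurableI; first exact: measurable_visited.
  apply: bigcupT_measurable_rat => q; apply: measurable_lt_set => //.
  by apply: mstat; apply: measurable_funB => //; exact: measurable_emp_cdf.
apply/seteqP; split => w [T0].
  by move=> /(deviation_rational l0 steep T0 K au uv vb)[q hq]; split => //; exists q.
by move=> [q _ hq]; split => //; apply/(deviation_rational l0 steep T0 K au uv vb); exists q.
Qed.

Variable Z : Omega -> R -> R.
Hypothesis hZ : forall w y, (0 < nvisits C (Y w) n)%N -> u <= y <= v ->
  forall z, (Z w (F y) <= z) = (F y <= emp_cdf C (Y w) n z).

Lemma measurable_quantile_event : measurable [set w | (0 < nvisits C (Y w) n)%N /\
  exists2 y, u <= y <= v &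
    K < (nvisits C (Y w) n)%:R * (Z w (F y) - y) ^+ 2].
Proof.
pose t q := rational_or u v u q.
rewrite (_ : [set _ | _] = [set w | (0 < nvisits C (Y w) n)%N] `&`
  \bigcup_(q : rat) \bigcup_(z : rat)
    ([set w | K < (nvisits C (Y w) n)%:R * (ratr z - t q) ^+ 2] `&`
     (([set w | t q < ratr z] `&` [set w | emp_cdf C (Y w) n (ratr z) < F (t q)]) `|`
      ([set w | ratr z < t q] `&` [set w | F (t q) <= emp_cdf C (Y w) n (ratr z)])))).
  apply: measurableI; first exact: measurable_visited.
  apply: bigcupT_measurable_rat => q; apply: bigcupT_measurable_rat => z.
  apply: measurableI; first by apply: measurable_lt_set => //; exact: mstat.
  by apply: measurableU; apply: measurableI;
    first [exact: measurable_lt_set|apply: measurable_lt_set => //; exact: measurable_emp_cdf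
          |apply: measurable_le_fun => //; exact: measurable_emp_cdf].
apply/seteqP; split => w [T0].
  move=> /(quantile_rational l0 steep T0 K0 au uv vb (fun y => @hZ w y T0))[q [z [h1 h2]]].
  by split => //; exists q => //; exists z.
move=> [q _ [z _ [h1 h2]]]; split => //.
by apply/(quantile_rational l0 steep T0 K0 au uv vb (fun y => @hZ w y T0)); exists q, z.
Qed.

End empirical_statistics.

(** * Tightness of the empirical process and of its inverse *)

Section empirical_ends.
Context (R : realType).
Variables (a b : R) (x : nat -> R) (n : nat).
Local Notation C := (`[a, b]%classic : set R).

Lemma emp_cdf_right : (0 < nvisits C x n)%N -> emp_cdf C x n b = 1.
Proof.
move=> T0; rewrite emp_cdfE (_ : visits_below C x n b = nvisits C x n).
  by rewrite divff// pnatr_eq0 -lt0n.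
apply: eq_bigr => t _; congr nat_of_bool; case: (boolP (x t \in C)) => //=.
by rewrite inE /= in_itv/= => /andP[].
Qed.

Lemma emp_cdf_left z : z < a -> emp_cdf C x n z = 0.
Proof.
move=> za; rewrite emp_cdfE (_ : visits_below C x n z = 0%N) ?mul0r//.
apply: big1 => t _; case: (boolP (x t \in C)) => //=.
rewrite inE /= in_itv/= => /andP[ax _].
by rewrite leNgt (lt_le_trans za ax).
Qed.

End empirical_ends.

Section uniform_bounds.
Context (R : realType) (d : measure_display) (S : measurableType d) (val : S -> R).
Hypothesis hval : borel_embedding val.
Context (d' : measure_display) (Omega : measurableType d') (Pr : probability Omega R).
Variables (P : R.-pker S ~> S) (psi : {measure set S -> \bar R})
  (pi : {sigma_finite_measure set S -> \bar R}) (s : S -> R) (nu : probability S R).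
Variables (X : nat -> {mfun Omega >-> S}) (xi : nat -> {mfun Omega >-> bool}).
Hypotheses (hpsi : irreducibility_measure P psi) (hpi : invariant_measure P pi)
  (hmin : minorized P s nu) (hsplit : split_chain X xi P s nu Pr).
Variables a b : R.
Hypothesis ab : a < b.
Local Notation C := (`[a, b]%classic : set R).
Local Notation CS := (val @^-1` C).
Local Notation F := (local_cdf val pi C).
Local Notation Y := (fun (w : Omega) (t : nat) => val (X t w)).
Hypothesis hblock : (\int[Pr]_w (@block_visits R _ _ _ _ X xi CS 1 w) ^+ 2 < +oo)%E.
Hypothesis piC : (0 < pi CS)%E.
Variables l L : R.
Hypothesis l0 : 0 < l.
Hypothesis steep :
  forall y z, a <= y -> y <= z -> z <= b -> l * (z - y) <= F z - F y <= L * (z - y).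

(** On the grid of half-lines the centered count is [T_n (F_n - F)]. *)
Lemma deviation_below (y : nat -> R) i n w : (0 < nvisits C (Y w) n)%N ->
  \sum_(t < n.+1) deviation CS (fun i => val @^-1` (C `&` `]-oo, y i]))
    (fun i => F (y i)) i (X t w) =
  (nvisits C (Y w) n)%:R * (emp_cdf C (Y w) n (y i) - F (y i)).
Proof.
move=> T0; rewrite sumrB -visits_below_sum -mulr_sumr -nvisits_sum mulrBr emp_cdfE.
by rewrite [X in _ = X - _]mulrC divfK ?(mulrC (F _))// pnatr_eq0 -lt0n.
Qed.

(** The mesh of the grid is chosen so that [F] moves by at most [1 / (n + 1)] between
    neighbours; as [T_n <= n + 1], the passage from the grid to all points
    costs a bounded amount. *)
Lemma empirical_process_bound eta : 0 < eta ->
  exists K : R, 0 <= K /\ exists n0 : nat, forall n, (n0 <= n)%N ->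
  exists Bad : set Omega, [/\ measurable Bad, (Pr Bad <= eta%:E)%E &
    forall w, ~ Bad w -> forall y, a <= y <= b ->
      (nvisits C (Y w) n)%:R * (emp_cdf C (Y w) n y - F y) ^+ 2 <= K].
Proof.
move=> eta0; have mCS : measurable CS := measurable_preimage_val hval (measurable_itv `[a, b]).
have [Kc [n0 h]] := empirical_deviation hmin hsplit mCS hblock hpsi hpi piC eta0.
pose K := Num.max 0 Kc; have K0 : 0 <= K by rewrite /K le_max lexx.
exists (2 * K + 2); split; first by rewrite addr_ge0// mulr_ge0.
exists n0 => n /h{}h.
pose k := (Num.trunc (L * (b - a) * n.+1%:R)).+1.
have kL : L * ((b - a) / k%:R) <= n.+1%:R^-1.
  rewrite mulrA ler_pdivrMr ?ltr0n// [leRHS]mulrC ler_pdivlMr ?ltr0n//; apply: ltW.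
  exact: truncnS_gt.
have n0' : 0 < n.+1%:R :> R by rewrite ltr0n.
pose y := grid_point a b k; pose A i := val @^-1` (C `&` `]-oo, y i]).
have yk : y k.+1 = b by exact: (grid_point_top a b (ltn0Sn _)).
have [||Bad [mBad PrBad good]] := h k.+1 A.
- split.
  + by move=> i; exact: measurable_below.
  + apply/seteqP; split => // x [/=]; rewrite !in_itv/= => /andP[ax _].
    by move=> /(le_trans ax); rewrite lerBrDl gerDr ler10.
  + move=> i j ij x [Cx xi']; split => //; move: xi'; rewrite /= !in_itv/=.
    by move=> /le_trans; apply; exact: (grid_point_homo ab).
  + apply/seteqP; split => x; first by case.
    move=> Cx; split => //; suff : val x <= y k.+1 by rewrite [X in _ -> X]/= in_itv.
    by rewrite yk; move: Cx; rewrite /= in_itv/= => /andP[].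
- by move=> i x [].
exists Bad; split => // w /good[T0 dev].
move: T0; rewrite -nvisits_sum ltr0n => T0; have Tr : 0 < (nvisits C (Y w) n)%:R :> R by rewrite ltr0n.
apply: (grid_deviation ab l0 steep (ltn0Sn _) _ _ kL) => //.
- by move=> u v; exact: emp_cdf_homo.
- rewrite exprVn ler_pdivrMr ?exprn_gt0// mul1r.
  apply: (@le_trans _ _ n.+1%:R); last by rewrite expr2 ler_peMr// ler1n.
  rewrite ler_nat /nvisits; apply: (@leq_trans (\sum_(t < n.+1) 1)%N).
    by apply: leq_sum => t _; case: (_ \in _).
  by rewrite sum_nat_const card_ord muln1.
move=> i im; have := dev i im.
rewrite -[X in X ^+ 2 <= _]/(\sum_(t < n.+1) deviation CS A (fun i => F (y i)) i (X t w)).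
rewrite (deviation_below y i T0) -nvisits_sum exprMn expr2 -mulrA mulrC.
rewrite ler_pM2r// => /le_trans; apply.
by rewrite /K le_max lexx orbT.
Qed.

End uniform_bounds.

Theorem lemma5p3 (R : realType)
  (d : measure_display) (S : measurableType d) (val : S -> R)
  (hval : borel_embedding val)
  (P : R.-pker S ~> S)
  (psi pi : {sigma_finite_measure set S -> \bar R})
  (s : S -> R) (nu : probability S R)
  (d' : measure_display) (Omega : measurableType d')
  (Pr : probability Omega R)
  (X : nat -> {mfun Omega >-> S}) (xi : nat -> {mfun Omega >-> bool})
  (f0 : R -> R) (x0 delta : R)
  (hX : markov_chain P Pr X)
  (* (1) *)
  (hpsi : maximal_irreducibility_measure P psi)
  (haper : aperiodic P psi)
  (hharris : harris_recurrent P psi)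
  (hpi : invariant_measure P pi)
  (hrec : positive_recurrent pi \/
     exists beta : R, 0 < beta < 1 /\ beta_null_recurrent P psi pi beta)
  (hmin : minorized P s nu)
  (hsplit : split_chain X xi P s nu Pr)
  (* (2) *)
  (hdelta : 0 < delta)
  (C := `[x0 - delta, x0 + delta]%classic : set R)
  (hCE : C `<=` range val)
  (hC : small_set P psi (val @^-1` C))
  (* (3) *)
  (hsupp : (measure_support val pi)° x0)
  (* (4) *)
  (F := local_cdf val pi C)
  (hf0 : forall y z : R, y <= z -> f0 z <= f0 y)
  (hf0' : bounded_derivative_on C f0)
  (hF' : bounded_derivative_on C F)
  (* (5) *)
  (hblock : (\int[Pr]_w (block_visits X xi (val @^-1` C) 1 w) ^+ 2 < +oo)%E)
  (Y := fun (w : Omega) (t : nat) => val (X t w))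
  (Y0 : nat -> {mfun Omega >-> R})
  (hY0 : forall n w, visited C (Y w) n != [::] ->
     Y0 n w < head 0 (visited C (Y w) n))
  (Finv := 'pinv_(fun=> x0) C F) :
  \forall eps \near 0^'+,
    bounded_in_probability Pr (fun n w =>
      (nvisits C (Y w) n)%:R%:E *
      ereal_sup [set (`|emp_cdf C (Y w) n y - F y|%R ^+ 2)%R%:E
                | y in [set y | (`|y - x0| <= eps)%R]])%E /\
    bounded_in_probability Pr (fun n w =>
      (nvisits C (Y w) n)%:R%:E *
      ereal_sup [set (`|emp_inv C (Y w) n (Y0 n w) p - Finv p|%R ^+ 2)%R%:E
                | p in [set p | (`|p - F x0| <= eps)%R]])%E.
Proof.
set a := x0 - delta in C F hCE hC hf0' hF' hblock hY0 Finv *.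
set b := x0 + delta in C F hCE hC hf0' hF' hblock hY0 Finv *.
have ab : a < b by rewrite /a /b; lra.
have mCS : measurable (val @^-1` C) := measurable_preimage_val hval (measurable_itv `[a, b]).
have piC : (0 < pi (val @^-1` C))%E.
  by apply: local_cdf_nonzero; exact: bounded_derivative_nonconstant ab hF'.
have Cfin : pi (val @^-1` C) \is a fin_num.
  exact: (measure_small_fin hmin hsplit mCS hblock hpsi.1 hpi).
have Fhomo : forall y z, y <= z -> F y <= F z by exact: (local_cdf_homo hval Cfin).
have [l [L [l0 steep]]] := bounded_slope ab Fhomo hF'.
have bound := empirical_process_bound hval hpsi.1 hpi hmin hsplit ab hblock piC l0 steep.
have Fb : F b = 1 by exact: local_cdf_top Cfin piC.
have Fc : {within C, continuous F}.
  have [df [? [? [_ hdf]]]] := hF'.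
  by apply: (@derivative_within_continuous _ _ _ _ df) => y /hdf[].
have ax0 : a <= x0 by rewrite /a; lra.
have x0b : x0 <= b by rewrite /b; lra.
have Fx0 : F a + l * delta <= F x0 <= F b - l * delta.
  have /andP[h1 _] := steep _ _ (lexx a) ax0 x0b.
  have /andP[h2 _] := steep _ _ ax0 x0b (lexx b).
  have e1 : x0 - a = delta by rewrite /a; ring.
  have e2 : b - x0 = delta by rewrite /b; ring.
  by rewrite e1 in h1; rewrite e2 in h2; apply/andP; split; lra.
have Finc y z : a <= y -> y < z -> z <= b -> F y < F z.
  move=> ay yz zb; have /andP[h1 _] := steep _ _ ay (ltW yz) zb.
  by rewrite -subr_gt0 (lt_le_trans _ h1)// mulr_gt0// subr_gt0.
have Fle y z : a <= y <= b -> a <= z <= b -> F y <= F z -> y <= z.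
  move=> /andP[_ yb] /andP[az _] Fyz; rewrite leNgt; apply/negP => /(Finc _ _ az)/(_ yb).
  by rewrite ltNge Fyz.
have FinvK q : a <= q <= b -> Finv (F q) = q.
  move=> qab; apply: pinvKV; last by rewrite inE.
  move=> y z; rewrite !inE => yC zC Fyz.
  by apply: le_anti; apply/andP; split; apply: Fle => //; rewrite Fyz.
have Fsurj p : F a <= p <= F b -> exists2 q, a <= q <= b & F q = p.
  move=> pab; have [|q] := IVT (ltW ab) Fc (v := p); last by rewrite in_itv/=; exists q.
  by rewrite (min_idPl _) ?(max_idPr _)// Fhomo// ltW.
have Fa : 0 <= F a by exact: local_cdf_ge0.
(* once the event is measurable, it suffices to include it in a small one *)
have bounded (Z : nat -> Omega -> \bar R) :
    (forall eta, 0 < eta -> exists K : R, exists n0 : nat, forall n, (n0 <= n)%N ->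
      measurable [set w | (K%:E < `|Z n w|)%E] /\
      exists Bad : set Omega, [/\ measurable Bad, (Pr Bad <= eta%:E)%E &
        forall w, ~ Bad w -> ~ (K%:E < `|Z n w|)%E]) -> bounded_in_probability Pr Z.
  move=> h eta /h[K [n0 hK]]; exists K; exists n0 => // n /= /hK[mE [Bad [mB PB good]]].
  apply: le_trans PB; apply: le_measure; rewrite ?inE// => w Zw.
  by apply: contrapT => /good.
(* l * delta keeps the levels within eps of F x0 inside the range of F on C *)
near=> eps.
have eps0 : 0 < eps by near: eps; exact: nbhs_right_gt.
have epsd : eps < delta by near: eps; exact: nbhs_right_lt.
have epsl : eps < l * delta by near: eps; apply: nbhs_right_lt; exact: mulr_gt0.
have [Fx1 Fx2] := andP Fx0.
split; apply: bounded => eta /bound[K [K0 [n0 hK]]].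
  exists K, n0 => n /hK[Bad [mBad PBad good]].
  have iE w : (K%:E < `|(nvisits C (Y w) n)%:R%:E *
      ereal_sup [set (`|emp_cdf C (Y w) n y - F y|%R ^+ 2)%R%:E
                | y in [set y | (`|y - x0| <= eps)%R]]|)%E <->
      (0 < nvisits C (Y w) n)%N /\ exists2 y, x0 - eps <= y <= x0 + eps &
        K < (nvisits C (Y w) n)%:R * (emp_cdf C (Y w) n y - F y) ^+ 2.
    rewrite scaled_sup_gt//; last by exists x0; rewrite /= subrr normr0 ltW.
    by split=> -[T0 [y hy Ky]]; split => //; exists y => //; move: hy; rewrite /= ler_distl.
  have au : a <= x0 - eps by rewrite /a; lra.
  have vb : x0 + eps <= b by rewrite /b; lra.
  split.
    rewrite (_ : [set w | _] = [set w | (0 < nvisits C (Y w) n)%N /\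
      exists2 y, x0 - eps <= y <= x0 + eps &
        K < (nvisits C (Y w) n)%:R * (emp_cdf C (Y w) n y - F y) ^+ 2]).
      by apply: (measurable_deviation_event hval X n l0 steep) => //; lra.
    by apply/seteqP; split => w /= /iE.
  exists Bad; split => // w /good{}good /iE[_ [y /andP[y1 y2]]].
  by apply/negP; rewrite -leNgt good// (le_trans au y1) (le_trans y2 vb).
have [q1 q1ab Fq1] : exists2 q, a <= q <= b & F q = F x0 - eps.
  by apply: Fsurj; apply/andP; split; lra.
have [q2 q2ab Fq2] : exists2 q, a <= q <= b & F q = F x0 + eps.
  by apply: Fsurj; apply/andP; split; lra.
have q12 : q1 <= q2 by apply: Fle => //; rewrite Fq1 Fq2; lra.
exists (K / l ^+ 2), n0 => n /hK[Bad [mBad PBad good]].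
have K'0 : 0 <= K / l ^+ 2 by rewrite divr_ge0// sqr_ge0.
have [aq1 q1b] := andP q1ab; have [aq2 q2b] := andP q2ab.
have Fq q : q1 <= q <= q2 -> 0 < F q <= 1.
  move=> /andP[h1 h2]; have := Fhomo _ _ h1; have := Fhomo _ _ h2.
  by rewrite Fq1 Fq2 => h3 h4; apply/andP; split; lra.
pose Z w p := emp_inv C (Y w) n (Y0 n w) p.
have hZ w q : (0 < nvisits C (Y w) n)%N -> q1 <= q <= q2 ->
    forall z, (Z w (F q) <= z) = (F q <= emp_cdf C (Y w) n z).
  by move=> T0 /Fq Fq01 z; apply: emp_inv_le => //; exact: hY0.
have iE w : ((K / l ^+ 2)%:E < `|(nvisits C (Y w) n)%:R%:E *
      ereal_sup [set (`|emp_inv C (Y w) n (Y0 n w) p - Finv p|%R ^+ 2)%R%:E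
                | p in [set p | (`|p - F x0| <= eps)%R]]|)%E <->
    (0 < nvisits C (Y w) n)%N /\ exists2 q, q1 <= q <= q2 &
      K / l ^+ 2 < (nvisits C (Y w) n)%:R * (Z w (F q) - q) ^+ 2.
  rewrite scaled_sup_gt//; last by exists (F x0); rewrite /= subrr normr0 ltW.
  split=> -[T0 [y hy Ky]]; split => //.
    move: hy Ky; rewrite /= ler_distl => /andP[h1 h2].
    have [|q qab Fqy] := Fsurj y; first by apply/andP; split; lra.
    rewrite -Fqy in h1 h2 *; rewrite FinvK// => Ky; exists q => //.
    by apply/andP; split; apply: Fle => //; rewrite ?Fq1 ?Fq2.
  have yab : a <= y <= b by case/andP: hy => h1 h2; rewrite (le_trans aq1 h1) (le_trans h2 q2b).
  exists (F y); last by rewrite FinvK.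
  by rewrite /= ler_distl -Fq1 -Fq2; case/andP: hy => h1 h2; rewrite !Fhomo.
split.
  rewrite (_ : [set w | _] = [set w | (0 < nvisits C (Y w) n)%N /\
    exists2 q, q1 <= q <= q2 &
      K / l ^+ 2 < (nvisits C (Y w) n)%:R * (Z w (F q) - q) ^+ 2]).
    exact: (measurable_quantile_event hval l0 steep aq1 q12 q2b K'0 hZ).
  by apply/seteqP; split => w /= /iE.
exists Bad; split => // w /good{}good /iE[T0 [q q12' Kq]].
have Tr : 0 < (nvisits C (Y w) n)%:R :> R by rewrite ltr0n.
have qab : a <= q <= b by case/andP: q12' => h1 h2; rewrite (le_trans aq1 h1) (le_trans h2 q2b).
pose D := Num.sqrt (K / (nvisits C (Y w) n)%:R).
have D0 : 0 <= D := sqrtr_ge0 _.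
have D2 : D ^+ 2 = K / (nvisits C (Y w) n)%:R by rewrite sqr_sqrtr// divr_ge0.
have hD y : a <= y <= b -> `|emp_cdf C (Y w) n y - F y| <= D.
  move=> /good h; rewrite -ler_sqr ?nnegrE// real_normK ?num_real// D2 ler_pdivlMr//.
  by rewrite mulrC.
have Zq : `|Z w (F q) - q| <= D / l.
  apply: (quantile_deviation l0 steep qab hD (hZ _ _ T0 q12')).
  - by rewrite emp_cdf_right//; have /andP[] := Fq q q12'.
  - by move=> z za; rewrite emp_cdf_left//; have /andP[] := Fq q q12'.
move: Kq; apply/negP; rewrite -leNgt.
have : `|Z w (F q) - q| ^+ 2 <= (D / l) ^+ 2 by rewrite ler_sqr ?nnegrE// divr_ge0// ltW.
rewrite real_normK ?num_real// expr_div_n D2 => h.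
by rewrite -ler_pdivlMl// mulrA [_^-1 * K]mulrC.
Unshelve. all: by end_near.
Qed.
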